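(* Let $R_{N,k}$ be the $k$-point correlation function of the rescaled system $\{z_j\}_1^N$ (at inverse temperature $\beta=1$) defined in the context. Then for every $k\ge 1$ and all $z_1,\dots,z_k\in\mathbb{C}$, $$\lim_{N\to\infty}R_{N,k}(z_1,\dots,z_k)=\det\big(K^{(\alpha)}(z_i,z_j)\big)_{i,j=1}^k,$$ where $$K^{(\alpha)}(z,w)=(2\operatorname{Re}z)^{\alpha/2}(2\operatorname{Re}w)^{\alpha/2}\int_0^1\frac{t^{\alpha+1}}{\Gamma(\alpha+1)}\,e^{-t(z+\bar w)}\,dt\cdot\mathbf{1}_{\mathbb{H}_+}(z)\,\mathbf{1}_{\mathbb{H}_+}(w),$$ and $\mathbb{H}_+=\{z\in\mathbb{C}:\operatorname{Re}z>0\}$ (so $K^{(\alpha)}(z,w)=0$ unless both $z,w\in\mathbb{H}_+$). The convergence is uniform for $z_1,\dots,z_k$ in any compact subset of $\mathbb{H}_+$.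
   Context: Notation: $dA=dx\,dy/\pi$ is Lebesgue measure on $\mathbb{C}$ divided by $\pi$; $D(p,r)$ is the open disk with center $p$ and radius $r$. Potential. $Q:\mathbb{C}\to\mathbb{R}\cup\{+\infty\}$ is lower semicontinuous, finite on a set of positive area, and satisfies $\liminf_{|\zeta|\to\infty}Q(\zeta)/\log|\zeta|^2>1$. Moreover $Q$ is radially symmetric, $Q(\zeta)=q(|\zeta|)$, $Q$ is subharmonic on $\mathbb{C}$, and $q$ is differentiable on $(0,\infty)$ with absolutely continuous derivative. Let $\rho_0$ be the smallest number such that $q'(r)>0$ for all $r>\rho_0$, and $\rho_1$ the smallest number such that $\rho_1q'(\rho_1)=2$. Fix $\rho_*$ with $\rho_0<\rho_*<\rho_1$, put $\mathcal{D}=D(0,\rho_* )$ and $\tau_*=\tfrac12\rho_*q'(\rho_* )$, and assume that $Q$ is strictly subharmonic in a neighborhood of $\partial\mathcal{D}$ (so $rq'(r)$ is strictly increasing near $r=\rho_*$). Perturbed localized potential. Fix $\alpha>-1$ and a smooth, real-valued, radially symmetric function $h$ on $\mathbb{C}$ with $h=0$ on $\{|\zeta|=\rho_*\}$. Set $Q_N(\zeta)=Q(\zeta)-\frac{\alpha}{N}\log(\rho_*-|\zeta|)-\frac1N h(\zeta)$ for $\zeta\in\mathcal{D}$, and let $Q_N^{\mathcal{D}}=Q_N$ on $\mathcal{D}$ and $Q_N^{\mathcal{D}}=+\infty$ on $\mathbb{C}\setminus\mathcal{D}$ (with $e^{-\infty}=0$). Coulomb gas. $\{\zeta_j\}_1^N$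 is a random configuration whose joint density with respect to $dA(\zeta_1)\cdots dA(\zeta_N)$ is $\mathbf{P}_N=\frac1{Z_N}e^{-H_N}$, $H_N(\zeta_1,\dots,\zeta_N)=-\sum_{j\ne k}\log|\zeta_j-\zeta_k|+N\sum_{j=1}^NQ_N^{\mathcal{D}}(\zeta_j)$, with $Z_N$ the normalizing constant. Its $k$-point correlation function is $\mathbf{R}_{N,k}(\zeta_1,\dots,\zeta_k)=\frac{N!}{(N-k)!}\int_{\mathbb{C}^{N-k}}\mathbf{P}_N(\zeta_1,\dots,\zeta_N)\,dA(\zeta_{k+1})\cdots dA(\zeta_N)$. Rescaling. Fix $p\in\partial\mathcal{D}$, let $\mathrm{n}$ be the unit inward normal to $\partial\mathcal{D}$ at $p$, and let $\gamma_N=\frac{\rho_*}{N(1-\tau_* )}$. The rescaled system $\{z_j\}_1^N$ is defined by $\zeta_j=p+\mathrm{n}\,\gamma_Nz_j$, so its $k$-point correlation function is $R_{N,k}(z_1,\dots,z_k)=\gamma_N^{2k}\,\mathbf{R}_{N,k}(p+\mathrm{n}\gamma_Nz_1,\dots,p+\mathrm{n}\gamma_Nz_k)$. *)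

(* Defs.v *)
From HB Require Import structures.
From mathcomp Require Import all_boot all_order all_algebra.
From mathcomp Require Import all_classical all_reals all_analysis.
From mathcomp Require Export complex.

Set Implicit Arguments.
Unset Strict Implicit.
Unset Printing Implicit Defensive.

Import Order.TTheory GRing.Theory Num.Theory numFieldNormedType.Exports.
Import Normc.

Local Open Scope classical_set_scope.
Local Open Scope ring_scope.
Local Open Scope complex_scope.

(* The complex plane is [R[i]]; its topology (from the modulus) is carried by
   the alias [R[i]^o].  [normc z : R] is the real-valued modulus. *)

Section Plane.
Variable R : realType.
Implicit Types (a r x : R) (z w : R[i]).

Definition of_pair (u : R * R) : R[i] := u.1 +i* u.2.

Definition expc z : R[i] :=
  (expR (complex.Re z))%:C * (cos (complex.Im z) +i* sin (complex.Im z)).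

(* dA = dx dy / pi *)
Definition dA : {measure set (measurableTypeR R * measurableTypeR R) -> \bar R} :=
  mscale ((NngNum (pi_ge0 R))%:num^-1)%:nng
    ((@lebesgue_measure R) \x (@lebesgue_measure R))%E.

Fixpoint iterated_int (n : nat) (F : seq R[i] -> \bar R) : \bar R :=
  if n is m.+1 then
    (\int[dA]_u iterated_int m (fun s => F (of_pair u :: s)))%E
  else F [::].

Definition infinity_filter : set_system R[i]^o :=
  filter_from setT (fun M : R => [set z | M < normc z]).

Definition is_least (S : set R) x := S x /\ lbound S x.

End Plane.

Section Regularity.
Variable R : realType.
Implicit Types (U : set R[i]^o) (u : R[i] -> \bar R) (f : R -> R).

Definition closed_disk (c : R[i]) (r : R) : set R[i] :=
  [set z | normc (z - c) <= r].

Definition circle_mean u (c : R[i]) (r : R) : \bar R :=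
  ((2 * pi)^-1%:E *
   \int[lebesgue_measure]_(t in `[0%R, (2 * pi)%R])
     u (c + r%:C * (cos t +i* sin t))%R)%E.

Definition upper_semicontinuous_on U u :=
  forall z, U z -> forall a : R, (u z < a%:E)%E ->
    \forall w \near (z : R[i]^o), (u w < a%:E)%E.

Definition subharmonic_on U u :=
  [/\ forall z, U z -> (u z < +oo)%E,
      upper_semicontinuous_on U u &
      forall c r, 0 < r -> closed_disk c r `<=` U ->
        (u c <= circle_mean u c r)%E].

(* Strictness for functions that need not be C^2: the strict sub-mean value
   inequality (for C^2 functions it follows from a positive Laplacian). *)
Definition strictly_subharmonic_on U u :=
  subharmonic_on U u /\
  forall c r, 0 < r -> closed_disk c r `<=` U -> (u c < circle_mean u c r)%E.

Definition absolutely_continuous_on (a b : R) f :=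
  forall eps, 0 < eps -> exists2 delta, 0 < delta &
    forall (n : nat) (x y : 'I_n -> R),
      (forall i, a <= x i /\ x i <= y i /\ y i <= b) ->
      (forall i j, i != j -> y i <= x j \/ y j <= x i) ->
      \sum_(i < n) (y i - x i) < delta ->
      \sum_(i < n) `|f (y i) - f (x i)| < eps.

(* C^infinity: all iterated directional derivatives are differentiable. *)
Definition smooth (f : R * R -> R) :=
  forall (s : seq (R * R)) (u : R * R),
    differentiable (foldr (fun v g => 'D_v g) f s) u.

End Regularity.

Section Gas.
Variable R : realType.
Variables (Q : R[i] -> \bar R) (rho alpha : R) (h : R[i] -> R).

Definition QN (N : nat) (z : R[i]) : \bar R :=
  (Q z - (alpha / N%:R * ln (rho - normc z))%:E - (h z / N%:R)%:E)%E.

Definition QND (N : nat) (z : R[i]) : \bar R :=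
  if normc z < rho then QN N z else +oo%E.

(* [lne 0 = -oo], so coinciding points have infinite energy. *)
Definition energy (N : nat) (s : seq R[i]) : \bar R :=
  (- (\sum_(j < N) \sum_(k < N | k != j)
        lne (normc (nth 0 s j - nth 0 s k))%:E)
   + N%:R%:E * \sum_(j < N) QND N (nth 0%R s j))%E.

Definition partition_function (N : nat) : \bar R :=
  iterated_int N (fun s => expeR (- energy N s)).

Definition joint_density (N : nat) (s : seq R[i]) : \bar R :=
  (expeR (- energy N s) / partition_function N)%E.

(* Meaningful for k <= N only: [N - k] is truncated. *)
Definition correlation (N k : nat) (z : k.-tuple R[i]) : \bar R :=
  ((N`!%:R / (N - k)`!%:R)%:E *
   iterated_int (N - k) (fun s => joint_density N (z ++ s)))%E.

End Gas.

Section Rescaling.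
Variable R : realType.
Variables (Q : R[i] -> \bar R) (q : R -> \bar R).
Variables (rho alpha : R) (h : R[i] -> R) (p : R[i]).

Definition dq : R -> R := derive1 (fine \o q).

Definition tau : R := rho * dq rho / 2.

Definition gamma_ (N : nat) : R := rho / (N%:R * (1 - tau)).

(* unit inward normal at p to the circle |z| = rho *)
Definition normal : R[i] := - (p / rho%:C).

Definition rescaled_correlation (N k : nat) (z : k.-tuple R[i]) : R :=
  gamma_ N ^+ (2 * k) *
  fine (correlation Q rho alpha h N
          [tuple p + normal * (gamma_ N)%:C * tnth z i | i < k]).

End Rescaling.

Section Kernel.
Variable R : realType.

Definition Gamma (s : R) : R :=
  \int[lebesgue_measure]_(x in `]0, +oo[) (x `^ (s - 1) * expR (- x)).

Definition half_plane : set R[i] := [set z | 0 < complex.Re z].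

Definition complex_integral (a b : R) (f : R -> R[i]) : R[i] :=
  (\int[lebesgue_measure]_(t in `[a, b]) complex.Re (f t)) +i*
  (\int[lebesgue_measure]_(t in `[a, b]) complex.Im (f t)).

Definition limit_kernel (alpha : R) (z w : R[i]) : R[i] :=
  ((2 * complex.Re z) `^ (alpha / 2) * (2 * complex.Re w) `^ (alpha / 2))%:C *
  complex_integral 0 1 (fun t =>
    (t `^ (alpha + 1) / Gamma (alpha + 1))%:C *
    expc (- (t%:C * (z + conjc w)))) *
  (\1_half_plane z * \1_half_plane w)%:C.

Definition limit_correlation (alpha : R) (k : nat) (z : k.-tuple R[i]) : R[i] :=
  \det (\matrix_(i < k, j < k) limit_kernel alpha (tnth z i) (tnth z j)).

End Kernel.

(* Main.v *)
(* The weight is radial, so the monomials are orthogonal and the correlations are determinants of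
   [K_N(z, w) = sum_(n < N) sqrt(w(z) w(w)) (z conj(w))^n / c_n], where [c_n] is the [n]-th moment
   of the weight in the variable [y = |z|^2].  In [c_n] substitute [y = rho^2 (1 - s / N)]: if
   [n / N -> x > tau], dominated convergence shows that [c_n / rho^(2n)], divided by a factor
   depending only on [N], tends to [2^(-alpha) Gamma(alpha + 1) (x - tau)^(-(alpha + 1))].
   The domination is [q(r) >= q(rho) + 2 tau ln(r / rho)] on [r <= rho], i.e. convexity of [q] in
   [ln r], which is subharmonicity of [Q].  As the normalised moments decrease in [n], the terms
   with [x <= tau] contribute nothing in the limit.  The rescaled kernel is thus a Riemann sum in
   [x = n / N]; writing [x = tau + (1 - tau) t], its limit is [K^(alpha)] times a unimodular
   cocycle, which cancels in the determinant.  The argument works when the points move with [N],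
   and convergence along all such sequences is locally uniform convergence.  If some
   [Re z_i <= 0], then [z_i] lies outside the disk, and both sides vanish. *)

Require Import Defs.
From mathcomp Require Import all_boot all_order all_algebra.
From mathcomp Require Import all_classical all_reals all_analysis.
From mathcomp Require Import measurable_realfun complex ring lra.
Set Implicit Arguments.
Unset Strict Implicit.
Unset Printing Implicit Defensive.
Import Order.TTheory GRing.Theory Num.Theory numFieldNormedType.Exports.
Import Normc.
Local Open Scope classical_set_scope.
Local Open Scope ring_scope.
Local Open Scope complex_scope.

(** * Determinants and the Gibbs factor *)

(** Subharmonicity is available only as the sub-mean value inequality, and [q'] is merely absolutely
    continuous, so convexity of [q] in [ln r] cannot be read off a second derivative. The tangent
    bound is proved by a touching argument instead: if it failed, [q] would lie, near some [c],
    below a strictly concave function of [ln r] that agrees with it at [c], and its mean over a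
    small circle centred at [c] would fall below [q c]. The behaviour of [Q] at the origin enters
    twice. It gives [tau < 1], so that there are indices with [n / N > tau] at all, and it makes the
    moments with [n / N <= tau] finite, where the tangent bound is too weak. Polar coordinates are
    replaced by the image of the area measure under [|u|^2], and integration over the angle by
    invariance under a single rotation with suitable angle. *)

Lemma det_bordered_idomain (D : idomainType) n (A : 'M[D]_n) (b : 'cV_n)
    (c : 'rV_n) (d : 'M[D]_1) : \det A != 0 ->
  \det (block_mx A b c d) = d 0 0 * \det A - (c *m \adj A *m b) 0 0.
Proof.
move=> A0.
(* The second factor is chosen so that the product is block lower triangular with diagonal blocks
   [(\det A)%:M] and the claimed value; the surplus [\det A ^+ n] on both sides is then
   cancelled. *)
have := congr1 determinant (mulmx_block A b c d (\adj A) (- (\adj A *m b)) 0 (\det A)%:M).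
rewrite det_mulmx det_ublock !mulmx0 !addr0 mulmxN mulmxA mul_mx_adj.
rewrite mul_scalar_mx mul_mx_scalar addNr det_lblock !det_scalar expr1.
have adjE : \det (\adj A) * \det A = \det A ^+ n.
  by rewrite -det_mulmx mul_adj_mx det_scalar.
rewrite adjE det_mx11 mulrC => /(mulfI (expf_neq0 n A0)) ->.
by rewrite mulmxN mul_mx_scalar mulmxA [LHS]mxE addrC !mxE [in LHS]mulrC.
Qed.

(** To allow singular [A], it is replaced by [X + A] over the polynomials, whose determinant is
    monic and hence nonzero; evaluation at 0 gives the identity back. *)
Lemma det_bordered (D : idomainType) n (A : 'M[D]_n) (b : 'cV_n)
    (c : 'rV_n) (d : 'M[D]_1) :
  \det (block_mx A b c d) = d 0 0 * \det A - (c *m \adj A *m b) 0 0.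
Proof.
pose ev : {rmorphism {poly D} -> D} := horner_eval (0 : D).
have evC m p (B : 'M[D]_(m, p)) : map_mx ev (map_mx polyC B) = B.
  by apply/matrixP => i j; rewrite !mxE /ev /= /horner_eval hornerC.
pose A' := char_poly_mx (- A).
have evA : map_mx ev A' = A.
  apply/matrixP => i j; rewrite !mxE /ev /= /horner_eval !hornerE.
  by rewrite hornerMn hornerX mul0rn sub0r opprK.
have /det_bordered_idomain : \det A' != 0.
  by apply: monic_neq0; exact: char_poly_monic.
move=> /(_ (map_mx polyC b) (map_mx polyC c) (map_mx polyC d)) /(congr1 ev).
rewrite -det_map_mx map_block_mx !evC evA => ->.
rewrite rmorphB rmorphM /= -det_map_mx evA mxE /ev {1}/horner_eval hornerC.
congr (_ - _).
have := congr1 (fun M : 'M[D]_1 => M 0 0)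
  (map_mxM ev (map_mx polyC c *m \adj A') (map_mx polyC b)).
by rewrite (map_mxM ev _ (\adj A')) map_mx_adj !evC evA mxE => ->.
Qed.

Lemma gtNy_adde_def (R : realType) (x y : \bar R) :
  (-oo < x -> -oo < y -> x +? y)%E.
Proof. by case: x y => [x| |] [y| |]. Qed.

Section GibbsFactor.
Variable R : realType.
Variables (Q : R[i] -> \bar R) (rho alpha : R) (h : R[i] -> R).
Hypothesis Q_fin : forall z, Q z \is a fin_num.

(** The one-particle factor [exp (- N Q_N)] on the disk: multiplication by [N] cancels the [1 / N]
    in front of [alpha] and [h]. *)
Definition weight (N : nat) (z : R[i]) : R :=
  if normc z < rho then
    expR (- (N%:R * fine (Q z))) * (rho - normc z) `^ alpha * expR (h z)
  else 0.

Lemma weight_ge0 N z : 0 <= weight N z.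
Proof.
by rewrite /weight; case: ifP => // _; rewrite !mulr_ge0 ?expR_ge0 ?powR_ge0.
Qed.

Lemma expeR_QND N z : (0 < N)%N ->
  expeR (- (N%:R%:E * QND Q rho alpha h N z)) = (weight N z)%:E.
Proof.
move=> N0; rewrite /weight /QND; case: ifPn => zr.
  have N1 : N%:R != 0 :> R by rewrite pnatr_eq0 -lt0n.
  rewrite /QN -(fineK (Q_fin z)) -!EFinB -EFinM -EFinN /=; congr (_%:E).
  rewrite /powR gt_eqF ?subr_gt0// -!expRD; congr expR.
  by field.
by rewrite gt0_muley ?lte_fin ?ltr0n.
Qed.

Lemma QND_gtNy N z : (-oo < QND Q rho alpha h N z)%E.
Proof.
rewrite /QND; case: ifPn => // _.
by rewrite /QN -(fineK (Q_fin z)) -!EFinB ltNyr.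
Qed.

(** Neither the negated interaction sum nor the potential sum can be [-oo], so the energy contains
    no [oo - oo] and [expeR] turns its sums into products. Coinciding points and points outside the
    disk give 0 on both sides. *)
Lemma expeR_energy N s : (0 < N)%N ->
  expeR (- energy Q rho alpha h N s) =
  (\prod_(j < N) \prod_(k < N | k != j) normc (nth 0 s j - nth 0 s k) *
   \prod_(j < N) weight N (nth 0 s j))%:E.
Proof.
move=> N0; rewrite /energy.
set S := (\sum_(j < N) _)%E; set T := (\sum_(j < N) QND _ _ _ _ _ _)%E.
have lney x : (lne x%:E < +oo :> \bar R)%E by rewrite /lne; case: ifP; rewrite ?ltry.
have Sy : (S < +oo)%E.
  by rewrite /S; apply: lte_sum_pinfty => j _; apply: lte_sum_pinfty => k _.
have QNy j : QND Q rho alpha h N (nth 0 s j) != -oo%E.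
  by rewrite gt_eqF// QND_gtNy.
have defQ : {in predT &, forall i j : 'I_N,
    (QND Q rho alpha h N (nth 0%R s i) +? QND Q rho alpha h N (nth 0%R s j))%E}.
  by move=> i j _ _; apply: gtNy_adde_def; exact: QND_gtNy.
have NT : (N%:R%:E * T = \sum_(j < N) N%:R%:E * QND Q rho alpha h N (nth 0%R s j))%E.
  by rewrite fin_num_sume_distrr.
have NQy j : (-oo < N%:R%:E * QND Q rho alpha h N (nth 0%R s j))%E.
  by have := QND_gtNy N (nth 0 s j); case: (QND _ _ _ _ _ _) => [r| |]// _; rewrite ?ltNyr// gt0_muley ?lte_fin ?ltr0n.
have NTy : (-oo < N%:R%:E * T)%E 
  by rewrite NT ltNye; apply/eqP => /esum_eqNyP[j [_ _ /eqP]]; apply/negP; rewrite gt_eqF.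
rewrite oppeD ?oppeK; last first.
  by apply: gtNy_adde_def => //; rewrite lteNr.
rewrite expeRD NT -sumeN; last first.
  by move=> i j _ _; apply: gtNy_adde_def; exact: NQy.
have expS (I : finType) (P : pred I) (F : I -> \bar R) :
    expeR (\sum_(i | P i) F i)%E = (\prod_(i | P i) expeR (F i))%E.
  by apply: big_morph; [exact: expeRD|exact: expeR0].
rewrite !expS EFinM -!prodEFin; congr (_ * _)%E.
  apply: eq_bigr => j _; rewrite expS -prodEFin; apply: eq_bigr => k _.
  by rewrite lneK// in_itv /= lee_fin leey andbT; case: (_ - _) => a b; exact: sqrtr_ge0.
by apply: eq_bigr => j _; rewrite expeR_QND.
Qed.

End GibbsFactor.

Section Vandermonde.
Variable R : rcfType.

Lemma normc_ge0 (z : R[i]) : 0 <= normc z.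
Proof. by case: z => a b; exact: sqrtr_ge0. Qed.

Lemma mulc_conj (z : R[i]) : z * conjc z = (normc z ^+ 2)%:C.
Proof.
by rewrite -sqr_normc normc_def -!rmorphXn /=; case: z => a b /=.
Qed.

Lemma normc_prod (I : Type) (r : seq I) (P : pred I) (F : I -> R[i]) :
  normc (\prod_(i <- r | P i) F i) = \prod_(i <- r | P i) normc (F i).
Proof. by apply: big_morph; [exact: normcM|exact: normc1]. Qed.

(** The product runs over ordered pairs, so each distance occurs twice; this is the squared modulus
    of the Vandermonde product. *)
Lemma prod_normc_Vandermonde N (a : 'rV[R[i]]_N) :
  (\prod_(j < N) \prod_(k < N | k != j) normc (a 0 j - a 0 k))%:C =
  \det (Vandermonde N a) * conjc (\det (Vandermonde N a)).
Proof.
rewrite mulc_conj det_Vandermonde normc_prod; congr (_%:C).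
under [in RHS]eq_bigr do rewrite normc_prod.
have symE (j k : 'I_N) : normc (a 0 j - a 0 k) = normc (a 0 k - a 0 j).
  by rewrite -normcN opprB.
rewrite expr2 [X in _ = _ * X](exchange_big_dep predT) //= -big_split /=.
apply: eq_bigr => j _.
rewrite (bigID (fun k : 'I_N => (j < k)%N)) /=; congr (_ * _).
  apply: eq_big => [k|k _]; last by rewrite symE.
  by rewrite -val_eqE /=; case: ltngtP.
by apply: eq_bigl => k; rewrite -val_eqE /=; case: ltngtP.
Qed.

(** The points come as a sequence, as in [iterated_int], so that points can be appended one at a
    time without changing types. *)
Definition det_at (K : R[i] -> R[i] -> R[i]) N (s : seq R[i]) : R[i] :=
  \det (\matrix_(i < N, j < N) K (nth 0 s i) (nth 0 s j)).

Definition orth_fun (w : R[i] -> R) (c : nat -> R) n z : R[i] :=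
  (Num.sqrt (w z) / Num.sqrt (c n))%:C * z ^+ n.

Definition proj_kernel (w : R[i] -> R) (c : nat -> R) N z u : R[i] :=
  \sum_(n < N) orth_fun w c n z * conjc (orth_fun w c n u).

(** The kernel matrix is [B B^*], where [B] is the transposed Vandermonde matrix with rows scaled by
    the roots of the weights and columns by the inverse roots of the moments. *)
Lemma det_proj_kernel (w : R[i] -> R) (c : nat -> R) N (s : seq R[i]) :
  (forall z, 0 <= w z) -> (forall n, 0 < c n) ->
  (\prod_(j < N) \prod_(k < N | k != j) normc (nth 0 s j - nth 0 s k) *
   \prod_(j < N) w (nth 0 s j))%:C =
  (\prod_(n < N) c n)%:C * det_at (proj_kernel w c N) N s.
Proof.
move=> w0 c0.
pose a : 'rV[R[i]]_N := \row_j nth 0 s j.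
pose dw : 'rV[R[i]]_N := \row_j (Num.sqrt (w (nth 0 s j)))%:C.
pose dc : 'rV[R[i]]_N := \row_n ((Num.sqrt (c n))^-1)%:C.
pose V := Vandermonde N a.
have KE : \matrix_(i < N, j < N) proj_kernel w c N (nth 0 s i) (nth 0 s j) =
   (diag_mx dw *m V^T *m diag_mx dc) *m
   map_mx conjc (diag_mx dw *m V^T *m diag_mx dc)^T.
  apply/matrixP => i j; rewrite !mxE; apply: eq_bigr => n _.
  by rewrite mul_mx_diag mul_diag_mx !mxE /orth_fun rmorphM /= !rmorphM /=; ring.
have detC (A : 'M[R[i]]_N) : \det (map_mx conjc A^T) = conjc (\det A).
  by rewrite det_map_mx det_tr.
rewrite /det_at KE det_mulmx detC !det_mulmx !det_diag det_tr.
rewrite !rmorphM /= !mulrA.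
have -> : \prod_(j < N) \prod_(k < N | k != j) normc (nth 0 s j - nth 0 s k) =
  \prod_(j < N) \prod_(k < N | k != j) normc (a 0 j - a 0 k).
  by apply: eq_bigr => j _; apply: eq_bigr => k _; rewrite !mxE.
rewrite prod_normc_Vandermonde -/V.
have -> : (\prod_(j < N) w (nth 0 s j))%:C =
   (\prod_(i < N) dw 0 i) * conjc (\prod_(i < N) dw 0 i) :> R[i].
  rewrite rmorph_prod rmorph_prod -big_split /=; apply: eq_bigr => j _.
  by rewrite mxE conjc_real -rmorphM /= -expr2 sqr_sqrtr.
have cE : (\prod_(n < N) c n)%:C * (\prod_(i < N) dc 0 i) *
   conjc (\prod_(i < N) dc 0 i) = 1 :> R[i].
  rewrite [X in X * _ * _]rmorph_prod rmorph_prod -!big_split /= big1// => j _.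
  rewrite mxE conjc_real -!rmorphM /= -(sqr_sqrtr (ltW (c0 j))).
  rewrite sqrtr_sqr gtr0_norm ?sqrtr_gt0// expr2.
  by rewrite mulfK ?divff// gt_eqF// sqrtr_gt0.
move: cE; move: (conjc (\prod_(i < N) dw 0 i)) (conjc (\prod_(i < N) dc 0 i)).
move: (conjc (\det V)) (\det V) (\prod_(i < N) dw 0 i) (\prod_(i < N) dc 0 i).
move: ((\prod_(n < N) c n)%:C) => c' v' v u t u' t' cE.
by rewrite -[LHS]mul1r -cE; ring.
Qed.

End Vandermonde.

(** * Integration in the plane *)

Section LebesgueAffine.
Variable R : realType.
Let mu : {measure set (measurableTypeR R) -> \bar R} := @lebesgue_measure R.

(** By uniqueness of Lebesgue measure: [a] times the image measure gives each interval []c, d]] its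
    length. *)
Lemma lebesgue_measure_affine (a b : R) A : 0 < a -> measurable A ->
  pushforward mu (fun x : measurableTypeR R => a * x + b : measurableTypeR R) A =
  (a^-1%:E * mu A)%E.
Proof.
move=> a0 mA.
have mphi : measurable_fun setT
    (fun x : measurableTypeR R => a * x + b : measurableTypeR R).
  by apply: measurable_funD => //; apply: measurable_funM.
pose an : {nonneg R} := NngNum (ltW a0).
have key : mu A = mscale an (pushforward mu
    (fun x : measurableTypeR R => a * x + b : measurableTypeR R)) A.
  move=> m; apply: lebesgue_measure_unique => //= _ [[c d]] _ <-.
  rewrite /mscale /= /pushforward /=.
have -> : (fun x : R => a * x + b) @^-1` `]c, d] = `](c - b) / a, (d - b) / a]%classic.
  apply/seteqP; split => x /=; rewrite !in_itv /=.
    by rewrite ltr_pdivrMr// ler_pdivlMr// [x * a]mulrC ltrBlDr lerBrDr.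
  by rewrite ltr_pdivrMr// ler_pdivlMr// [x * a]mulrC ltrBlDr lerBrDr.
rewrite !lebesgue_measure_itv /= !lte_fin ltr_pM2r ?invr_gt0// ltrD2r.
case: ifPn => cd; rewrite ?mule0// -!EFinD -EFinM; congr (_%:E).
by field; rewrite gt_eqF.
by rewrite (key mphi) /mscale /= muleA -EFinM mulVf ?mul1e// gt_eqF.
Qed.

Lemma ge0_integral_affine (f : R -> \bar R) (a b : R) : 0 < a ->
  measurable_fun setT f -> (forall x, 0 <= f x)%E ->
  (\int[mu]_x f (a * x + b)%R = a^-1%:E * \int[mu]_x f x)%E.
Proof.
move=> a0 mf f0.
have mphi : measurable_fun setT
    (fun x : measurableTypeR R => a * x + b : measurableTypeR R).
  by apply: measurable_funD => //; apply: measurable_funM.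
have /= := @ge0_integral_pushforward _ _ _ _ R _ mphi mu setT f measurableT mf (fun x _ => f0 x).
rewrite preimage_setT => <-.
have ai0 : 0 <= a^-1 by rewrite invr_ge0 ltW.
rewrite -(@ge0_integral_mscale _ _ R mu _ measurableT (NngNum ai0) f mf)//.
by apply: eq_measure_integral => A mA _; exact: lebesgue_measure_affine.
Qed.

Let mu2 : {measure set (measurableTypeR R * measurableTypeR R) -> \bar R} :=
  (mu \x mu)%E.

(** On every horizontal line a shear is a translation, so Tonelli reduces the claim to dimension
    one. *)
Lemma ge0_integral_shear1 (f : R * R -> \bar R) (a : R) :
  measurable_fun setT f -> (forall u, 0 <= f u)%E ->
  (\int[mu2]_u f (u.1 + a * u.2, u.2)%R = \int[mu2]_u f u)%E.
Proof.
move=> mf f0.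
have ms : measurable_fun setT (fun u : R * R => (u.1 + a * u.2, u.2)%R).
  apply/measurable_fun_pairP; split; last exact: measurable_snd.
  by apply: measurable_funD => //; apply: measurable_funM.
rewrite fubini_tonelli2//; last exact: (measurableT_comp mf ms).
rewrite [RHS]fubini_tonelli2//.
apply: eq_integral => y _; rewrite /fubini_G /=.
have := @ge0_integral_affine (fun x => f (x, y)) 1 (a * y) ltr01.
rewrite invr1 mul1e => <- //.
  by apply: eq_integral => x _; rewrite mul1r.
exact: (measurableT_comp mf (measurable_pair2 _)).
Qed.

Lemma ge0_integral_shear2 (f : R * R -> \bar R) (a : R) :
  measurable_fun setT f -> (forall u, 0 <= f u)%E ->
  (\int[mu2]_u f (u.1, u.2 + a * u.1)%R = \int[mu2]_u f u)%E.
Proof.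
move=> mf f0.
have ms : measurable_fun setT (fun u : R * R => (u.1, u.2 + a * u.1)%R).
  apply/measurable_fun_pairP; split; first exact: measurable_fst.
  by apply: measurable_funD => //; apply: measurable_funM.
rewrite fubini_tonelli1//; last exact: (measurableT_comp mf ms).
rewrite [RHS]fubini_tonelli1//.
apply: eq_integral => x _; rewrite /fubini_F /=.
have := @ge0_integral_affine (fun y => f (x, y)) 1 (a * x) ltr01.
rewrite invr1 mul1e => <- //.
  by apply: eq_integral => y _; rewrite mul1r.
exact: (measurableT_comp mf (measurable_pair1 _)).
Qed.

Lemma ge0_integral_scale2 (f : R * R -> \bar R) (a : R) : 0 < a ->
  measurable_fun setT f -> (forall u, 0 <= f u)%E ->
  (\int[mu2]_u f (a * u.1, a * u.2)%R = (a ^- 2)%:E * \int[mu2]_u f u)%E.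
Proof.
move=> a0 mf f0.
have ms : measurable_fun setT (fun u : R * R => (a * u.1, a * u.2)%R).
  by apply/measurable_fun_pairP; split; apply: measurable_funM.
have ai0 : 0 <= a^-1 by rewrite invr_ge0 ltW.
rewrite fubini_tonelli1//; last exact: (measurableT_comp mf ms).
rewrite fubini_tonelli1// /fubini_F /=.
have mF : measurable_fun setT (fun x : R => \int[mu]_y f (x, y))%E.
  exact: measurable_fun_fubini_tonelli_F.
have F0 x : (0 <= \int[mu]_y f (x, y))%E by apply: integral_ge0.
transitivity (\int[mu]_x (a^-1%:E * \int[mu]_y f (a * x, y)%R))%E.
  apply: eq_integral => x _.
  have := @ge0_integral_affine (fun y => f ((a * x)%R, y)) a 0 a0.
  move=> <- //; last exact: (measurableT_comp mf (measurable_pair1 _)).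
  by apply: eq_integral => y _; rewrite addr0.
have mF' : measurable_fun setT (fun x : R => \int[mu]_y f (a * x, y)%R)%E.
  by apply: (measurableT_comp mF); apply: measurable_funM.
rewrite ge0_integralZl//.
have := @ge0_integral_affine (fun x => \int[mu]_y f (x, y))%E a 0 a0 mF F0.
rewrite (_ : (\int[mu]_x _)%E = \int[mu]_x (\int[mu]_y f ((a * x)%R, y))%E)%E; last first.
  by apply: eq_integral => x _; apply: eq_integral => y _; rewrite addr0.
by move=> ->; rewrite muleA -EFinM -invfM expr2.
Qed.

(* A rotation is a product of three shears. *)
Lemma ge0_integral_rotation (f : R * R -> \bar R) (c s : R) : s != 0 ->
  c ^+ 2 + s ^+ 2 = 1 -> measurable_fun setT f -> (forall u, 0 <= f u)%E ->
  (\int[mu2]_u f (c * u.1 - s * u.2, s * u.1 + c * u.2)%R = \int[mu2]_u f u)%E.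
Proof.
move=> s0 cs1 mf f0; pose t := (c - 1) / s.
have ms1 a : measurable_fun setT (fun u : R * R => (u.1 + a * u.2, u.2)%R).
  apply/measurable_fun_pairP; split; last exact: measurable_snd.
  by apply: measurable_funD => //; apply: measurable_funM.
have ms2 a : measurable_fun setT (fun u : R * R => (u.1, u.2 + a * u.1)%R).
  apply/measurable_fun_pairP; split; first exact: measurable_fst.
  by apply: measurable_funD => //; apply: measurable_funM.
rewrite -(@ge0_integral_shear1 f t)//.
rewrite -(@ge0_integral_shear2 (fun u => f (u.1 + t * u.2, u.2)%R) s)//; last first.
  exact: (measurableT_comp mf (ms1 _)).
rewrite -(@ge0_integral_shear1 (fun u => f (u.1 + t * (u.2 + s * u.1), (u.2 + s * u.1))%R) t)//; last first.
  exact: (measurableT_comp (measurableT_comp mf (ms1 _)) (ms2 _)).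
apply: eq_integral => -[x y] _ /=; congr (f (_, _)).
  have -> : c * x - s * y = c * x + (c ^+ 2 + s ^+ 2 - 1) / s * y - s * y by rewrite cs1; field.
  by rewrite /t; field.
by rewrite /t; field.
Qed.

Definition norm2 (u : R * R) : R := u.1 ^+ 2 + u.2 ^+ 2.

Lemma measurable_norm2 : measurable_fun setT norm2.
Proof. by apply: measurable_funD; exact: measurable_funX. Qed.

(** Kept as an unknown constant: the radial change of variables is proved with it first, and
    applying that to a Gaussian then identifies it as pi. *)
Definition unit_disk_area : \bar R := mu2 [set u | norm2 u <= 1].

Lemma measurable_disk (t : R) : measurable [set u : R * R | norm2 u <= t].
Proof.
rewrite (_ : [set u | _] = setT `&` norm2 @^-1` `]-oo, t]).
  by apply: measurable_norm2.
by rewrite setTI; apply/seteqP; split => u /=; rewrite in_itv.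
Qed.

Lemma disk_area (t : R) : 0 < t ->
  mu2 [set u | norm2 u <= t] = (t%:E * unit_disk_area)%E.
Proof.
move=> t0; rewrite /unit_disk_area.
have D0 := measurable_disk.
have E r : mu2 [set u | norm2 u <= r] =
    (\int[mu2]_u (\1_[set u | norm2 u <= r] u)%:E)%E.
  by rewrite (@integral_indic _ _ _ mu2 _ measurableT _ (D0 r)) setIT.
rewrite !E.
have st : 0 < (Num.sqrt t)^-1 by rewrite invr_gt0 sqrtr_gt0.
have := @ge0_integral_scale2 (fun u => (\1_[set u | norm2 u <= 1] u)%:E) _ st.
rewrite -exprVn invrK (sqr_sqrtr (ltW t0)) => <-.
- apply: eq_integral => -[x y] _; congr (_%:E).
  have mE u r : (u \in [set u : R * R | norm2 u <= r]) = (norm2 u <= r).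
    by apply/idP/idP; rewrite inE.
  rewrite !indicE !mE /norm2 /= !exprMn -mulrDr exprVn (sqr_sqrtr (ltW t0)).
  by rewrite ler_pdivrMl// mulr1.
- by apply/measurable_EFinP; exact: measurable_indic.
- by move=> u; rewrite lee_fin.
Qed.

Lemma disk_area0 : mu2 [set u | norm2 u <= 0] = 0%E.
Proof.
rewrite (_ : [set u | _] = [set 0] `*` [set 0]).
  rewrite [LHS]product_measure1E//.
  by rewrite (_ : mu [set 0] = 0%E) ?mul0e//; exact: lebesgue_measure_set1.
apply/seteqP; split => -[x y] /=; rewrite /norm2 /=; last first.
  by move=> [-> ->]; rewrite expr0n addr0.
move=> xy0; have x0 := sqr_ge0 x; have y0 := sqr_ge0 y.
by split; apply/eqP; rewrite -sqrf_eq0; apply/eqP; lra.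
Qed.

Lemma disk_area_neg (t : R) : t < 0 -> mu2 [set u | norm2 u <= t] = 0%E.
Proof.
move=> t0; rewrite (_ : [set u | _] = set0) ?(measure0 mu2)//.
apply/seteqP; split => -[x y] //=; rewrite /norm2 /= => xy0.
by have x0 := sqr_ge0 x; have y0 := sqr_ge0 y; lra.
Qed.

Lemma unit_disk_area_fin : unit_disk_area \is a fin_num.
Proof.
rewrite ge0_fin_numE ?(measure_ge0 mu2)//.
apply: (@le_lt_trans _ _ (mu2 (`[-1, 1] `*` `[-1, 1]))).
  apply: le_measure; rewrite ?inE//; first exact: measurable_disk.
    exact: measurableX.
  move=> -[x y] /=; rewrite /norm2 /= !in_itv /= => xy0.
  by have x0 := sqr_ge0 x; have y0 := sqr_ge0 y; split; apply/andP; split; nra.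
rewrite [X in (X < _)%E]product_measure1E//.
have I2 : mu `[-1, 1]%classic = (1 - -1)%:E.
  by rewrite [LHS]lebesgue_measure_itv /= lte_fin ifT//; lra.
by rewrite [X in (X * _)%E]I2 [X in (_ * X)%E]I2 ltry.
Qed.

(** Disks [|u|^2 <= t] have area linear in [t], so the image of the area measure under [|u|^2] is
    proportional to length on intervals, hence to Lebesgue measure on the half-line. This does the
    work of polar coordinates. *)
Lemma pushforward_norm2 (A : set (measurableTypeR R)) : measurable A -> A `<=` `]0%R, +oo[%classic ->
  mu2 (norm2 @^-1` A) = (unit_disk_area * mu A)%E.
Proof.
move=> mA A0.
have cE := fineK unit_disk_area_fin.
have c0 : 0 <= fine unit_disk_area by apply: fine_ge0; exact: (measure_ge0 mu2).
pose c := NngNum c0.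
have mD : measurable (`]0, +oo[%classic : set (measurableTypeR R)) by [].
have mui (a b : R) : a < b -> mu `]a, b]%classic = (b - a)%:E.
  by move=> ab; rewrite [LHS]lebesgue_measure_itv /= lte_fin ab.
pose G : set (set (measurableTypeR R)) := @ocitv R.
pose g k : set (measurableTypeR R) := `](- k%:R), k%:R]%classic.
have key : forall m : measurable_fun setT (norm2 : _ -> measurableTypeR R),
  pushforward mu2 (norm2 : _ -> measurableTypeR R) A =
    mscale c (mrestr mu mD) A.
  move=> m; apply: (measure_unique G g) => //.
  - exact: ocitvI.
  - by move=> i; exact: is_ocitv.
  - apply/seteqP; split => // x _.
    have [k kx] : exists k : nat, `|x| < k%:R.
      by exists (Num.truncn `|x|).+1; rewrite truncnS_gt.
    exists k => //=; rewrite /g /= in_itv /=.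
    by move: kx; rewrite ltr_norml => /andP[-> /ltW ->].
  - move=> _ [[a b] _ <-]; 
    change (mu2 (norm2 @^-1` `]a, b]) =
      ((fine unit_disk_area)%:E * mu (`]a, b] `&` `]0%R, +oo[)%classic)%E).
    have [ba|ab] := leP b a.
      have -> : `]a, b]%classic = set0 by apply: set_itv_ge; rewrite bnd_simp -leNgt.
      by rewrite preimage_set0 set0I !measure0 mule0.
    have -> : norm2 @^-1` `]a, b] = [set u | norm2 u <= b] `\` [set u | norm2 u <= a].
      apply/seteqP; split => u /=; rewrite in_itv /=.
        by move=> /andP[au ub]; split => //; apply/negP; rewrite -ltNge.
      by move=> [-> /negP]; rewrite -ltNge => ->.
    have fin r : mu2 [set u | norm2 u <= r] \is a fin_num.
      have [r0|r0|->] := ltgtP r 0.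
      - by rewrite disk_area_neg.
      - by rewrite disk_area// fin_numM// unit_disk_area_fin.
      - by rewrite disk_area0.
    have mK r : measurable
      ([set u | norm2 u <= r] : set (measurableTypeR R * measurableTypeR R)).
      exact: measurable_disk.
    rewrite [LHS](measureD (mK b) (mK a)); last first.
      by rewrite ltey_eq fin.
    rewrite setIidr; last by move=> u /= /le_trans; apply; exact: ltW.
    (* For [a < 0] the smaller disk is empty, and only the part of the interval in the positive
       half-line counts. *)
    have [a0|a0] := leP 0 a.
      rewrite setIidl; last first.
        by move=> x /=; rewrite !in_itv /= andbT => /andP[/(le_lt_trans a0)].
      rewrite mui//.
      transitivity (b%:E * unit_disk_area - a%:E * unit_disk_area)%E.
        congr (_ - _)%E; first by apply: disk_area; exact: le_lt_trans ab.
        move: a0; rewrite le_eqVlt => /predU1P[<-|/disk_area//].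
        by rewrite mul0e; exact: disk_area0.
      by rewrite -cE -!EFinM -!EFinB; congr (_%:E); ring.
    transitivity (mu2 [set u | norm2 u <= b]).
      by rewrite [X in (_ - X)%E]disk_area_neg// sube0.
    have [b0|b0] := leP b 0.
      rewrite (_ : _ `&` _ = set0); last first.
        apply/seteqP; split => // x /=; rewrite !in_itv /= andbT => -[/andP[_ xb]].
        by move=> /lt_le_trans /(_ xb); rewrite ltNge b0.
      rewrite measure0 mule0; move: b0; rewrite le_eqVlt => /predU1P[->|/disk_area_neg//].
      by rewrite disk_area0.
    rewrite (_ : _ `&` _ = `]0, b]%classic); last first.
      apply/seteqP; split => x /=; rewrite !in_itv /= ?andbT => -[].
        by move=> /andP[_ ->] ->.
      by move=> /andP[x0 ->]; rewrite x0 (lt_trans a0).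
    rewrite mui// disk_area// -cE.
    by rewrite -!EFinM; congr (_%:E); ring.
  - move=> k; change (mu2 (norm2 @^-1` g k) < +oo)%E.
    apply: (@le_lt_trans _ _ (mu2 [set u | norm2 u <= k.+1%:R])).
      apply: le_measure; rewrite ?inE.
      - by rewrite /g -[_ @^-1` _]setTI; apply: m.
      - exact: measurable_disk.
      - move=> u /=; rewrite /g /= in_itv /= => /andP[_ /le_trans]; apply.
        by rewrite ler_nat.
    by rewrite [ltLHS]disk_area// ltey_eq fin_numM// unit_disk_area_fin.
have := key measurable_norm2.
by rewrite /mscale /= /mrestr cE setIidl.
Qed.

Lemma ge0_integral_norm2_unnorm (f : R -> \bar R) : measurable_fun setT f ->
  (forall x, 0 <= f x)%E ->
  (\int[mu2]_u f (norm2 u) = unit_disk_area * \int[mu]_(x in `]0%R, +oo[) f x)%E.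
Proof.
move=> mf f0.
have cE := fineK unit_disk_area_fin.
have c0 : 0 <= fine unit_disk_area by apply: fine_ge0; exact: (measure_ge0 mu2).
pose D := [set u : R * R | 0 < norm2 u].
have mC : measurable [set u : R * R | norm2 u <= 0] by exact: measurable_disk.
have DC : ~` D = [set u : R * R | norm2 u <= 0].
  by apply/seteqP; split => u /=; [move=> /negP; rewrite -leNgt|move=> ?; apply/negP; rewrite -leNgt].
have mD : measurable D by rewrite -[D]setCK DC; exact: measurableC.
have mfn : measurable_fun setT (fun u => f (norm2 u)).
  by apply: (measurableT_comp mf); exact: measurable_norm2.
(* The origin, a null set, is removed to match the open half-line on the right. *)
have -> : (\int[mu2]_u f (norm2 u) = \int[mu2]_(u in D) f (norm2 u))%E.
  rewrite -(setUv D) ge0_integral_setU ?setUv//; last first.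
  - by apply/disj_setPCl.
  - by rewrite DC.
  rewrite [X in (_ + X)%E]null_set_integral ?adde0//.
  - by rewrite DC.
  - exact: measurable_funTS.
  - by rewrite DC; exact: disk_area0.
have mn : measurable_fun setT
    (norm2 : (measurableTypeR R * measurableTypeR R)%type -> measurableTypeR R) by exact: measurable_norm2.
have := @ge0_integral_pushforward _ _ _ _ R _ mn mu2
  `]0, +oo[%classic f.
rewrite (_ : norm2 @^-1` `]0, +oo[ = D); last first.
  by apply/seteqP; split => u /=; rewrite in_itv /= andbT.
move=> <- //; last exact: measurable_funTS.
rewrite -cE -(@ge0_integral_mscale _ _ R mu _ _ (NngNum c0) f)//; last exact: measurable_funTS.
apply: eq_measure_integral => A mA AD.
transitivity ((fine unit_disk_area)%:E * mu A)%E => //.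
by rewrite cE; exact: pushforward_norm2.
Qed.

Lemma integral_expRN : (\int[mu]_(x in `]0%R, +oo[) (expR (- x))%:E = 1)%E.
Proof.
have mg : measurable_fun (`]0%R, +oo[%classic : set (measurableTypeR R)) (fun x : R => (expR (- x))%:E).
  by apply: measurable_funTS; apply/measurable_EFinP; apply: measurableT_comp.
rewrite integral_itv_obnd_cbnd// -(@integral_exponential_pdf R 1 ltr01).
rewrite [LHS]integral_mkcond; apply: eq_integral => x _.
by rewrite /exponential_pdf !patchE; case: ifP; rewrite // mul1r mulN1r.
Qed.

(** The integral of [exp (- |u|^2)] is computed twice: radially it is the unknown area times 1, by
    Tonelli it is the square of the Gaussian integral. *)
Lemma unit_disk_areaE : unit_disk_area = pi%:E.
Proof.
have mg : measurable_fun setT (fun x : R => (expR (- x))%:E).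
  by apply/measurable_EFinP; apply: measurableT_comp.
have := @ge0_integral_norm2_unnorm (fun x => (expR (- x))%:E) mg.
rewrite integral_expRN mule1 => <-; last by move=> x; rewrite lee_fin expR_ge0.
rewrite fubini_tonelli1; last 2 first.
- by apply: (measurableT_comp mg); exact: measurable_norm2.
- by move=> u; rewrite lee_fin expR_ge0.
rewrite /fubini_F.
transitivity (\int[mu]_x ((Num.sqrt pi)%:E * (gauss_fun x)%:E))%E.
  apply: eq_integral => x _; rewrite muleC -integralT_gauss -ge0_integralZl//.
  - apply: eq_integral => y _; rewrite -EFinM /gauss_fun -expRD /norm2 /=.
    by rewrite opprD.
  - by apply/measurable_EFinP; exact: measurable_gauss_fun.
  - by move=> y _; rewrite lee_fin gauss_fun_ge0.
  - by rewrite lee_fin gauss_fun_ge0.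
rewrite ge0_integralZl//.
- by rewrite integralT_gauss -EFinM -expr2 sqr_sqrtr// pi_ge0.
- by apply/measurable_EFinP; exact: measurable_gauss_fun.
- by move=> y _; rewrite lee_fin gauss_fun_ge0.
Qed.

End LebesgueAffine.

Section ComplexIntegral.
Context d (T : measurableType d) (R : realType).
Variable mu : {measure set T -> \bar R}.
Implicit Types f g : T -> R[i].

Definition cintegrable f :=
  mu.-integrable setT (EFin \o (fun x => complex.Re (f x))) /\
  mu.-integrable setT (EFin \o (fun x => complex.Im (f x))).

Definition cint f : R[i] :=
  (\int[mu]_x complex.Re (f x)) +i* (\int[mu]_x complex.Im (f x)).

Lemma eq_cint f g : f =1 g -> cint f = cint g.
Proof. by move=> /funext ->. Qed.

Lemma eq_cintegrable f g : f =1 g -> cintegrable f -> cintegrable g.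
Proof. by move=> /funext ->. Qed.

Lemma cintegrableD f g : cintegrable f -> cintegrable g ->
  cintegrable (fun x => f x + g x).
Proof.
move=> [fr fi] [gr gi]; split.
  rewrite (_ : _ \o _ = (EFin \o (fun x => complex.Re (f x))) \+
    (EFin \o (fun x => complex.Re (g x))))%E; first exact: integrableD.
  by apply/funext => x /=; case: (f x); case: (g x).
rewrite (_ : _ \o _ = (EFin \o (fun x => complex.Im (f x))) \+
  (EFin \o (fun x => complex.Im (g x))))%E; first exact: integrableD.
by apply/funext => x /=; case: (f x); case: (g x).
Qed.

Lemma cintD f g : cintegrable f -> cintegrable g ->
  cint (fun x => f x + g x) = cint f + cint g.
Proof.
move=> [fr fi] [gr gi]; rewrite /cint; apply/eqP; rewrite eq_complex /=.
rewrite -!RintegralD//; apply/andP; split; apply/eqP;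
  by apply: eq_Rintegral => x _; case: (f x); case: (g x).
Qed.

Lemma integrable_Rlin (a b : R) (u v : T -> R) :
  mu.-integrable setT (EFin \o u) -> mu.-integrable setT (EFin \o v) ->
  mu.-integrable setT (EFin \o (fun x => a * u x + b * v x)).
Proof.
move=> iu iv.
rewrite (_ : _ \o _ = (fun x => a%:E * (EFin \o u) x) \+
  (fun x => b%:E * (EFin \o v) x))%E; last by apply/funext => x.
by apply: integrableD => //; exact: integrableZl.
Qed.

Lemma Rintegral_Rlin (a b : R) (u v : T -> R) :
  mu.-integrable setT (EFin \o u) -> mu.-integrable setT (EFin \o v) ->
  \int[mu]_x (a * u x + b * v x) = a * \int[mu]_x u x + b * \int[mu]_x v x.
Proof.
move=> iu iv; rewrite RintegralD// ?RintegralZl//.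
- by apply: (@eq_integrable _ _ _ _ _ _ (fun x => a%:E * (EFin \o u) x)%E) => //; exact: integrableZl.
- by apply: (@eq_integrable _ _ _ _ _ _ (fun x => b%:E * (EFin \o v) x)%E) => //; exact: integrableZl.
Qed.

Lemma cintegrableZ c f : cintegrable f -> cintegrable (fun x => c * f x).
Proof.
move=> [fr fi]; case: c => a b; split.
  rewrite (_ : (fun x => _) = fun x => a * complex.Re (f x) + (- b) * complex.Im (f x)).
    exact: integrable_Rlin.
  by apply/funext => x; case: (f x) => r s /=; rewrite mulNr.
rewrite (_ : (fun x => _) = fun x => b * complex.Re (f x) + a * complex.Im (f x)).
  exact: integrable_Rlin.
by apply/funext => x; case: (f x) => r s /=; rewrite addrC.
Qed.

Lemma cintZ c f : cintegrable f -> cint (fun x => c * f x) = c * cint f.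
Proof.
move=> [fr fi]; case: c => a b; rewrite /cint; apply/eqP; rewrite eq_complex /=.
rewrite -mulNr addrC -!Rintegral_Rlin//; apply/andP; split; apply/eqP;
  apply: eq_Rintegral => x _; case: (f x) => r s /=; rewrite ?mulNr// addrC//.
Qed.

Lemma cintegrableN f : cintegrable f -> cintegrable (fun x => - f x).
Proof.
move=> /(cintegrableZ (-1)); apply: eq_cintegrable => x; exact: mulN1r.
Qed.

Lemma cintegrable0 : cintegrable (fun=> 0).
Proof. by split; exact: integrable0. Qed.

Lemma cintegrable_sum I (r : seq I) (P : pred I) (F : I -> T -> R[i]) :
  (forall i, P i -> cintegrable (F i)) ->
  cintegrable (fun x => \sum_(i <- r | P i) F i x).
Proof.
move=> iF; elim: r => [|i r IH].
  by apply: eq_cintegrable cintegrable0 => x; rewrite big_nil.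
case: (boolP (P i)) => Pi; last first.
  by apply: eq_cintegrable IH => x; rewrite big_cons (negbTE Pi).
apply: eq_cintegrable (cintegrableD (iF i Pi) IH) => x.
by rewrite big_cons Pi.
Qed.

Lemma cint_sum I (r : seq I) (P : pred I) (F : I -> T -> R[i]) :
  (forall i, P i -> cintegrable (F i)) ->
  cint (fun x => \sum_(i <- r | P i) F i x) = \sum_(i <- r | P i) cint (F i).
Proof.
move=> iF; elim: r => [|i r IH].
  rewrite big_nil (@eq_cint _ (fun=> 0)) => [|x]; last by rewrite big_nil.
  by rewrite /cint /Rintegral integral0.
rewrite big_cons; case: (boolP (P i)) => Pi; last first.
  by rewrite -IH; apply: eq_cint => x; rewrite big_cons (negbTE Pi).
rewrite -IH -cintD; [|exact: iF|exact: cintegrable_sum].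
by apply: eq_cint => x; rewrite big_cons Pi.
Qed.

End ComplexIntegral.

Section AreaMeasure.
Variable R : realType.
Let mu2 : {measure set (measurableTypeR R * measurableTypeR R) -> \bar R} :=
  ((@lebesgue_measure R) \x (@lebesgue_measure R))%E.

Lemma ge0_integral_dA (f : R * R -> \bar R) : measurable_fun setT f ->
  (forall u, 0 <= f u)%E ->
  (\int[@dA R]_u f u = (pi^-1)%:E * \int[mu2]_u f u)%E.
Proof. by move=> mf f0; rewrite /dA ge0_integral_mscale. Qed.

(** The factor [1 / pi] in [dA] cancels the area of the unit disk, so moments in the plane are
    moments in [|u|^2] with no constant. *)
Lemma ge0_integral_norm2 (f : R -> \bar R) : measurable_fun setT f ->
  (forall x, 0 <= f x)%E ->
  (\int[@dA R]_u f (norm2 u) = \int[lebesgue_measure]_(x in `]0%R, +oo[) f x)%E.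
Proof.
move=> mf f0; rewrite ge0_integral_dA//; last first.
  by apply: (measurableT_comp mf); exact: measurable_norm2.
rewrite ge0_integral_norm2_unnorm// unit_disk_areaE muleA -EFinM mulVf ?mul1e//.
by rewrite gt_eqF// pi_gt0.
Qed.

Definition rotate (c s : R) (u : R * R) : R * R :=
  (c * u.1 - s * u.2, s * u.1 + c * u.2).

Lemma measurable_rotate c s : measurable_fun setT (rotate c s).
Proof.
apply/measurable_fun_pairP; split.
  by apply: measurable_funB; apply: measurable_funM.
by apply: measurable_funD; apply: measurable_funM.
Qed.

Lemma dA_rotate c s (A : set (measurableTypeR R * measurableTypeR R)) :
  s != 0 -> c ^+ 2 + s ^+ 2 = 1 -> measurable A ->
  @dA R (rotate c s @^-1` A) = @dA R A.
Proof.
move=> s0 cs1 mA.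
have mr : measurable (rotate c s @^-1` A : set (measurableTypeR R * measurableTypeR R)).
  by rewrite -[_ @^-1` _]setTI; apply: measurable_rotate.
have mI (B : set (measurableTypeR R * measurableTypeR R)) : measurable B ->
    measurable_fun setT (fun u : R * R => (\1_B u)%:E : \bar R).
  by move=> mB; apply/measurable_EFinP; exact: measurable_indic.
have -> : @dA R A = (\int[@dA R]_u (\1_A u)%:E)%E.
  by rewrite (integral_indic (@dA R) measurableT mA) setIT.
have -> : @dA R (rotate c s @^-1` A) = (\int[@dA R]_u (\1_(rotate c s @^-1` A) u)%:E)%E.
  by rewrite (integral_indic (@dA R) measurableT mr) setIT.
rewrite !ge0_integral_dA//; [|exact: mI|exact: mI].
congr (_ * _)%E; rewrite -(@ge0_integral_rotation _ (fun u => (\1_A u)%:E) c s)//.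
exact: mI.
Qed.

Lemma Rintegral_dA_rotate (c s : R) (f : R * R -> R) :
  s != 0 -> c ^+ 2 + s ^+ 2 = 1 -> measurable_fun setT f ->
  (@dA R).-integrable setT (EFin \o (fun u => f (rotate c s u))) ->
  \int[@dA R]_u f (rotate c s u) = \int[@dA R]_u f u.
Proof.
move=> s0 cs1 mf intf; rewrite /Rintegral; congr fine.
have mr : measurable_fun setT (rotate c s :
  (measurableTypeR R * measurableTypeR R)%type -> (measurableTypeR R * measurableTypeR R)%type).
  exact: measurable_rotate.
have mEf : measurable_fun setT (EFin \o f :
    (measurableTypeR R * measurableTypeR R)%type -> \bar R).
  exact/measurable_EFinP.
rewrite -(@integral_pushforward _ _ _ _ _ _ mr (@dA R) setT (EFin \o f) mEf intf measurableT).
by apply: eq_measure_integral => A mA _; exact: dA_rotate.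
Qed.

End AreaMeasure.

(** * Correlations as determinants *)

Section Determinantal.
Variable R : realType.
Variables (phi : nat -> R[i] -> R[i]) (N : nat).
Let pt (u : R * R) : R[i] := of_pair u.

Hypothesis phi_int : forall m n, (m < N)%N -> (n < N)%N ->
  cintegrable (@dA R) (fun u => phi m (pt u) * conjc (phi n (pt u))).
Hypothesis phi_orth : forall m n, (m < N)%N -> (n < N)%N ->
  cint (@dA R) (fun u => phi m (pt u) * conjc (phi n (pt u))) = (m == n)%:R.

Let K z w := \sum_(n < N) phi n z * conjc (phi n w).

Let KK_E z w u : K z (pt u) * K (pt u) w =
  \sum_(m < N) \sum_(n < N)
    (phi m z * conjc (phi n w)) * (phi n (pt u) * conjc (phi m (pt u))).
Proof.
rewrite /K mulr_suml; apply: eq_bigr => m _; rewrite mulr_sumr.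
by apply: eq_bigr => n _; ring.
Qed.

Let KK_int z w : cintegrable (@dA R) (fun u => K z (pt u) * K (pt u) w).
Proof.
rewrite (funext (KK_E z w)).
apply: cintegrable_sum => m _; apply: cintegrable_sum => n _.
exact: cintegrableZ (phi_int _ _).
Qed.

Lemma kernel_reproducing z w :
  cint (@dA R) (fun u => K z (pt u) * K (pt u) w) = K z w.
Proof.
rewrite (funext (KK_E z w)) cint_sum; last first.
  move=> m _; apply: cintegrable_sum => n _.
  exact: cintegrableZ (phi_int _ _).
apply: eq_bigr => m _; rewrite cint_sum; last first.
  by move=> n _; exact: cintegrableZ (phi_int _ _).
rewrite (bigD1 m) //= big1 ?addr0 => [|n nm]; rewrite cintZ; try exact: phi_int.
  by rewrite phi_orth// eqxx mulr1.
by rewrite phi_orth// (negbTE nm : (n == m :> nat) = false) mulr0.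
Qed.

Let Kd_int : cintegrable (@dA R) (fun u => K (pt u) (pt u)).
Proof. by apply: cintegrable_sum => n _; exact: phi_int. Qed.

Lemma kernel_trace : cint (@dA R) (fun u => K (pt u) (pt u)) = N%:R.
Proof.
rewrite cint_sum => [|n _]; last exact: phi_int.
rewrite -[in RHS](card_ord N) -sumr_const; apply: eq_bigr => n _.
by rewrite phi_orth// eqxx.
Qed.

(** Expansion along the row and column of the last point leaves [u] only in [K u u] and in products
    [K x u * K u y], which the trace and the reproducing property integrate. *)
Let det_atS m s u : size s = m -> det_at K m.+1 (rcons s u) =
  K u u * det_at K m s - \sum_(j < m) \sum_(i < m)
    (\adj (\matrix_(i < m, j < m) K (nth 0 s i) (nth 0 s j)) i j) *
    (K (nth 0 s j) u * K u (nth 0 s i)).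
Proof.
move=> sm; rewrite -addn1 /det_at.
set M := \matrix_(i, j) _; rewrite -[M]submxK det_bordered.
have Eul : ulsubmx M = \matrix_(i < m, j < m) K (nth 0 s i) (nth 0 s j).
  by apply/matrixP => i j; rewrite !mxE /= !nth_rcons !sm !ltn_ord.
have Edr : drsubmx M 0 0 = K u u.
  by rewrite !mxE /= !nth_rcons !sm addn0 ltnn eqxx.
rewrite Eul Edr; congr (_ - _).
rewrite mxE; apply: eq_bigr => j _; rewrite mxE mulr_suml.
apply: eq_bigr => i _; rewrite !mxE /= !nth_rcons !sm addn0 ltnn eqxx !ltn_ord.
ring.
Qed.

Lemma det_kernel_int m s : size s = m ->
  cintegrable (@dA R) (fun u => det_at K m.+1 (rcons s (pt u))).
Proof.
move=> sm; rewrite (funext (fun u => det_atS (pt u) sm)).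
apply: cintegrableD.
  by apply: eq_cintegrable (cintegrableZ (det_at K m s) Kd_int) => u; exact: mulrC.
apply: cintegrableN; apply: cintegrable_sum => j _; apply: cintegrable_sum => i _.
exact/cintegrableZ/KK_int.
Qed.

(** The term [K u u] integrates to [N]; the reproducing property turns the remaining double sum into
    the trace of [A *m \adj A], that is [m] times the determinant. *)
Lemma cint_det_kernel m s : size s = m ->
  cint (@dA R) (fun u => det_at K m.+1 (rcons s (pt u))) =
  (N%:R - m%:R) * det_at K m s.
Proof.
move=> sm.
pose A := \matrix_(i < m, j < m) K (nth 0 s i) (nth 0 s j).
pose D u := \sum_(j < m) \sum_(i < m)
    (\adj A i j) * (K (nth 0 s j) (pt u) * K (pt u) (nth 0 s i)).
have Dint : cintegrable (@dA R) D.
  apply: cintegrable_sum => j _; apply: cintegrable_sum => i _.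
  exact/cintegrableZ/KK_int.
rewrite (@eq_cint _ _ _ (@dA R) _ (fun u => det_at K m s * K (pt u) (pt u) + (-1) * D u)); last first.
  by move=> u; rewrite det_atS// mulN1r mulrC.
rewrite cintD; [|exact: cintegrableZ|exact: cintegrableZ].
rewrite !cintZ// kernel_trace mulrBl mulrC mulN1r; congr (_ - _).
rewrite cint_sum; last first.
  by move=> j _; apply: cintegrable_sum => i _; exact/cintegrableZ/KK_int.
transitivity (\tr (A *m \adj A)); last first.
  by rewrite mul_mx_adj mxtrace_scalar mulr_natl.
apply: eq_bigr => j _; rewrite cint_sum; last first.
  by move=> i _; exact/cintegrableZ/KK_int.
rewrite mxE; apply: eq_bigr => i _.
by rewrite (cintZ _ (KK_int _ _)) kernel_reproducing [A j i]mxE mulrC.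
Qed.

(** Each integration contributes [N - size s], the number of variables still free, whence the
    factorial. The factor [a] carries the normalisation through the induction; real parts appear
    because [iterated_int] takes extended real values. *)
Lemma iterated_int_det_kernel (a : R) m s : (size s + m = N)%N ->
  iterated_int m (fun t => (a * complex.Re (det_at K N (s ++ t)))%:E) =
  ((a * m`!%:R * complex.Re (det_at K (size s) s))%:E : \bar R).
Proof.
elim: m s => [|m IH] s sN /=.
  by rewrite cats0 fact0 mulr1 -sN addn0.
have [dr _] := det_kernel_int (erefl (size s)).
transitivity (\int[@dA R]_u (a * m`!%:R * complex.Re (det_at K (size s).+1 (rcons s (pt u))))%:E)%E.
  apply: eq_integral => u _.
  have := IH (rcons s (pt u)); rewrite size_rcons addSnnS => /(_ sN) <-.
  by congr iterated_int; apply/funext => t; rewrite cat_rcons.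
under eq_integral do rewrite EFinM.
rewrite integralZl// -[X in (_ * X)%E]fineK; last exact: integrable_fin_num.
have := congr1 (@complex.Re R) (cint_det_kernel (erefl (size s))).
rewrite -natrB; last by rewrite -sN leq_addr.
rewrite -sN addKn /cint /Rintegral => /= ->.
have ReMn (n : nat) (z : R[i]) : complex.Re (n%:R * z) = n%:R * complex.Re z.
  by rewrite -(rmorph_nat (real_complex R)); case: z => x y /=; rewrite mul0r subr0.
by rewrite -EFinM ReMn factS natrM; congr (_%:E); ring.
Qed.

End Determinantal.

Section ComplexExponential.
Variable R : realType.
Implicit Types z w : R[i].

Lemma ReD z w : complex.Re (z + w) = complex.Re z + complex.Re w.
Proof. by case: z; case: w. Qed.

Lemma ImD z w : complex.Im (z + w) = complex.Im z + complex.Im w.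
Proof. by case: z; case: w. Qed.

Lemma conjcM z w : conjc (z * w) = conjc z * conjc w.
Proof. exact: rmorphM. Qed.

Lemma conjcX z n : conjc (z ^+ n) = conjc z ^+ n.
Proof. exact: rmorphXn. Qed.

Lemma expcD z w : expc (z + w) = expc z * expc w.
Proof.
rewrite /expc ReD ImD expRD cosD sinD rmorphM /=.
by apply/eqP; rewrite eq_complex /=; apply/andP; split; apply/eqP; ring.
Qed.

Lemma expc0 : expc 0 = 1 :> R[i].
Proof. by rewrite /expc /= expR0 cos0 sin0 mul1r. Qed.

Lemma expcX z n : expc z ^+ n = expc (z *+ n).
Proof.
elim: n => [|n IH]; first by rewrite expr0 mulr0n expc0.
by rewrite exprS IH mulrS expcD.
Qed.

Lemma expc_conj z : conjc (expc z) = expc (conjc z).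
Proof.
case: z => a b; rewrite /expc /= cosN sinN; apply/eqP.
by rewrite eq_complex /=; apply/andP; split; apply/eqP; ring.
Qed.

Lemma normc_expc z : normc (expc z) = expR (complex.Re z).
Proof.
rewrite /expc normcM [X in _ * X](_ : _ = 1) ?mulr1.
  by rewrite /= expr0n addr0 sqrtr_sqr ger0_norm// expR_ge0.
by rewrite /= cos2Dsin2 sqrtr1.
Qed.

End ComplexExponential.

Section RadialOrthogonality.
Variable R : realType.
Let pt (u : R * R) : R[i] := of_pair u.

Definition cmeasurable (f : R * R -> R[i]) :=
  measurable_fun setT (fun u => complex.Re (f u)) /\
  measurable_fun setT (fun u => complex.Im (f u)).

Lemma cmeasurableM (f g : R * R -> R[i]) : cmeasurable f -> cmeasurable g ->
  cmeasurable (fun u => f u * g u).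
Proof.
move=> [fr fi] [gr gi]; split.
  rewrite (_ : (fun u => _) = fun u => complex.Re (f u) * complex.Re (g u) -
    complex.Im (f u) * complex.Im (g u)).
    by apply: measurable_funB; exact: measurable_funM.
  by apply/funext => u; case: (f u); case: (g u).
rewrite (_ : (fun u => _) = fun u => complex.Re (f u) * complex.Im (g u) +
  complex.Im (f u) * complex.Re (g u)).
  by apply: measurable_funD; exact: measurable_funM.
by apply/funext => u; case: (f u); case: (g u).
Qed.

Lemma cmeasurableX (f : R * R -> R[i]) n : cmeasurable f ->
  cmeasurable (fun u => f u ^+ n).
Proof.
move=> mf; elim: n => [|n IH]; first by split; exact: measurable_cst.
have := cmeasurableM mf IH.
by rewrite (_ : (fun u => f u * _) = fun u => f u ^+ n.+1)//; apply/funext => u; rewrite exprS.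
Qed.

Lemma cmeasurable_pt : cmeasurable pt.
Proof. by split => /=; [exact: measurable_fst|exact: measurable_snd]. Qed.

Lemma cmeasurable_conj (f : R * R -> R[i]) : cmeasurable f ->
  cmeasurable (fun u => conjc (f u)).
Proof.
move=> [fr fi]; split.
  by rewrite (_ : (fun u => _) = fun u => complex.Re (f u))//; apply/funext => u; case: (f u).
rewrite (_ : (fun u => _) = fun u => - complex.Im (f u)); last first.
  by apply/funext => u; case: (f u).
exact: measurable_funN.
Qed.

Lemma norm_ReIm (z : R[i]) : `|complex.Re z| <= normc z /\ `|complex.Im z| <= normc z.
Proof.
case: z => a b /=; rewrite -!sqrtr_sqr; split; apply: ler_wsqrtr.
  by rewrite lerDl sqr_ge0.
by rewrite lerDr sqr_ge0.
Qed.

Lemma normc_pt u : normc (pt u) ^+ 2 = norm2 u.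
Proof. by case: u => x y /=; rewrite sqr_sqrtr// addr_ge0// sqr_ge0. Qed.

Lemma normcX (z : R[i]) n : normc (z ^+ n) = normc z ^+ n.
Proof. by elim: n => [|n IH]; rewrite ?normc1// !exprS normcM IH. Qed.

Lemma normc_conj (z : R[i]) : normc (conjc z) = normc z.
Proof. by case: z => a b /=; rewrite sqrrN. Qed.

Variables (w : R[i] -> R) (W : R -> R) (c : nat -> R).
Hypothesis wE : forall u, w (pt u) = W (norm2 u).
Hypothesis W_ge0 : forall x, 0 <= W x.
Hypothesis mW : measurable_fun setT W.
Hypothesis c_gt0 : forall n, 0 < c n.
Hypothesis cE : forall n,
  (\int[lebesgue_measure]_(x in `]0%R, +oo[) (x ^+ n * W x)%:E = (c n)%:E)%E.

Let mWn n : measurable_fun setT (fun u => norm2 u ^+ n * W (norm2 u)).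
Proof.
apply: (measurable_funM (f := fun u => norm2 u ^+ n) (g := W \o @norm2 R)).
  by apply: measurable_funX; exact: measurable_norm2.
by apply: (measurableT_comp mW); exact: measurable_norm2.
Qed.

Lemma norm2_ge0 (u : R * R) : 0 <= norm2 u.
Proof. by rewrite addr_ge0// sqr_ge0. Qed.

Let integral_moment n :
  (\int[@dA R]_u (norm2 u ^+ n * W (norm2 u))%:E = (c n)%:E)%E.
Proof.
(* [ge0_integral_norm2] asks for a function nonnegative on the whole line, so [x] is replaced by its
   absolute value, which agrees with it on the half-line. *)
have mA : measurable_fun setT (fun x : R => (`|x| ^+ n * W x)%:E).
  apply/measurable_EFinP; apply: measurable_funM => //.
  by apply: measurable_funX; exact: normr_measurable.
have this := @ge0_integral_norm2 R (fun x : R => (`|x| ^+ n * W x)%:E) mA.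
transitivity (\int[lebesgue_measure]_(x in `]0%R, +oo[) (`|x| ^+ n * W x)%:E)%E.
  rewrite -this; last by move=> x; rewrite lee_fin mulr_ge0.
  by apply: eq_integral => u _; rewrite (ger0_norm (norm2_ge0 u)).
rewrite -cE; apply: eq_integral => x; rewrite inE /= in_itv /= andbT => x0.
by rewrite gtr0_norm.
Qed.

Let integrable_moment n :
  (@dA R).-integrable setT (EFin \o (fun u => norm2 u ^+ n * W (norm2 u))).
Proof.
apply/integrableP; split; first by apply/measurable_EFinP; exact: mWn.
under eq_integral do rewrite /= ger0_norm ?mulr_ge0 ?exprn_ge0 ?norm2_ge0//.
by rewrite integral_moment ltry.
Qed.

Let mono m n u : R[i] := (w (pt u))%:C * (pt u ^+ m * conjc (pt u) ^+ n).

Let cmeasurable_mono m n : cmeasurable (mono m n).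
Proof.
apply: cmeasurableM; last first.
  apply: cmeasurableM; apply: cmeasurableX; first exact: cmeasurable_pt.
  by apply: cmeasurable_conj; exact: cmeasurable_pt.
split; last exact: measurable_cst.
rewrite (_ : (fun u => _) = W \o @norm2 R); last by apply/funext => u /=; rewrite wE.
by apply: (measurableT_comp mW); exact: measurable_norm2.
Qed.

(** The inequality [x y <= x^2 + y^2] for [x = |z|^m] and [y = |z|^n]: integrability of mixed
    monomials follows from that of the moments. *)
Let mono_bound m n u : normc (mono m n u) <=
  norm2 u ^+ m * W (norm2 u) + norm2 u ^+ n * W (norm2 u).
Proof.
rewrite /mono wE !normcM !normcX normc_conj -!normc_pt -!exprM.
have -> : normc (W (normc (pt u) ^+ 2))%:C = W (normc (pt u) ^+ 2).
  by rewrite /= expr0n addr0 sqrtr_sqr ger0_norm.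
rewrite -mulrDl mulrC ler_wpM2r// mul2n mul2n -!addnn !exprD.
set x := normc _ ^+ m; set y := normc _ ^+ n.
by have := sqr_ge0 (x - y); have := sqr_ge0 x; have := sqr_ge0 y; rewrite !expr2; nra.
Qed.

Let cintegrable_mono m n : cintegrable (@dA R) (mono m n).
Proof.
have [mr mi] := cmeasurable_mono m n.
have I2 : (@dA R).-integrable setT (EFin \o (fun u =>
    norm2 u ^+ m * W (norm2 u) + norm2 u ^+ n * W (norm2 u))).
  by apply: (@eq_integrable _ _ _ _ _ measurableT _ _ _ (integrableD measurableT (integrable_moment m) (integrable_moment n))).
have B0 u : 0 <= norm2 u ^+ m * W (norm2 u) + norm2 u ^+ n * W (norm2 u).
  by rewrite addr_ge0// mulr_ge0// exprn_ge0// norm2_ge0.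
split; apply: (le_integrable measurableT _ _ I2).
- exact/measurable_EFinP.
- move=> u _ /=; rewrite lee_fin [leRHS]ger0_norm//.
  exact: le_trans (norm_ReIm _).1 (mono_bound _ _ _).
- exact/measurable_EFinP.
- move=> u _ /=; rewrite lee_fin [leRHS]ger0_norm//.
  exact: le_trans (norm_ReIm _).2 (mono_bound _ _ _).
Qed.
Let mono_rotate m n t u : mono m n (rotate (cos t) (sin t) u) =
  expc (0 +i* (t * (m%:R - n%:R))) * mono m n u.
Proof.
have ptr : pt (rotate (cos t) (sin t) u) = expc (0 +i* t) * pt u.
  rewrite /expc /= expR0 mul1r; case: u => x y.
  by apply/eqP; rewrite eq_complex /= ; apply/andP; split; apply/eqP; ring.
rewrite /mono !wE.
have -> : norm2 (rotate (cos t) (sin t) u) = norm2 u.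
  by rewrite -normc_pt ptr normcM normc_expc /= expR0 mul1r normc_pt.
rewrite ptr conjcM expc_conj (exprMn _ (expc _) (pt u)) (exprMn _ (expc _) (conjc _)) !expcX.
have -> : expc (0 +i* (t * (m%:R - n%:R))) =
    expc ((0 +i* t) *+ m) * expc (conjc (0 +i* t) *+ n) :> R[i].
  rewrite -expcD; congr expc.
  have Mn (z : R[i]) k : z *+ k = (complex.Re z *+ k) +i* (complex.Im z *+ k).
    elim: k => [|k IH]; first by rewrite !mulr0n.
    by rewrite !mulrS IH; case: z {IH}.
  rewrite !Mn /=; apply/eqP; rewrite eq_complex /=; apply/andP; split; apply/eqP.
    by rewrite !mul0rn addr0.
  by rewrite mulNrn mulrBr !mulr_natr.
ring.
Qed.

(** Rotation by the angle [t = 1 / (m - n)] multiplies the integrand by [exp i] and preserves the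
    integral, which must vanish since [exp i] is not 1. As [0 < |t| <= 1 < pi], also [sin t != 0],
    as the decomposition into shears requires. *)
Let cint_mono_neq m n : m != n -> cint (@dA R) (mono m n) = 0.
Proof.
move=> mn; have d0 : m%:R - n%:R != 0 :> R by rewrite subr_eq0 eqr_nat.
pose t : R := (m%:R - n%:R)^-1.
have t1 : `|t| <= 1.
  rewrite /t normfV invf_le1 ?normr_gt0//.
  have := mn; rewrite neq_ltn => /orP[mn'|mn'].
    by rewrite distrC -natrB 1?ltnW// ger0_norm ?ler0n// ler1n subn_gt0.
  by rewrite -natrB 1?ltnW// ger0_norm ?ler0n// ler1n subn_gt0.
have pi1 : 1 < pi :> R by apply: lt_le_trans (pi_ge2 R); rewrite ltr1n.
have sin1 : 0 < sin 1 :> R by apply: sin_gt0_pi; rewrite ltr01 pi1.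
have st : sin t != 0.
  have t0 : t != 0 by rewrite invr_eq0.
  have [tn|tp|/eqP] := ltgtP t 0; last by rewrite (negbTE t0).
    rewrite -oppr_eq0 -sinN gt_eqF// sin_gt0_pi// oppr_gt0 tn /=.
    by rewrite (le_lt_trans _ pi1)// -(ltr0_norm tn).
  by rewrite gt_eqF// sin_gt0_pi// tp /= (le_lt_trans _ pi1)// -(gtr0_norm tp).
pose zeta : R[i] := expc (0 +i* 1).
have zE u : mono m n (rotate (cos t) (sin t) u) = zeta * mono m n u.
  by rewrite mono_rotate mulVf.
have [mr mi] := cmeasurable_mono m n.
have key : zeta * cint (@dA R) (mono m n) = cint (@dA R) (mono m n).
  rewrite -cintZ// -(funext zE) /cint.
  have [ir ii] : cintegrable (@dA R) (fun u => mono m n (rotate (cos t) (sin t) u)).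
    by rewrite (funext zE); exact: cintegrableZ.
  have cs := cos2Dsin2 t.
  apply: (f_equal2 (@Complex R)).
    exact: (@Rintegral_dA_rotate R (cos t) (sin t) (fun u => complex.Re (mono m n u))).
  exact: (@Rintegral_dA_rotate R (cos t) (sin t) (fun u => complex.Im (mono m n u))).
have z1 : zeta - 1 != 0.
  rewrite /zeta /expc /= expR0 mul1r eq_complex /= negb_and; apply/orP; right.
  by rewrite oppr0 addr0 gt_eqF.
apply/eqP; have := congr1 (fun x => x - cint (@dA R) (mono m n)) key.
by rewrite subrr -{2}[cint _ _]mul1r -mulrBl => /eqP; rewrite mulf_eq0 (negbTE z1).
Qed.

Let cint_mono_eq n : cint (@dA R) (mono n n) = (c n)%:C.
Proof.
have E u : mono n n u = (norm2 u ^+ n * W (norm2 u))%:C.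
  rewrite /mono -exprMn mulc_conj normc_pt -rmorphXn -rmorphM /= mulrC wE//.
rewrite (@eq_cint _ _ _ (@dA R) _ _ E) /cint /=.
rewrite [X in X +i* _]/Rintegral integral_moment.
by rewrite /Rintegral integral0.
Qed.

Let orth_mono m n u : orth_fun w c m (pt u) * conjc (orth_fun w c n (pt u)) =
  ((Num.sqrt (c m) * Num.sqrt (c n))^-1)%:C * mono m n u.
Proof.
rewrite /orth_fun /mono conjcM conjc_real conjcX.
have -> : (w (pt u))%:C = (Num.sqrt (w (pt u)))%:C * (Num.sqrt (w (pt u)))%:C :> R[i].
  by rewrite -rmorphM /= -expr2 sqr_sqrtr// wE.
rewrite invfM !rmorphM /=; ring.
Qed.

Lemma orth_fun_int m n : cintegrable (@dA R)
  (fun u => orth_fun w c m (pt u) * conjc (orth_fun w c n (pt u))).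
Proof. by rewrite (funext (orth_mono m n)); exact: cintegrableZ. Qed.

Lemma orth_fun_orth m n : cint (@dA R)
  (fun u => orth_fun w c m (pt u) * conjc (orth_fun w c n (pt u))) = (m == n)%:R.
Proof.
rewrite (funext (orth_mono m n)) cintZ//; case: eqP => [->|/eqP mn].
  rewrite cint_mono_eq -rmorphM /= -expr2 sqr_sqrtr ?mulVf ?gt_eqF//.
  exact: ltW.
by rewrite cint_mono_neq// mulr0.
Qed.

End RadialOrthogonality.

Section CorrelationDeterminant.
Variable R : realType.
Variables (Q : R[i] -> \bar R) (rho alpha : R) (h : R[i] -> R) (N : nat).
Hypothesis N_gt0 : (0 < N)%N.
Hypothesis Q_fin : forall z, Q z \is a fin_num.
Let w := weight Q rho alpha h N.
Variables (W : R -> R) (c : nat -> R).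
Hypothesis wE : forall u, w (of_pair u) = W (norm2 u).
Hypothesis W_ge0 : forall x, 0 <= W x.
Hypothesis mW : measurable_fun setT W.
Hypothesis c_gt0 : forall n, 0 < c n.
Hypothesis cE : forall n,
  (\int[lebesgue_measure]_(x in `]0%R, +oo[) (x ^+ n * W x)%:E = (c n)%:E)%E.
Let K := proj_kernel w c N.

Let Gibbs_det s :
  expeR (- energy Q rho alpha h N s) =
  (\prod_(n < N) c n * complex.Re (det_at K N s))%:E.
Proof.
rewrite expeR_energy//; congr (_%:E).
have /(congr1 (@complex.Re R)) /= -> := @det_proj_kernel R w c N s (weight_ge0 _ _ _ _ _) c_gt0.
by case: (det_at K N s) => x y /=; rewrite mul0r subr0.
Qed.

Let iterated_K a m s : (size s + m = N)%N ->
  iterated_int m (fun t => (a * complex.Re (det_at K N (s ++ t)))%:E) =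
  ((a * m`!%:R * complex.Re (det_at K (size s) s))%:E : \bar R).
Proof.
apply: iterated_int_det_kernel => m' n' _ _.
- by apply: (@orth_fun_int _ w W c).
- by apply: (@orth_fun_orth _ w W c).
Qed.

Let partition_functionE :
  partition_function Q rho alpha h N = (\prod_(n < N) c n * N`!%:R)%:E.
Proof.
rewrite /partition_function.
have := iterated_K (\prod_(n < N) c n) (s := [::]) (m := N) erefl.
rewrite /= [det_at K 0 [::]](_ : _ = 1) ?mulr1 => [<-|]; last exact: det_mx00.
by congr iterated_int; apply/funext => s; rewrite Gibbs_det.
Qed.

(** Integrating out [N - k] variables produces [(N - k)!], and the partition function is [N!] times
    the same product of moments; together they cancel the combinatorial prefactor exactly. *)
Lemma correlation_det k (z : k.-tuple R[i]) : (k <= N)%N ->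
  correlation Q rho alpha h N z = (complex.Re (det_at K k z))%:E.
Proof.
move=> kN; rewrite /correlation.
have c0 : \prod_(n < N) c n != 0 by rewrite gt_eqF// prodr_gt0.
have f0 n : n`!%:R != 0 :> R by rewrite pnatr_eq0 -lt0n fact_gt0.
rewrite (_ : iterated_int _ _ =
   iterated_int (N - k) (fun t => (N`!%:R^-1 * complex.Re (det_at K N (z ++ t)))%:E)).
  rewrite iterated_K size_tuple ?subnKC// -EFinM; congr (_%:E).
  by field; rewrite !f0.
congr iterated_int; apply/funext => t.
rewrite /joint_density Gibbs_det partition_functionE inver ifF; last first.
  by apply/negP => /eqP /eqP; rewrite mulf_eq0 (negbTE c0) (negbTE (f0 _)).
rewrite -EFinM; congr (_%:E).
by field; rewrite f0 c0.
Qed.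

End CorrelationDeterminant.

(** * Consequences of subharmonicity *)

Section LogTaylor.
Variable R : realType.

(** The remainder has derivative [y^2 / (1 + y)], at most [2 y^2] in this range, so the mean value
    theorem gives a cubic bound. *)
Lemma ln_taylor2 (x : R) : `|x| <= 4^-1 ->
  `|ln (1 + x) - (x - x ^+ 2 / 2)| <= 2 * `|x| ^+ 3.
Proof.
move=> x4.
pose f (y : R) := ln (1 + y) - (y - y ^+ 2 / 2).
pose df (y : R) := (1 + y)^-1 - (1 - y).
have fd (y : R) : `|y| <= 4^-1 -> is_derive y 1 f (df y).
  move=> y4; have y0 : 0 < 1 + y by move: y4; rewrite ler_norml => /andP[]; lra.
  rewrite /f /df.
  have dln : is_derive y 1 (fun y : R => ln (1 + y)) (1 + y)^-1.
    have d1 : is_derive (1 + y) 1 (@ln R) (1 + y)^-1 by exact: is_derive1_ln.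
    have d2 : is_derive y 1 (fun y : R => 1 + y) 1.
      by rewrite -[X in is_derive _ _ _ X]add0r; apply: is_deriveD.
    have := @is_derive1_comp R (@ln R) (fun y => 1 + y) y _ _ d1 d2.
    by rewrite mulr1.
  have dq : is_derive y 1 (fun y : R => y - y ^+ 2 / 2) (1 - y).
    have -> : (fun y : R => y - y ^+ 2 / 2) = (fun y : R => y - (2^-1 : R) *: y ^+ 2).
      by apply/funext => z; rewrite mulrC.
    apply: is_derive_eq.
    by rewrite /GRing.scale /=; field.
  exact: is_deriveB.
have f0 : f 0 = 0 by rewrite /f addr0 ln1 expr0n /= mul0r !subr0.
have key (a b : R) : a <= b -> `|a| <= 4^-1 -> `|b| <= 4^-1 ->
    exists2 c, c \in `[a, b]%R & f b - f a = df c * (b - a).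
  move=> ab a4 b4.
  have abs y : a <= y -> y <= b -> `|y| <= 4^-1.
    by move: a4 b4; rewrite !ler_norml => /andP[? ?] /andP[? ?] ? ?; apply/andP; split; lra.
  apply: MVT_segment => //.
    by move=> y; rewrite in_itv /= => /andP[/ltW ay /ltW yb]; apply: fd; exact: abs.
  apply: continuous_in_subspaceT => y; rewrite inE /= in_itv /= => /andP[ay yb].
  apply: differentiable_continuous; apply/derivable1_diffP.
  by have [] := fd y (abs y ay yb).
have dfE (y : R) : `|y| <= 4^-1 -> `|df y| <= 2 * `|y| ^+ 2.
  move=> y4; have y0 : 0 < 1 + y by move: y4; rewrite ler_norml => /andP[]; lra.
  have -> : df y = y ^+ 2 / (1 + y) by rewrite /df; field; rewrite gt_eqF.
  rewrite normrM normrX mulrC ler_wpM2r ?exprn_ge0// normfV gtr0_norm//.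
  by rewrite -[leRHS]invrK lef_pV2 ?posrE ?invr_gt0//; move: y4; rewrite ler_norml => /andP[]; lra.
rewrite -/(f x).
have x0 := normr_ge0 x.
have fin (c : R) : `|c| <= `|x| -> `|f x| = `|df c| * `|x| -> `|f x| <= 2 * `|x| ^+ 3.
  move=> cx ->; have := dfE c (le_trans cx x4) => h1.
  have h2 : `|c| ^+ 2 <= `|x| ^+ 2 by rewrite ler_pXn2r// nnegrE.
  rewrite exprSr mulrA ler_wpM2r//; apply: le_trans h1 _.
  by rewrite ler_wpM2l.
have [xp|xn] := leP 0 x.
  have [|||c] := key 0 x; rewrite ?normr0 ?invr_ge0//.
  rewrite in_itv /= f0 !subr0 => /andP[c0 cx] fE.
  by apply: (fin c); [rewrite !ger0_norm|rewrite fE normrM].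
have [|||c] := key x 0; rewrite ?normr0 ?invr_ge0 ?(ltW xn)//.
rewrite in_itv /= f0 !sub0r => /andP[cx c0] fE.
apply: (fin c); first by rewrite !ler0_norm ?lerN2// ltW.
by rewrite -normrN fE normrM normrN.
Qed.

(** To be used with [1 + x = |z / c|^2], where [ln (1 + x) / 2] is [ln |z / c|]. The constant 16
    comes from [|ln (1 + x)| >= |x| / 2]. *)
Lemma log_quadratic_bound (B e x : R) : 0 < e -> `|x| <= 4^-1 ->
  B * (ln (1 + x) / 2) - e * (ln (1 + x) / 2) ^+ 2 <=
  B / 2 * (x - x ^+ 2 / 2) + `|B| * `|x| ^+ 3 - e / 16 * x ^+ 2.
Proof.
move=> e0 x4; have := ln_taylor2 x4; set l := ln (1 + x) => lx.
have h1 : B * (l / 2) <= B / 2 * (x - x ^+ 2 / 2) + `|B| * `|x| ^+ 3.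
  rewrite -lerBlDl (_ : _ - _ = B * (l - (x - x ^+ 2 / 2)) / 2); last by field.
  apply: le_trans (ler_norm _) _; rewrite !normrM (@ger0_norm _ 2^-1)//.
  rewrite -mulrA ler_wpM2l// ler_pdivrMr// [_ * 2]mulrC//.
have h2 : x ^+ 2 / 16 <= (l / 2) ^+ 2.
  have x0 := normr_ge0 x.
  have la : `|x| / 2 <= `|l|.
    have hx : `|x| - `|x| ^+ 2 / 2 - 2 * `|x| ^+ 3 <= `|l|.
      have : `|x - x ^+ 2 / 2| <= `|l| + 2 * `|x| ^+ 3.
        rewrite -[X in `|X|](subrKC l) -[x - _ - _]opprB.
        by apply: le_trans (ler_normD _ _) _; rewrite normrN lerD2l.
      have : `|x| <= `|x - x ^+ 2 / 2| + `|x| ^+ 2 / 2.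
        rewrite -{1}(subrK (x ^+ 2 / 2) x); apply: le_trans (ler_normD _ _) _.
        by rewrite lerD2l normrM normrX (@ger0_norm _ 2^-1).
      lra.
    apply: le_trans hx.
    have : `|x| ^+ 2 <= `|x| / 4 by rewrite expr2 ler_wpM2l.
    have : `|x| ^+ 3 <= `|x| / 16.
      rewrite exprS ler_wpM2l// expr2; have := ler_pM x0 x0 x4 x4.
      by move=> /le_trans; apply; rewrite -invfM -natrM.
    lra.
  rewrite expr_div_n ler_pdivlMr// -(real_normK (num_real l)).
  apply: (@le_trans _ _ ((`|x| / 2) ^+ 2)).
    rewrite expr_div_n real_normK ?num_real//.
    have := sqr_ge0 x; rewrite -![2 ^+ 2]natrX; lra.
  by rewrite ler_pXn2r// nnegrE// divr_ge0.
have h3 : e / 16 * x ^+ 2 <= e * (l / 2) ^+ 2.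
  by rewrite -mulrA; apply: ler_wpM2l; [exact: ltW|rewrite mulrC].
lra.
Qed.

End LogTaylor.

Section CircleMean.
Variable R : realType.
Let mu := @lebesgue_measure R.

Lemma integral_trig2 (a0 a1 a2 : R) :
  (\int[mu]_(t in `[0%R, (2 * pi)%R]) (a0 + a1 * cos t + a2 * cos t ^+ 2)%:E =
   (2 * pi * (a0 + a2 / 2))%:E)%E.
Proof.
pose F (t : R) := a0 * t + a1 * sin t + a2 / 2 * (t + sin t * cos t).
have pi0 := pi_gt0 R.
have dF (t : R) : is_derive t 1 F (a0 + a1 * cos t + a2 * cos t ^+ 2).
  have -> : F = (fun t => a0 *: t + a1 *: sin t + (a2 / 2) *: (t + sin t * cos t)) by [].
  apply: is_derive_eq.
  rewrite /GRing.scale /=; have := cos2Dsin2 t; rewrite !expr2 => cs.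
  have -> : sin t * - sin t = cos t * cos t - 1 by rewrite -cs; ring.
  by field.
have cF : continuous F.
  move=> t; apply: differentiable_continuous; apply/derivable1_diffP.
  by have [] := dF t.
rewrite (@continuous_FTC2 _ _ F).
- rewrite /F (_ : 2 * pi = 0 + pi *+ 2) ?sin0; last by rewrite add0r mulr2n; ring.
  rewrite sinD2pi cosD2pi sin0 -EFinB; congr (_%:E).
  by rewrite mulr2n; field.
- by rewrite mulr_gt0.
- apply: continuous_subspaceT => t.
  apply: cvgD; first apply: cvgD; first exact: cvg_cst.
    by apply: cvgMr; exact: continuous_cos.
  by apply: cvgMr; apply: (cvgM (@continuous_cos R t) (@continuous_cos R t)).
- split.
  + by move=> t _; have [] := dF t.
  + by apply: cvg_at_right_filter; exact: cF.
  + by apply: cvg_at_left_filter; exact: cF.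
- by move=> t _; rewrite derive1E; have [_ ->] := dF t.
Qed.

End CircleMean.

Section RadialSubharmonic.
Variable R : realType.
Variables (Q : R[i] -> \bar R) (q : R -> \bar R).
Hypothesis Q_radial : forall z, Q z = q (normc z).
Hypothesis Q_subharmonic : subharmonic_on setT Q.
Hypothesis q_fin : forall r, 0 < r -> q r \is a fin_num.
Let g := fine \o q.
Hypothesis g_cont : forall r, 0 < r -> {for r, continuous g}.

Let normc_circle (c s t : R) : 0 < c ->
  normc (c%:C + (c * s)%:C * (cos t +i* sin t)) =
  c * Num.sqrt (1 + (2 * s * cos t + s ^+ 2)).
Proof.
move=> c0 /=; rewrite !mul0r subr0 !addr0 add0r.
rewrite -[c in RHS](gtr0_norm c0) -sqrtr_sqr -sqrtrM ?sqr_ge0//; congr Num.sqrt.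
have := cos2Dsin2 t; rewrite !expr2 => cs.
have -> : (c + c * s * cos t) * (c + c * s * cos t) + c * s * sin t * (c * s * sin t) =
  c * c * (1 + 2 * s * cos t + s * s * (cos t * cos t + sin t * sin t)) by ring.
by rewrite cs; ring.
Qed.

(* On a small circle about [c] the logarithm [y = ln (r / c)] has mean zero, so
   the mean of [B y - e y ^ 2] is strictly negative to leading order. *)
Lemma no_superharmonic_touching (c delta e B : R) : 0 < c -> 0 < delta -> 0 < e ->
  ~ (forall r, 0 < r -> `|r - c| < delta ->
       g r <= g c + B * ln (r / c) - e * ln (r / c) ^+ 2).
Proof.
move=> c0 d0 e0 touch.
(* The coefficient of [- x^2] in the quadratic bound. With [x = 2 s cos t + s^2] and the mean of
   [cos^2] equal to 1/2, the order [s^2] of the mean is [B / 2 - 2 kap = - e / 8]: the terms in [B]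
   cancel. *)
pose kap := B / 4 + e / 16.
pose m := 27 * `|B| + `|kap| + 1.
have m0 : 0 < m by rewrite /m; have := normr_ge0 B; have := normr_ge0 kap; lra.
(* The three bounds ensure [|x| <= 3 s <= 1/4], that the circle of radius [c s] stays where the
   touching inequality holds, and that the errors, at most [m s^3], do not exceed half of the gain
   [e s^2 / 8]. *)
pose s := Num.min 12^-1 (Num.min (delta / (2 * c)) (e / (16 * m))).
have s0 : 0 < s by rewrite /s !lt_min invr_gt0 ltr0n !divr_gt0// mulr_gt0.
have s12 : s <= 12^-1 by rewrite /s ge_min lexx.
have sd : c * s < delta.
  apply: (@le_lt_trans _ _ (delta / 2)); last by lra.
  have : s <= delta / (2 * c) by rewrite /s !ge_min lexx !orbT.
  by rewrite ler_pdivlMr ?mulr_gt0//; lra.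
have sm : s * m <= e / 16.
  have : s <= e / (16 * m) by rewrite /s !ge_min lexx !orbT.
  by rewrite ler_pdivlMr ?mulr_gt0//; lra.
pose x t : R := 2 * s * cos t + s ^+ 2.
have xs t : `|x t| <= 3 * s.
  apply: le_trans (ler_normD _ _) _.
  rewrite [`|s ^+ 2|]normrX !normrM (@ger0_norm _ 2)// (gtr0_norm s0).
  have h1 : s * `|cos t| <= s by rewrite ler_piMr ?cos_max// ltW.
  have h2 : s ^+ 2 <= s by rewrite expr2 ler_piMr ?ltW//; lra.
  lra.
have x4 t : `|x t| <= 4^-1 by apply: le_trans (xs t) _; lra.
have x1 t : 0 < 1 + x t by have := x4 t; rewrite ler_norml => /andP[]; lra.
pose n t := normc (c%:C + (c * s)%:C * (cos t +i* sin t)).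
have nE t : n t = c * Num.sqrt (1 + x t) by rewrite /n normc_circle.
have n0 t : 0 < n t by rewrite nE mulr_gt0// sqrtr_gt0.
have nc t : `|n t - c| < delta.
  apply: le_lt_trans sd; rewrite nE.
  have -> : c * Num.sqrt (1 + x t) - c = c * (Num.sqrt (1 + x t) - 1) by ring.
  rewrite normrM (gtr0_norm c0) ler_wpM2l ?(ltW c0)//.
  have s1 : 0 <= 1 - s by lra.
  have s2 : 0 <= 1 + s by lra.
  have lo : 1 - s <= Num.sqrt (1 + x t).
    rewrite -(ger0_norm s1) -sqrtr_sqr ler_wsqrtr// /x.
    have := cos_geN1 t; have := sqr_ge0 s; rewrite !expr2; nra.
  have hi : Num.sqrt (1 + x t) <= 1 + s.
    rewrite -(ger0_norm s2) -sqrtr_sqr ler_wsqrtr// /x.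
    have := cos_le1 t; have := sqr_ge0 s; rewrite !expr2; nra.
  by rewrite ler_norml; apply/andP; split; lra.
have lnE t : ln (n t / c) = ln (1 + x t) / 2.
  rewrite nE mulrAC divff ?gt_eqF// mul1r -powR12_sqrt ?(ltW (x1 t))//.
  by rewrite ln_powR mulrC.
pose a0 := g c + B / 2 * s ^+ 2 + 27 * `|B| * s ^+ 3 - kap * s ^+ 4.
pose a1 := B * s - 4 * kap * s ^+ 3.
pose a2 := - (4 * kap * s ^+ 2).
have bound t : g (n t) <= a0 + a1 * cos t + a2 * cos t ^+ 2.
  apply: le_trans (touch _ (n0 t) (nc t)) _; rewrite lnE.
  rewrite -addrA; apply: le_trans (lerD (lexx _) (log_quadratic_bound B e0 (x4 t))) _.
  have h3 : `|B| * `|x t| ^+ 3 <= 27 * `|B| * s ^+ 3.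
    have -> : 27 * `|B| * s ^+ 3 = `|B| * (3 * s) ^+ 3 by rewrite exprMn; ring.
    by rewrite ler_wpM2l// ler_pXn2r// nnegrE// mulr_ge0// ltW.
  have -> : a0 + a1 * cos t + a2 * cos t ^+ 2 =
     g c + B / 2 * (x t - x t ^+ 2 / 2) + 27 * `|B| * s ^+ 3 - e / 16 * x t ^+ 2.
    by rewrite /a0 /a1 /a2 /kap /x; field.
  lra.
have mean_lt : a0 + a2 / 2 < g c.
  rewrite /a0 /a2.
  have h1 : 27 * `|B| * s ^+ 3 - kap * s ^+ 4 <= s ^+ 2 * (s * m).
    have k1 : - kap <= `|kap| by rewrite -normrN ler_norm.
    have k2 : - kap * s ^+ 4 <= `|kap| * s ^+ 3.
      apply: (@le_trans _ _ (`|kap| * s ^+ 4)).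
        by rewrite ler_wpM2r// exprn_ge0// ltW.
      by rewrite ler_wpM2l// exprS ler_piMl// ?exprn_ge0 ?(ltW s0)//; lra.
    have -> : s ^+ 2 * (s * m) = 27 * `|B| * s ^+ 3 + `|kap| * s ^+ 3 + s ^+ 3.
      by rewrite /m; ring.
    have : 0 <= s ^+ 3 by rewrite exprn_ge0// ltW.
    lra.
  have s20 : 0 < s ^+ 2 by rewrite exprn_gt0.
  have h2 : s ^+ 2 * (s * m) <= s ^+ 2 * (e / 16) by rewrite ler_wpM2l// ltW.
  have h4 : 0 < e * s ^+ 2 by rewrite mulr_gt0.
  rewrite /kap in h1 *; lra.
have pi0 := pi_gt0 R.
have sub : (Q c%:C <= circle_mean Q c%:C (c * s))%E.
  by case: Q_subharmonic => _ _; apply; rewrite ?mulr_gt0// => z _.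
have QgE t : Q (c%:C + (c * s)%:C * (cos t +i* sin t)) = (g (n t))%:E.
  by rewrite Q_radial /g /= fineK// q_fin//; exact: n0.
have cn : continuous n.
  rewrite (_ : n = fun t => c * Num.sqrt (1 + x t)); last by apply/funext => t; rewrite nE.
  move=> t; apply: cvgMr; apply: (@continuous_comp _ _ _ (fun t => 1 + x t) Num.sqrt); last exact: sqrt_continuous.
  apply: cvgD; first exact: cvg_cst.
  by apply: cvgD; [apply: cvgMr; exact: continuous_cos|exact: cvg_cst].
have cgn : continuous (fun t => g (n t)).
  by move=> t; apply: (@continuous_comp _ _ _ n g); [exact: cn|apply: g_cont].
have : (circle_mean Q c%:C (c * s) <= (a0 + a2 / 2)%:E)%E.
  rewrite /circle_mean; under eq_integral do rewrite QgE.
  have -> : (a0 + a2 / 2)%:E = ((2 * pi)^-1%:E * (2 * pi * (a0 + a2 / 2))%:E)%E.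
    by rewrite -EFinM mulKf// gt_eqF// mulr_gt0.
  rewrite lee_pmul2l//; last by rewrite lte_fin invr_gt0 mulr_gt0.
  rewrite -(@integral_trig2 R a0 a1 a2); apply: le_integral => //.
  - apply: continuous_compact_integrable; first exact: segment_compact.
    exact: continuous_subspaceT.
  - apply: continuous_compact_integrable; first exact: segment_compact.
    apply: continuous_subspaceT => t.
    apply: cvgD; first apply: cvgD; first exact: cvg_cst.
      by apply: cvgMr; exact: continuous_cos.
    by apply: cvgMr; apply: (cvgM (@continuous_cos R t) (@continuous_cos R t)).
  - by move=> t _; rewrite lee_fin.
move=> /(le_trans sub); rewrite Q_radial /= expr0n addr0 sqrtr_sqr gtr0_norm//.
by rewrite -(fineK (q_fin c0)) lee_fin leNgt mean_lt.
Qed.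

End RadialSubharmonic.

Section TangentInequality.
Variable R : realType.
Variables (Q : R[i] -> \bar R) (q : R -> \bar R).
Hypothesis Q_radial : forall z, Q z = q (normc z).
Hypothesis Q_subharmonic : subharmonic_on setT Q.
Hypothesis q_fin : forall r, 0 < r -> q r \is a fin_num.
Let g := fine \o q.
Hypothesis g_derivable : forall r, 0 < r -> derivable g r 1.

Lemma left_increase (v : R -> R) (a b d : R) : a < b -> is_derive b 1 v d ->
  d < 0 -> exists2 r, a < r < b & v b < v r.
Proof.
move=> ab [dv vE] d0.
have cv : h^-1 *: (v (h *: 1 + b) - v b) @[h --> 0^'] --> d by rewrite -vE; exact: dv.
have := cvgr_lt d cv 0 d0.
move=> [e /= e0 He].
pose h := Num.min (e / 2) ((b - a) / 2).
have h0 : 0 < h by rewrite /h lt_min !divr_gt0// subr_gt0.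
have he : h < e by rewrite (@le_lt_trans _ _ (e / 2))// ?ge_min ?lexx//; lra.
have hb : h < b - a.
  rewrite (@le_lt_trans _ _ ((b - a) / 2))// ?ge_min ?lexx ?orbT//; lra.
exists (b - h); first by apply/andP; split; lra.
have := He (- h); rewrite /= sub0r opprK (gtr0_norm h0) => /(_ he).
rewrite oppr_eq0 gt_eqF// => /(_ isT).
rewrite invrN /GRing.scale /= mulr1 mulNr oppr_lt0 pmulr_rgt0 ?invr_gt0//.
by rewrite subr_gt0 addrC.
Qed.

Lemma g_continuous (r : R) : 0 < r -> {for r, continuous g}.
Proof.
by move=> r0; apply: differentiable_continuous; apply/derivable1_diffP/g_derivable.
Qed.

(** If the bound failed at [r], the chord over [[r, rho]] would be steeper in [ln r] than the
    tangent at [rho]. Subtracting an intermediate slope and adding a small convex quadratic gives a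
    function [v] with an interior maximum, where [g] is touched from above by a strictly concave
    function of the logarithm. *)
Lemma tangent_ineq (rho r : R) : 0 < rho -> 0 < r <= rho ->
  g rho + rho * derive1 g rho * ln (r / rho) <= g r.
Proof.
move=> rho0 /andP[r0]; rewrite le_eqVlt => /predU1P[->|rrho].
  by rewrite divff ?gt_eqF// ln1 mulr0 addr0.
rewrite leNgt; apply/negP => lt.
pose T := rho * derive1 g rho.
pose lam := ln (rho / r).
have lam0 : 0 < lam by rewrite ln_gt0// ltr_pdivlMr// mul1r.
have lamE : lam = ln rho - ln r by rewrite /lam ln_div// posrE.
have rE : ln (r / rho) = - lam by rewrite ln_div ?posrE// lamE opprB.
pose sig := (g rho - g r) / lam.
have sigT : T < sig by rewrite /sig ltr_pdivlMr//; move: lt; rewrite rE -/T; lra.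
(* Being below the chord slope makes [v r < v rho]; being above the tangent slope makes [v] decrease
   at [rho]. So the maximum is at neither end. *)
pose a := (sig + T) / 2.
have aT : T < a by rewrite /a; lra.
have asig : a < sig by rewrite /a; lra.
(* The quadratic term of [v] vanishes at both ends and adds [e * lam] to the logarithmic slope at
   [rho]; this value uses up only half of the gap [a - T]. *)
pose e := (a - T) / (2 * lam).
have e0 : 0 < e by rewrite divr_gt0// ?subr_gt0// mulr_gt0.
pose v (x : R) := g x - a * ln x + e * ((ln x - ln r) * (ln x - ln rho)).
have vr : v r = g r - a * ln r by rewrite /v subrr mul0r mulr0 addr0.
have vrho : v rho = g rho - a * ln rho by rewrite /v subrr !mulr0 addr0.
have v_incr : v r < v rho.
  rewrite vr vrho -subr_gt0 (_ : _ - _ = (sig - a) * lam); last first.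
    by rewrite mulrBl {1}/sig divfK ?gt_eqF// lamE; ring.
  by rewrite mulr_gt0// subr_gt0.
have dv (x : R) : 0 < x -> is_derive x 1 v
    (derive1 g x - a * x^-1 + e * ((2 * ln x - ln r - ln rho) * x^-1)).
  move=> x0.
  have d1 : is_derive x 1 g (derive1 g x) by rewrite derive1E; apply: DeriveDef => //; exact: g_derivable.
  have d2 := is_derive1_ln x0.
  have -> : v = (fun x => g x - a *: ln x + e *: ((ln x - ln r) * (ln x - ln rho))) by [].
  apply: is_derive_eq; rewrite /GRing.scale /=; ring.
have dvrho : is_derive rho 1 v ((T - a) / 2 / rho).
  have := dv _ rho0; congr is_derive.
  rewrite (_ : 2 * ln rho - _ - _ = lam); last by rewrite lamE; ring.
  by rewrite /e /T; field; rewrite (gt_eqF rho0) (gt_eqF lam0).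
have [|r2 /andP[r2r r2rho] vr2] := left_increase rrho dvrho.
  by rewrite pmulr_llt0 ?invr_gt0// pmulr_llt0//; lra.
have cv : {within `[r, rho], continuous v}.
  apply: continuous_in_subspaceT => x; rewrite inE /= in_itv /= => /andP[rx _].
  apply: differentiable_continuous; apply/derivable1_diffP.
  by have [] := dv x (lt_le_trans r0 rx).
have [c] := EVT_max (ltW rrho) cv.
rewrite in_itv /= => /andP[rc crho] cmax.
have vc_rho : v rho < v c.
  by apply: lt_le_trans vr2 _; apply: cmax; rewrite in_itv /= !ltW.
have {}rc : r < c.
  rewrite lt_neqAle rc andbT; apply/eqP => rcE.
  by move: (lt_trans v_incr vc_rho); rewrite rcE ltxx.
have {}crho : c < rho.
  rewrite lt_neqAle crho andbT; apply/eqP => rcE.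
  by move: vc_rho; rewrite rcE ltxx.
have c0 : 0 < c by exact: lt_trans rc.
(* The slope at [c] after recentring the quadratic: [v x <= v c] becomes exactly the touching
   inequality in [ln (x / c)]. *)
pose B := a - e * (2 * ln c - ln r - ln rho).
have d0 : 0 < Num.min (c - r) (rho - c) by rewrite lt_min !subr_gt0 rc.
apply: (no_superharmonic_touching Q_radial Q_subharmonic q_fin g_continuous
  (B := B) c0 d0 e0) => x x0.
rewrite lt_min !ltr_norml => /andP[/andP[x1 _] /andP[_ x2]].
have : v x <= v c by apply: cmax; rewrite in_itv /=; apply/andP; split; lra.
rewrite /v /B ln_div ?posrE// -/g; nra.
Qed.

End TangentInequality.

Section DropletEdge.
Variable R : realType.
Variables (Q : R[i] -> \bar R) (q : R -> \bar R) (rho1 rho : R).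
Hypothesis Q_radial : forall z, Q z = q (normc z).
Hypothesis Q_gtNy : forall z, (-oo < Q z)%E.
Hypothesis Q_lsc : lower_semicontinuous (Q : R[i]^o -> \bar R).
Hypothesis q_fin : forall r, 0 < r -> q r \is a fin_num.
Let g := fine \o q.
Hypothesis g_derivable : forall r, 0 < r -> derivable g r 1.
Hypothesis dq_ac : forall a b, 0 < a -> a <= b -> absolutely_continuous_on a b (dq q).

Lemma absolutely_continuous_within (a b : R) (f : R -> R) : a < b ->
  absolutely_continuous_on a b f -> {within `[a, b], continuous f}.
Proof.
move=> ab fac; apply/subspace_continuousP => x /= xab.
apply/cvgrPdist_lt => eps eps0; have [d d0 Hd] := fac eps eps0.
rewrite near_withinE; near=> y => yab.
have xy : `|x - y| < d by near: y; exact: nbhsx_ballx.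
move: xab yab; rewrite /= !in_itv /= => /andP[ax xb] /andP[ay yb].
have := Hd 1%N (fun=> Num.min x y) (fun=> Num.max x y); rewrite !big_ord1 => H.
have -> : `|f x - f y| = `|f (Num.max x y) - f (Num.min x y)|.
  by rewrite maxEle minEle; case: ifP => // _; rewrite distrC.
apply: H.
- move=> _; rewrite le_min ax ay /= ge_max xb yb; split => //; split => //.
  by rewrite le_max ge_min lexx.
- by move=> i j; rewrite !ord1 eqxx.
- move: xy; rewrite ltr_norml => /andP[? ?].
  by rewrite maxEle minEle; case: ifP => _; lra.
Unshelve. all: by end_near. Qed.

(** Lower semicontinuity of [Q] at 0, transported to small radii. It excludes a logarithmic fall of
    [q] at the origin and later bounds the weight there. *)
Lemma potential_lower_bound_near0 :
  exists b, exists2 d, 0 < d & forall r, 0 < r -> r < d -> b < g r.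
Proof.
pose z0 : R[i] := 0.
have [b bQ] : exists b : R, (b%:E < Q z0)%E.
  have := Q_gtNy z0; case: (Q z0) => [x| |//] _.
    by exists (x - 1); rewrite lte_fin; lra.
  by exists 0; rewrite ltry.
have [V /nbhs_ballP[e /= e0 eV] Vb] := Q_lsc bQ.
(* Balls of [R[i]^o] have radii in [R[i]], and a positive element of [R[i]] is real. *)
have [d d0 dE] : exists2 d : R, 0 < d & e = d%:C.
  case: e e0 {eV} => x y; rewrite ltcE /= => /andP[/eqP -> x0].
  by exists x.
exists b, d => // r r0 rd.
have := Vb r%:C; rewrite Q_radial /= expr0n addr0 sqrtr_sqr gtr0_norm//.
rewrite -(fineK (q_fin r0)) lte_fin; apply; apply: eV.
by rewrite /ball /= sub0r normrN dE normc_def /= expr0n addr0 sqrtr_sqr gtr0_norm// ltcR.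
Qed.

(* If [r q'(r)] stayed above 2 then [q <= 2 ln + C] near 0, against the lower
   semicontinuity of [Q] at 0. *)
Lemma edge_lt2 : is_least [set r | 0 < r /\ r * dq q r = 2] rho1 -> 0 < rho ->
  rho < rho1 -> rho * dq q rho < 2.
Proof.
move=> [_ rho1_lb] rho0 rho_lt.
have ne2 (r : R) : 0 < r -> r <= rho -> r * dq q r != 2.
  move=> r0 rr; apply/eqP => rE; have := rho1_lb r (conj r0 rE).
  by rewrite leNgt (le_lt_trans rr).
rewrite ltNge; apply/negP => ge2.
(* The value 2 is not attained before [rho1], and absolute continuity makes [q'] continuous, so the
   intermediate value theorem propagates the inequality down from [rho]. *)
have gt2 (r : R) : 0 < r -> r <= rho -> 2 < r * dq q r.
  move=> r0; rewrite le_eqVlt => /predU1P[->|rr].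
    by rewrite lt_neqAle ge2 eq_sym ne2.
  rewrite ltNge; apply/negP => le2.
  have cF : {within `[r, rho], continuous (fun x => x * dq q x)}.
    have cd := absolutely_continuous_within rr (dq_ac r0 (ltW rr)).
    move=> x; apply: (@cvgM _ (subspace `[r, rho])); last exact: cd.
    by apply: (@continuous_subspaceT _ _ `[r, rho] (@id R)) => y; exact: cvg_id.
  have [|c] := IVT (v := 2) (ltW rr) cF.
    by rewrite ge_min le_max le2 ge2 orbT.
  rewrite in_itv /= => /andP[rc crho] cE.
  by move: (ne2 c (lt_le_trans r0 rc) crho); rewrite cE eqxx.
have gle (r : R) : 0 < r -> r < rho -> g r - 2 * ln r <= g rho - 2 * ln rho.
  move=> r0 rr.
  pose f x := g x - 2 * ln x.
  have df (x : R) : 0 < x -> is_derive x 1 f (derive1 g x - 2 * x^-1).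
    move=> x0.
    have d1 : is_derive x 1 g (derive1 g x) by rewrite derive1E; apply: DeriveDef => //; exact: g_derivable.
    have d2 := is_derive1_ln x0.
    have -> : f = (fun x => g x - 2 *: ln x) by [].
    by apply: is_derive_eq; rewrite /GRing.scale /=.
  have [||c] := @MVT_segment R f (fun x => derive1 g x - 2 * x^-1) r rho (ltW rr).
  - by move=> x; rewrite in_itv /= => /andP[rx _]; apply: df; exact: lt_trans rx.
  - apply: continuous_in_subspaceT => x; rewrite inE /= in_itv /= => /andP[rx _].
    apply: differentiable_continuous; apply/derivable1_diffP.
    by have [] := df x (lt_le_trans r0 rx).
  rewrite in_itv /= => /andP[rc crho] fE.
  have c0 : 0 < c by exact: lt_le_trans rc.
  have : 0 <= f rho - f r; last by rewrite /f; lra.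
  rewrite fE mulr_ge0//; last by lra.
  have := gt2 c c0 crho; rewrite /dq -/g => h.
  rewrite subr_ge0 ler_pdivrMr// mulrC; exact: ltW.
have [b [d d0 near0]] := potential_lower_bound_near0.
pose C := g rho - 2 * ln rho.
(* Small enough that the upper bound [2 * ln r + C] of [g r] is at most the lower bound [b]. *)
pose r := Num.min (d / 2) (Num.min (rho / 2) (expR ((b - C) / 2))).
have r0 : 0 < r by rewrite !lt_min !divr_gt0// expR_gt0.
have rd : r < d.
  by rewrite (@le_lt_trans _ _ (d / 2)) ?ge_min ?lexx//; lra.
have rr : r < rho.
  by rewrite (@le_lt_trans _ _ (rho / 2)) ?ge_min ?lexx ?orbT//; lra.
have lr : ln r <= (b - C) / 2.
  by rewrite -[leRHS]expRK ler_ln ?posrE ?expR_gt0// !ge_min lexx !orbT.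
have := near0 r r0 rd; have := gle r r0 rr; rewrite -/C; lra.
Qed.

End DropletEdge.

(** * Asymptotics of the radial moments *)

Section RealDominated.
Context d (T : measurableType d) (R : realType).
Variable mu : {measure set T -> \bar R}.

Lemma Rdominated_convergence (D : set T) (f_ : nat -> T -> R) (f g : T -> R) :
  measurable D -> (forall n, measurable_fun D (f_ n)) -> measurable_fun D f ->
  (forall x, D x -> f_ n x @[n --> \oo] --> f x) ->
  mu.-integrable D (EFin \o g) -> (forall n x, D x -> `|f_ n x| <= g x) ->
  mu.-integrable D (EFin \o f) /\
  \int[mu]_(x in D) f_ n x @[n --> \oo] --> \int[mu]_(x in D) f x.
Proof.
move=> mD mf_ mf cf ig fg.
have [|||||i _ c] := @dominated_convergence _ _ _ mu D mD
  (fun n => EFin \o f_ n) (EFin \o f) (EFin \o g).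
- by move=> n; exact/measurable_EFinP.
- exact/measurable_EFinP.
- by apply: aeW => x Dx; apply/cvg_EFin; [exact: nearW|exact: cf].
- exact: ig.
- by apply: aeW => x n Dx; rewrite lee_fin fg.
split => //; rewrite /Rintegral; apply: fine_cvg.
by rewrite fineK//; exact: integrable_fin_num.
Qed.

Lemma gt0_integral (D : set T) (f : T -> R) : measurable D -> measurable_fun D f ->
  (forall x, D x -> 0 < f x) -> (0 < mu D)%E -> (0 < \int[mu]_(x in D) (f x)%:E)%E.
Proof.
move=> mD mf f0 muD; rewrite lt_neqAle integral_ge0 ?andbT; last first.
  by move=> x Dx; rewrite lee_fin ltW// f0.
apply/eqP => I0.
have mE : measurable_fun D (EFin \o f) by exact/measurable_EFinP.
have : (\int[mu]_(x in D) `|(EFin \o f) x| = 0)%E.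
  rewrite I0; apply: eq_integral => x; rewrite inE => Dx.
  by rewrite gee0_abs// lee_fin ltW// f0.
move=> /(ae_eq_integral_abs mu mD mE) [A [mA A0 DA]].
have : (mu D <= mu A)%E.
  apply: le_measure; rewrite ?inE// => x Dx; apply: DA => /= /(_ Dx) [fx].
  by have := f0 x Dx; rewrite fx ltxx.
by rewrite A0 leNgt muD.
Qed.

End RealDominated.

Section GammaIntegral.
Variables (R : realType) (alpha : R).
Hypothesis alpha_gt : -1 < alpha.
Let mu : {measure set (measurableTypeR R) -> \bar R} := @lebesgue_measure R.
Let I0y : set (measurableTypeR R) := `]0%R, +oo[%classic.

Let mI0y : measurable I0y. Proof. by rewrite /I0y. Qed.

Lemma measurable_powR_exp (c : R) :
  measurable_fun setT (fun s : R => s `^ alpha * expR (- (c * s))).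
Proof.
apply: measurable_funM; first exact: measurable_powR.
by apply: measurableT_comp => //; apply: measurable_funN; apply: measurable_funM.
Qed.

(** The integrand may be singular at 0, so the fundamental theorem is applied on [[1 / (n + 1), 1]];
    the bound [1 / (alpha + 1)] is uniform in [n] and survives monotone convergence. *)
Lemma integral_powR_01 :
  (\int[mu]_(s in `]0%R, 1%R]) (s `^ alpha)%:E < +oo)%E.
Proof.
have a1 : 0 < alpha + 1 by rewrite -ltrBlDr sub0r.
pose F n : set (measurableTypeR R) := `[n.+1%:R^-1, 1%R]%classic.
have F_nd : nondecreasing_seq F.
  move=> m n mn; apply/subsetPset => x; rewrite /F /= !in_itv /= => /andP[h ->].
  by rewrite andbT (le_trans _ h)// lef_pV2 ?posrE// ler_nat.
have bF : \bigcup_n F n = `]0%R, 1%R]%classic.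
  apply/seteqP; split => x.
    move=> [n _]; rewrite /F /= !in_itv /= => /andP[h ->].
    by rewrite andbT (lt_le_trans _ h)// invr_gt0.
  rewrite /= in_itv /= => /andP[x0 x1].
  exists (Num.truncn x^-1) => //; rewrite /F /= in_itv /= x1 andbT.
  by rewrite -[leRHS]invrK lef_pV2 ?posrE ?invr_gt0// ltW// truncnS_gt.
have mp : measurable_fun setT (fun s : R => (s `^ alpha)%:E).
  by apply/measurable_EFinP; exact: measurable_powR.
have cvgI := @ge0_nondecreasing_set_cvg_integral _ _ R F (fun s => (s `^ alpha)%:E) mu F_nd.
apply: (@le_lt_trans _ _ ((alpha + 1)^-1)%:E); last exact: ltry.
have {cvgI} : (\int[mu]_(x in F n) (x `^ alpha)%:E)%E @[n --> \oo] -->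
    (\int[mu]_(x in `]0%R, 1%R]) (x `^ alpha)%:E)%E.
  rewrite -bF; apply: cvgI => //.
  - by move=> n; rewrite /F.
  - by move=> n; exact: measurable_funTS.
  - by move=> n x _; rewrite lee_fin powR_ge0.
move=> cvgI; rewrite -(cvg_lim _ cvgI)//; apply: lime_le; first by apply/cvg_ex; eexists; exact: cvgI.
apply: nearW => n.
have n0 : 0 < n.+1%:R^-1 :> R by rewrite invr_gt0.
have n1 : n.+1%:R^-1 <= 1 :> R by rewrite invf_le1// ler1n.
move: n1; rewrite le_eqVlt => /predU1P[nE|n1].
  by rewrite /F nE set_itv1 integral_set1 lee_fin invr_ge0 ltW.
pose G (s : R) := (alpha + 1)^-1 * s `^ (alpha + 1).
have dG (s : R) : 0 < s -> is_derive s 1 G (s `^ alpha).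
  move=> s0; have dp := is_derive1_powR (alpha + 1) s0.
  have -> : G = (fun s => (alpha + 1)^-1 *: s `^ (alpha + 1)) by [].
  by apply: is_derive_eq; rewrite /GRing.scale /= mulrA mulVf ?gt_eqF// mul1r addrK.
have cG (s : R) : 0 < s -> {for s, continuous G}.
  move=> s0; apply: differentiable_continuous; apply/derivable1_diffP.
  by have [] := dG s s0.
rewrite [X in (X <= _)%E](@continuous_FTC2 _ _ G _ _ n1).
- rewrite -EFinB lee_fin /G powR1 mulr1 gerBl mulr_ge0 ?powR_ge0//.
  by rewrite invr_ge0 ltW.
- apply: continuous_in_subspaceT => s; rewrite inE /= in_itv /= => /andP[ns _].
  apply: differentiable_continuous; apply/derivable1_diffP.
  by apply: derivable_powR; rewrite in_itv /= andbT (lt_le_trans n0).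
- split.
  + by move=> s; rewrite in_itv /= => /andP[ns _]; have [] := dG s (lt_trans n0 ns).
  + by apply: cvg_at_right_filter; exact: cG.
  + by apply: cvg_at_left_filter; exact: cG.
- by move=> s; rewrite in_itv /= => /andP[ns _]; rewrite derive1E; have [_ ->] := dG s (lt_trans n0 ns).
Qed.

Lemma integral_exp_rate (c : R) : 0 < c ->
  (\int[mu]_(s in I0y) (c * expR (- (c * s)))%:E = 1)%E.
Proof.
move=> c0.
have mg : measurable_fun I0y (fun s : R => (c * expR (- (c * s)))%:E).
  apply: measurable_funTS; apply/measurable_EFinP; apply: measurable_funM => //.
  by apply: measurableT_comp => //; apply: measurable_funN; apply: measurable_funM.
rewrite /I0y integral_itv_obnd_cbnd// -(integral_exponential_pdf c0).
rewrite [LHS]integral_mkcond; apply: eq_integral => x _.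
by rewrite /exponential_pdf !patchE; case: ifP; rewrite // mulNr.
Qed.

Lemma powR_exp_le (c s : R) : 0 < c -> 1 <= s ->
  s `^ alpha * expR (- (c * s)) <=
  expR (`|alpha| * ln ((2 * `|alpha| + 1) / c)) * expR (- (c / 2 * s)).
Proof.
move=> c0 s1; have s0 : 0 < s by exact: lt_le_trans s1.
rewrite /powR gt_eqF// -!expRD ler_expR.
(* Chosen so that [|alpha| / k <= c / 2]: with [ln s <= s / k + ln k], the power costs at most half
   of the exponential rate. The summand 1 keeps [k] positive for [alpha = 0]. *)
have al := normr_ge0 alpha; pose k := (2 * `|alpha| + 1) / c.
have k0 : 0 < k by rewrite divr_gt0//; lra.
have h1 : alpha * ln s <= `|alpha| * ln s by rewrite ler_wpM2r ?ln_ge0// ler_norm.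
have h2 : ln s <= s / k + ln k.
  rewrite -{1}(divfK (lt0r_neq0 k0) s) lnM ?posrE ?divr_gt0// lerD2r.
  by rewrite ltW// ln_sublinear// divr_gt0.
have h3 : `|alpha| * (s / k) <= c / 2 * s.
  have a1 : 0 < 2 * `|alpha| + 1 by lra.
  have -> : `|alpha| * (s / k) = (s * c) * (`|alpha| / (2 * `|alpha| + 1)).
    by rewrite /k; field; rewrite (gt_eqF a1) (gt_eqF c0).
  have -> : c / 2 * s = (s * c) * 2^-1 by field.
  apply: ler_wpM2l; first by rewrite mulr_ge0 ?ltW.
  by rewrite ler_pdivrMr//; lra.
have h4 : `|alpha| * ln s <= `|alpha| * (s / k + ln k) by rewrite ler_wpM2l.
rewrite -/k; lra.
Qed.

Lemma integrable_powR_exp (c : R) : 0 < c ->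
  mu.-integrable I0y (EFin \o (fun s => s `^ alpha * expR (- (c * s)))).
Proof.
move=> c0; have mf := measurable_powR_exp c.
have f0 s : 0 <= s `^ alpha * expR (- (c * s)) by rewrite mulr_ge0 ?powR_ge0 ?expR_ge0.
apply/integrableP; split; first by apply: measurable_funTS; exact/measurable_EFinP.
under eq_integral do rewrite /= ger0_norm//.
have E : I0y = `]0%R, 1%R]%classic `|` `]1%R, +oo[%classic.
  by rewrite /I0y -itv_bndbnd_setU// bnd_simp.
have m01 : measurable (`]0%R, 1%R]%classic : set (measurableTypeR R)) by [].
have m1y : measurable (`]1%R, +oo[%classic : set (measurableTypeR R)) by [].
rewrite E ge0_integral_setU//; last 3 first.
- by rewrite -E; apply: measurable_funTS; exact/measurable_EFinP.
- by move=> x _; rewrite lee_fin.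
- apply/disj_setPS => x /=; rewrite !in_itv /= andbT => -[/andP[_ x1]].
  by rewrite ltNge x1.
apply: lte_add_pinfty.
  apply: le_lt_trans integral_powR_01; apply: ge0_le_integral => //.
  - by move=> x _; rewrite lee_fin.
  - by apply: measurable_funTS; exact/measurable_EFinP.
  - by apply: measurable_funTS; apply/measurable_EFinP; exact: measurable_powR.
  - move=> x /=; rewrite in_itv /= => /andP[x0 _]; rewrite lee_fin ler_piMr ?powR_ge0//.
    by rewrite -expR0 ler_expR oppr_le0 mulr_ge0 ?ltW.
pose K := expR (`|alpha| * ln ((2 * `|alpha| + 1) / c)).
have c2 : 0 < c / 2 by rewrite divr_gt0.
have me : measurable_fun setT (fun s : R => (c / 2 * expR (- (c / 2 * s)))%:E).
  apply/measurable_EFinP; apply: measurable_funM => //.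
  by apply: measurableT_comp => //; apply: measurable_funN; apply: measurable_funM.
have e0 s : (0 <= (c / 2 * expR (- (c / 2 * s)))%:E)%E.
  by rewrite lee_fin mulr_ge0 ?expR_ge0 ?ltW.
apply: (@le_lt_trans _ _ (\int[mu]_(s in `]1%R, +oo[)
    ((K / (c / 2))%:E * (c / 2 * expR (- (c / 2 * s)))%:E))%E).
  apply: ge0_le_integral => //.
  - by move=> x _; rewrite lee_fin.
  - by apply: measurable_funTS; exact/measurable_EFinP.
  - by apply: measurable_funTS; exact: measurable_funeM.
  - move=> x /=; rewrite in_itv /= andbT => /ltW x1; rewrite -EFinM lee_fin.
    by rewrite mulrA divfK ?gt_eqF//; exact: powR_exp_le.
rewrite ge0_integralZl//; last 2 first.
- exact: measurable_funTS.
- by rewrite lee_fin divr_ge0 ?expR_ge0// ltW.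
apply: lte_mul_pinfty => //; first by rewrite lee_fin divr_ge0 ?expR_ge0// (ltW c2).
apply: (@le_lt_trans _ _ 1%E); last exact: ltry.
rewrite -(integral_exp_rate c2); apply: ge0_subset_integral => //.
- exact: measurable_funTS.
- by move=> x; rewrite /I0y /= !in_itv /= !andbT; apply: lt_trans.
Qed.

Lemma GammaE : Gamma (alpha + 1) = \int[mu]_(s in I0y) (s `^ alpha * expR (- (1 * s))).
Proof.
by rewrite /Gamma addrK; apply: eq_Rintegral => s _; rewrite mul1r.
Qed.

Lemma Gamma_gt0 : 0 < Gamma (alpha + 1).
Proof.
rewrite GammaE -lte_fin fineK; last first.
  by apply: integrable_fin_num => //; exact: integrable_powR_exp.
apply: gt0_integral => //.
- by apply: measurable_funTS; exact: measurable_powR_exp.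
- by move=> x; rewrite /I0y /= in_itv /= andbT => x0; rewrite mulr_gt0 ?powR_gt0 ?expR_gt0.
- have -> : mu I0y = +oo%E by rewrite [LHS]lebesgue_measure_itv /= ltry.
  exact: ltry.
Qed.

Lemma integral_powR_exp (c : R) : 0 < c ->
  \int[mu]_(s in I0y) (s `^ alpha * expR (- (c * s))) =
  c `^ (- (alpha + 1)) * Gamma (alpha + 1).
Proof.
move=> c0; rewrite GammaE.
pose F (s : R) : \bar R := ((fun s => (s `^ alpha * expR (- (1 * s)))%:E) \_ I0y) s.
have F0 s : (0 <= F s)%E.
  by rewrite /F patchE; case: ifP => // _; rewrite lee_fin mulr_ge0 ?powR_ge0 ?expR_ge0.
have mF : measurable_fun setT F.
  apply/(measurable_restrictT _ mI0y); apply: measurable_funTS.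
  by apply/measurable_EFinP; exact: measurable_powR_exp.
have := @ge0_integral_affine R F c 0 c0 mF F0.
rewrite -[X in (_ = _ * X)%E -> _]integral_mkcond => IE.
have ca0 : 0 < c `^ alpha by rewrite powR_gt0.
have LE : (\int[mu]_(s in I0y) (s `^ alpha * expR (- (c * s)))%:E =
   (c `^ (- alpha))%:E * \int[mu]_x F (c * x + 0)%R)%E.
  rewrite integral_mkcond -ge0_integralZl//; last 2 first.
  - by apply: (measurableT_comp mF); apply: measurable_funD => //; apply: measurable_funM.
  - by rewrite lee_fin powR_ge0.
  apply: eq_integral => s _; rewrite /F !patchE addr0.
  have -> : (c * s \in I0y) = (s \in I0y).
    by apply/idP/idP; rewrite !inE /I0y /= !in_itv /= !andbT pmulr_rgt0.
  case: ifP => [|_]; last by rewrite mule0.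
  rewrite inE /I0y /= in_itv /= andbT => s0; rewrite -EFinM; congr (_%:E).
  rewrite powRM ?ltW// powRN mul1r -mulrA mulKf// gt_eqF//.
rewrite /Rintegral LE IE.
have fin : (\int[mu]_(s in I0y) (s `^ alpha * expR (- (1 * s)))%:E)%E \is a fin_num.
  by apply: integrable_fin_num => //; exact: integrable_powR_exp.
rewrite fineM//; last by rewrite fin_numM.
rewrite fineM//= mulrA; congr (_ * _).
rewrite opprD powRD; last by rewrite (gt_eqF c0) implybT.
by rewrite powR_inv1// ltW.
Qed.

End GammaIntegral.

Section SequenceLimits.
Variable R : realType.
Implicit Types a u r : nat -> R.

Lemma cvg_mul_ln1p a u (l : R) : u @ \oo --> (0 : R) ->
  a j * u j @[j --> \oo] --> l -> a j * ln (1 + u j) @[j --> \oo] --> l.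
Proof.
move=> u0 aul.
have h : a j * (ln (1 + u j) - u j) @[j --> \oo] --> (0 : R).
  apply/cvgr0Pnorm_lt => e e0.
  have auu : `|a j * u j| * `|u j| @[j --> \oo] --> (0 : R).
    rewrite -(mulr0 `|l|) -(normr0 R).
    by apply: cvgM; apply: cvg_norm.
  near=> j.
  have uj : `|u j| <= 4^-1.
    by near: j; have /cvgr0Pnorm_le := u0; apply; rewrite invr_gt0.
  have : `|a j * u j| * `|u j| < e.
    by near: j; exact: (cvgr_lt 0 auu e e0).
  apply: le_lt_trans.
  rewrite !normrM -mulrA ler_wpM2l//.
  have x0 := normr_ge0 (u j).
  have := ln_taylor2 uj => h1.
  have -> : ln (1 + u j) - u j = (ln (1 + u j) - (u j - u j ^+ 2 / 2)) - u j ^+ 2 / 2 by ring.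
  apply: le_trans (ler_normB _ _) _.
  have -> : `|u j ^+ 2 / 2| = `|u j| ^+ 2 / 2 by rewrite normrM normrX (@ger0_norm _ 2^-1).
  have : `|u j| ^+ 3 <= `|u j| * `|u j| / 4 by rewrite !exprS expr0 mulr1 mulrA ler_wpM2l// mulr_ge0.
  by move: h1; rewrite expr2; lra.
have -> : (fun j => a j * ln (1 + u j)) = (fun j => a j * (ln (1 + u j) - u j) + a j * u j).
  by apply/funext => j; ring.
by rewrite -(add0r l); exact: cvgD.
Unshelve. all: by end_near. Qed.

Lemma cvg_mul_diff (g : R -> R) (rho d l : R) a r : is_derive rho 1 g d ->
  r @ \oo --> rho -> a j * (r j - rho) @[j --> \oo] --> l ->
  a j * (g (r j) - g rho) @[j --> \oo] --> d * l.
Proof.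
move=> [dg gE] rr arl.
(* The difference quotient, completed by the derivative at [rho] because [r j = rho] may occur. *)
pose phi x := if x == rho then d else (g x - g rho) / (x - rho).
have phiE x : g x - g rho = phi x * (x - rho).
  by rewrite /phi; case: eqVneq => [->|xr]; rewrite ?subrr ?mulr0// divfK// subr_eq0.
have cphi : phi (r j) @[j --> \oo] --> d.
  have cg : h^-1 *: (g (h *: 1 + rho) - g rho) @[h --> 0^'] --> d by rewrite -gE; exact: dg.
  apply/cvgrPdist_lt => e e0.
  have /cvgrPdist_lt /(_ e e0) [del /= del0 Hd] := cg.
  near=> j; rewrite /phi; case: eqVneq => [_|rj]; first by rewrite subrr normr0.
  have /= := Hd (r j - rho); rewrite sub0r normrN => H.
  have /H : `|r j - rho| < del.
    by rewrite distrC; near: j; have /cvgrPdist_lt := rr; apply.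
  rewrite subr_eq0 => /(_ rj).
  by rewrite /GRing.scale /= mulr1 subrK mulrC.
have -> : (fun j => a j * (g (r j) - g rho)) = (fun j => phi (r j) * (a j * (r j - rho))).
  by apply/funext => j; rewrite phiE mulrCA.
exact: cvgM.
Unshelve. all: by end_near. Qed.

Lemma near_natr_gt (N_ : nat -> nat) (x : R) : N_ @ \oo --> \oo ->
  \forall j \near \oo, x < (N_ j)%:R.
Proof.
move=> Noo; near=> j; apply: (lt_le_trans (truncnS_gt _)); rewrite ler_nat.
by near: j; exact: (Noo _ (nbhs_infty_gt _)).
Unshelve. all: by end_near. Qed.

Lemma cvg_invn (N_ : nat -> nat) : N_ @ \oo --> \oo ->
  (N_ j)%:R^-1 @[j --> \oo] --> (0 : R).
Proof.
move=> Noo; apply/cvgr0Pnorm_lt => e e0; near=> j.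
have h : e^-1 < (N_ j)%:R by near: j; exact: near_natr_gt.
have N0 : 0 < (N_ j)%:R :> R by apply: lt_trans h; rewrite invr_gt0.
by rewrite ger0_norm ?invr_ge0 ?(ltW N0)// -(invrK e) ltf_pV2 ?posrE ?invr_gt0.
Unshelve. all: by end_near. Qed.

Lemma cvg_at (f : R -> R) u (l : R) : {for l, continuous f} -> u @ \oo --> l ->
  f (u j) @[j --> \oo] --> f l.
Proof. by move=> cf ul; apply: (cvg_comp u f ul); exact: cf. Qed.

Lemma cvg_truncn_ratio (N_ : nat -> nat) (x : R) : 0 <= x -> N_ @ \oo --> \oo ->
  (Num.truncn (x * (N_ j)%:R))%:R / (N_ j)%:R @[j --> \oo] --> x.
Proof.
move=> x0 Noo.
have low : x - (N_ j)%:R^-1 @[j --> \oo] --> x.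
  by rewrite -[X in _ --> X]subr0; apply: cvgB; [exact: cvg_cst|exact: cvg_invn].
apply: (squeeze_cvgr _ low (cvg_cst x)).
near=> j.
have N1 : 0 < (N_ j)%:R :> R by rewrite ltr0n; near: j; exact: (Noo _ (nbhs_infty_gt _)).
have xN : 0 <= x * (N_ j)%:R by rewrite mulr_ge0.
apply/andP; split; last by rewrite ler_pdivrMr// truncn_le.
rewrite ler_pdivlMr// mulrBl mulVf ?gt_eqF// lerBlDr ltW//.
by rewrite -[1]/(1%:R) -natrD addn1 truncnS_gt.
Unshelve. all: by end_near. Qed.

End SequenceLimits.

Section Moments.
Variables (R : realType) (g H : R -> R) (rho alpha tau : R).
Hypothesis rho_gt0 : 0 < rho.
Hypothesis alpha_gt : -1 < alpha.
Hypothesis g_cont : forall r, 0 < r -> {for r, continuous g}.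
Hypothesis g_low : exists b, exists2 d, 0 < d & forall r, 0 < r -> r < d -> b < g r.
Hypothesis g_der : is_derive rho 1 g (2 * tau / rho).
Hypothesis g_tan : forall r, 0 < r -> r <= rho -> g rho + 2 * tau * ln (r / rho) <= g r.
Hypothesis H_cont : continuous H.
Hypothesis H_rho : H rho = 0.
Let mu : {measure set (measurableTypeR R) -> \bar R} := @lebesgue_measure R.
Let I0y : set (measurableTypeR R) := `]0%R, +oo[%classic.
Let mI0y : measurable I0y. Proof. by rewrite /I0y. Qed.

Definition radial_weight (N : nat) (r : R) : R :=
  if r < rho then expR (- (N%:R * g r)) * (rho - r) `^ alpha * expR (H r) else 0.

Lemma radial_weight_ge0 N r : 0 <= radial_weight N r.
Proof.
by rewrite /radial_weight; case: ifP => // _; rewrite !mulr_ge0 ?expR_ge0 ?powR_ge0.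
Qed.

Let measurable_sub (f : R -> R) (a b : R) :
  (forall x, a < x -> x < b -> {for x, continuous f}) ->
  measurable_fun (`]a, b[%classic : set (measurableTypeR R)) f.
Proof.
move=> cf; apply: open_continuous_measurable_fun; first exact: interval_open.
by move=> x; rewrite inE /= in_itv /= => /andP[ax xb]; exact: cf.
Qed.

Lemma continuous_powR (a x : R) : 0 < x -> {for x, continuous (fun y => y `^ a)}.
Proof.
move=> x0; apply: differentiable_continuous; apply/derivable1_diffP.
by apply: derivable_powR; rewrite in_itv /= andbT.
Qed.

Lemma measurable_radial_weight N :
  measurable_fun setT (fun y : R => radial_weight N (Num.sqrt y)).
Proof.
pose f (y : R) := radial_weight N (Num.sqrt y).
pose J : set (measurableTypeR R) := `]0%R, rho ^+ 2[%classic.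
pose J' : set (measurableTypeR R) := `]-oo, 0%R]%classic.
have mJ : measurable J by rewrite /J.
have mJ' : measurable J' by rewrite /J'.
have sq y : 0 < y -> (Num.sqrt y < rho) = (y < rho ^+ 2).
  move=> y0; rewrite -{2}(sqr_sqrtr (ltW y0)) ltr_pXn2r// nnegrE ?sqrtr_ge0//.
  exact: ltW.
(* [Num.sqrt] is 0 on negative arguments, so [f] is constant on [J']; it is continuous on [J] and
   zero from [rho ^+ 2] on. *)
rewrite -/f (_ : f = (fun y => (f \_ J) y + radial_weight N 0 * \1_J' y)); last first.
  apply/funext => y; rewrite patchE indicE /J /J'.
  have [y0|y0] := leP y 0.
    rewrite (mem_set (_ : `]-oo, 0%R]%classic y))/= ?in_itv//= mulr1 memNset/=.
      by rewrite add0r /f ler0_sqrtr.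
    by rewrite in_itv /= ltNge y0.
  rewrite (memNset (_ : ~ `]-oo, 0%R]%classic y))/= ?in_itv/= ?mulr0 ?addr0; last first.
    by rewrite leNgt y0.
  have [yr|yr] := ltP y (rho ^+ 2).
    by rewrite mem_set//= in_itv /= y0.
  rewrite memNset/=; last by rewrite in_itv /= y0 /= ltNge yr.
  by rewrite /f /radial_weight sq// ltNge yr.
apply: measurable_funD; last first.
  by apply: measurable_funM => //; exact: measurable_indic.
apply/(measurable_restrictT _ mJ).
apply: measurable_sub => y y0 yr.
have s0 : 0 < Num.sqrt y by rewrite sqrtr_gt0.
have sr : Num.sqrt y < rho by rewrite sq.
have cs : {for y, continuous (@Num.sqrt R)} by exact: sqrt_continuous.
pose h (r : R) := expR (- (N%:R * g r)) * (rho - r) `^ alpha * expR (H r).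
have ch : {for y, continuous (h \o Num.sqrt)}.
  apply: continuous_comp => //; apply: cvgM; first apply: cvgM.
  - apply: (@continuous_comp _ _ _ (fun r => - (N%:R * g r)) expR); last exact: continuous_expR.
    by apply: cvgN; apply: cvgMr; exact: g_cont.
  - apply: (@continuous_comp _ _ _ (fun r => rho - r) (fun r => r `^ alpha)).
      by apply: cvgB; [exact: cvg_cst|exact: cvg_id].
    by apply: continuous_powR; rewrite subr_gt0.
  - by apply: (@continuous_comp _ _ _ H expR); [exact: H_cont|exact: continuous_expR].
have fE : \forall z \near y, (h \o Num.sqrt) z = f z.
  have : \forall z \near y, z \in `]0, rho ^+ 2[.
    by apply: near_in_itvoo; rewrite in_itv /= y0.
  apply: filterS => z; rewrite in_itv /= => /andP[z0 zr].
  by rewrite /f /radial_weight sq// zr.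
rewrite /prop_for /continuous_at -(nbhs_singleton fE).
by apply: cvg_trans ch; apply: near_eq_cvg; apply: filterS fE => z.
Qed.

Lemma H_bound : exists2 E, 0 < E & forall r, 0 <= r -> r <= rho -> expR (H r) <= E.
Proof.
have [c _ cmax] := EVT_max (ltW rho_gt0) (continuous_subspaceT H_cont).
exists (expR (H c)); first exact: expR_gt0.
by move=> r r0 rr; rewrite ler_expR; apply: cmax; rewrite in_itv /= r0.
Qed.

(* The [n]-th moment integrand after [y = rho^2 (1 - s / N)], divided by [edge_scale N n]. *)
Definition edge_integrand (N n : nat) (s : R) : R :=
  let u := 1 - s / N%:R in
  if (0 < s) && (s < N%:R) then
    u ^+ n * (N%:R * (1 - Num.sqrt u)) `^ alpha *
    expR (- (N%:R * (g (rho * Num.sqrt u) - g rho))) * expR (H (rho * Num.sqrt u))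
  else 0.

(** Here [rho^2 / N] is the Jacobian of the substitution, [rho^(2n)] and [(rho / N)^alpha] are the
    sizes of the power and of the distance factor at the edge, and the exponential is the value
    there of the unperturbed weight. *)
Definition edge_scale (N n : nat) : R :=
  rho ^+ (2 * n) * rho ^+ 2 * N%:R^-1 * (rho / N%:R) `^ alpha * expR (- (N%:R * g rho)).

Lemma edge_integrand_ge0 N n s : 0 <= edge_integrand N n s.
Proof.
rewrite /edge_integrand; case: ifP => // /andP[s0 sN].
have N0 : 0 < N%:R :> R by exact: lt_trans sN.
have u0 : 0 <= 1 - s / N%:R by rewrite subr_ge0 ler_pdivrMr// mul1r ltW.
by rewrite !mulr_ge0 ?expR_ge0 ?powR_ge0 ?exprn_ge0.
Qed.

Lemma edge_integrandE N n (s : R) : (0 < N)%N ->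
  let y := rho ^+ 2 * (1 - s / N%:R) in
  (if 0 < y then y ^+ n * radial_weight N (Num.sqrt y) else 0) =
  edge_scale N n * (N%:R / rho ^+ 2) * edge_integrand N n s.
Proof.
move=> N0 y; have N1 : 0 < N%:R :> R by rewrite ltr0n.
have r2 : 0 < rho ^+ 2 by rewrite exprn_gt0.
rewrite /y pmulr_rgt0// subr_gt0 ltr_pdivrMr// mul1r /edge_integrand.
case: ifPn => sN; last by rewrite andbF mulr0.
rewrite andbT sqrtrM ?ltW// sqrtr_sqr (gtr0_norm rho_gt0) /radial_weight.
set u := 1 - s / N%:R.
have u0 : 0 < u by rewrite /u subr_gt0 ltr_pdivrMr// mul1r.
have su1 : (Num.sqrt u < 1) = (0 < s).
  rewrite -sqrtr1 ltr_sqrt// /u gtrBl pmulr_lgt0 ?invr_gt0//.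
have -> : (rho * Num.sqrt u < rho) = (0 < s) by rewrite -[ltRHS]mulr1 ltr_pM2l.
case: ifPn => s0; last by rewrite !mulr0.
rewrite /edge_scale exprMn -exprM.
have w0 : 0 < 1 - Num.sqrt u by rewrite subr_gt0 su1.
have -> : rho - rho * Num.sqrt u = rho / N%:R * (N%:R * (1 - Num.sqrt u)).
  by field; rewrite gt_eqF.
rewrite powRM ?ltW ?divr_gt0 ?mulr_gt0//.
have -> : expR (- (N%:R * g (rho * Num.sqrt u))) =
  expR (- (N%:R * g rho)) * expR (- (N%:R * (g (rho * Num.sqrt u) - g rho))).
  by rewrite -expRD; congr expR; ring.
field; rewrite (gt_eqF N1) (gt_eqF rho_gt0)//.
Qed.

Let weighted n N y := y ^+ n * radial_weight N (Num.sqrt y).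

Lemma measurable_weighted n N : measurable_fun setT (weighted n N).
Proof.
by apply: measurable_funM; [exact: measurable_funX|exact: measurable_radial_weight].
Qed.

(** The substitution is decreasing in [s], while [ge0_integral_affine] handles positive slopes. *)
Lemma ge0_integral_reflect (f : R -> \bar R) : measurable_fun setT f ->
  (forall x, 0 <= f x)%E -> (\int[mu]_x f (- x)%R = \int[mu]_x f x)%E.
Proof.
move=> mf f0.
have mo : measurable_fun setT (-%R : measurableTypeR R -> measurableTypeR R).
  exact: measurable_funN.
have /= := @ge0_integral_pushforward _ _ _ _ R _ mo mu setT f measurableT mf (fun x _ => f0 x).
rewrite preimage_setT => <-.
by apply: eq_measure_integral => A mA _; exact: lebesgue_measureN.
Qed.

Lemma edge_scale_gt0 N n : (0 < N)%N -> 0 < edge_scale N n.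
Proof.
move=> N0; have N1 : 0 < N%:R :> R by rewrite ltr0n.
by rewrite /edge_scale !mulr_gt0 ?exprn_gt0 ?invr_gt0 ?powR_gt0 ?divr_gt0 ?expR_gt0.
Qed.

Let patched n N : R -> R := weighted n N \_ I0y.

Let patchedE n N y : patched n N y = if 0 < y then weighted n N y else 0.
Proof.
rewrite /patched patchE /I0y; congr (if _ then _ else _).
by apply/idP/idP; rewrite inE /= in_itv /= andbT.
Qed.

Let measurable_patched n N : measurable_fun setT (patched n N).
Proof.
by apply/(measurable_restrictT _ mI0y); apply: measurable_funTS; exact: measurable_weighted.
Qed.

Let patched_ge0 n N y : 0 <= patched n N y.
Proof.
rewrite patchedE; case: ifP => // y0.
by rewrite mulr_ge0 ?radial_weight_ge0// exprn_ge0// ltW.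
Qed.

Let patched_affine n N s : (0 < N)%N ->
  patched n N (rho ^+ 2 / N%:R * (- s) + rho ^+ 2) =
  edge_scale N n * (N%:R / rho ^+ 2) * edge_integrand N n s.
Proof.
move=> N0; have N1 : 0 < N%:R :> R by rewrite ltr0n.
rewrite patchedE -edge_integrandE// (_ : _ + _ = rho ^+ 2 * (1 - s / N%:R))//.
by field; rewrite gt_eqF.
Qed.

Lemma measurable_edge_integrand N n : (0 < N)%N ->
  measurable_fun setT (edge_integrand N n).
Proof.
move=> N0; have N1 : 0 < N%:R :> R by rewrite ltr0n.
have c0 : 0 < edge_scale N n * (N%:R / rho ^+ 2).
  by rewrite mulr_gt0 ?edge_scale_gt0// divr_gt0// exprn_gt0.
rewrite (_ : edge_integrand N n = fun s => (edge_scale N n * (N%:R / rho ^+ 2))^-1 *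
    patched n N (rho ^+ 2 / N%:R * (- s) + rho ^+ 2)); last first.
  by apply/funext => s; rewrite patched_affine// mulKf// gt_eqF.
apply: measurable_funM => //; apply: (measurableT_comp (measurable_patched n N)).
by apply: measurable_funD => //; apply: measurable_funM => //; exact: measurable_funN.
Qed.

Lemma integral_weighted n N : (0 < N)%N ->
  (\int[mu]_(y in I0y) (y ^+ n * radial_weight N (Num.sqrt y))%:E =
   (edge_scale N n)%:E * \int[mu]_(s in I0y) (edge_integrand N n s)%:E)%E.
Proof.
move=> N0; have N1 : 0 < N%:R :> R by rewrite ltr0n.
have a0 : 0 < rho ^+ 2 / N%:R by rewrite divr_gt0// exprn_gt0.
have mp : measurable_fun setT (fun y => (patched n N y)%:E).
  by apply/measurable_EFinP; exact: measurable_patched.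
have mpa : measurable_fun setT (fun y => (patched n N (rho ^+ 2 / N%:R * y + rho ^+ 2))%:E).
  by apply: (measurableT_comp mp); apply: measurable_funD => //; apply: measurable_funM.
transitivity (\int[mu]_y (patched n N y)%:E)%E.
  rewrite integral_mkcond; apply: eq_integral => y _.
  by rewrite /patched !patchE; case: ifP.
have := @ge0_integral_affine R (fun y => (patched n N y)%:E) _ (rho ^+ 2) a0 mp.
move=> /(_ _)/(congr1 (fun x => (rho ^+ 2 / N%:R)%:E * x)%E).
rewrite muleA -EFinM divff ?gt_eqF// mul1e => <-; last by move=> y; rewrite lee_fin.
rewrite -(ge0_integral_reflect mpa) => [|x]; last by rewrite lee_fin.
under eq_integral do rewrite patched_affine//.
rewrite [in RHS]integral_mkcond -ge0_integralZl//; last 3 first.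
- by apply/measurable_EFinP; apply: measurable_funM => //; exact: measurable_edge_integrand.
- by move=> s _; rewrite lee_fin mulr_ge0 ?edge_integrand_ge0// mulr_ge0 ?divr_ge0 ?exprn_ge0 ?ltW// edge_scale_gt0.
- by rewrite lee_fin ltW.
rewrite -ge0_integralZl//; last 3 first.
- apply/(measurable_restrictT _ mI0y); apply: measurable_funTS; apply/measurable_EFinP.
  exact: measurable_edge_integrand.
- by move=> s _; rewrite patchE; case: ifP => // _; rewrite lee_fin edge_integrand_ge0.
- by rewrite lee_fin ltW// edge_scale_gt0.
apply: eq_integral => s _; rewrite patchE; case: ifPn => sI.
  by rewrite -!EFinM; congr (_%:E); field; rewrite (gt_eqF N1) (gt_eqF rho_gt0).
rewrite mule0 /edge_integrand ifF ?mulr0 ?mule0//.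
apply/negP => /andP[s0 _]; move: sI; rewrite notin_setE /I0y /=; apply.
by rewrite in_itv /= s0.
Qed.

Lemma edge_integrand_le : exists2 K, 0 < K & forall N n s, (0 < N)%N ->
  tau <= n%:R / N%:R -> 0 < s ->
  edge_integrand N n s <= K * (s `^ alpha * expR (- ((n%:R / N%:R - tau) * s))).
Proof.
have [E E0 HE] := H_bound.
exists ((1 + 2 `^ (- alpha)) * E).
  by rewrite mulr_gt0// ltr_wpDr ?powR_ge0.
move=> N n s N0 nt s0; have N1 : 0 < N%:R :> R by rewrite ltr0n.
rewrite /edge_integrand s0 /=; case: ifPn => [sN|_]; last first.
  by rewrite !mulr_ge0 ?powR_ge0 ?expR_ge0 ?(ltW E0)// addr_ge0// powR_ge0.
set u : R := 1 - s / N%:R; set v : R := Num.sqrt u.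
have sN0 : 0 < s / N%:R by rewrite divr_gt0.
have u0 : 0 < u by rewrite /u subr_gt0 ltr_pdivrMr// mul1r.
have u1 : u < 1 by rewrite /u; lra.
have v0 : 0 < v by rewrite sqrtr_gt0.
have v1 : v < 1 by rewrite -sqrtr1 ltr_sqrt.
have vE : v * v = u by rewrite -expr2 sqr_sqrtr// ltW.
have lnv : 2 * ln v = ln u by rewrite -vE lnM ?posrE//; ring.
have le_H : expR (H (rho * v)) <= E.
  by apply: HE; [rewrite mulr_ge0 ?ltW|rewrite -[leRHS]mulr1 ler_wpM2l ?ltW].
have w0 : 0 < N%:R * (1 - v) by rewrite mulr_gt0// subr_gt0.
(* Since [1 - v^2 = s / N], the rescaled distance to the edge lies between [s / 2] and [s]. *)
have wE : N%:R * (1 - v) = s * (1 + v)^-1.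
  apply: (@mulIf _ (1 + v)); first by rewrite gt_eqF// addr_gt0.
  rewrite divfK ?gt_eqF ?addr_gt0//.
  have -> : N%:R * (1 - v) * (1 + v) = N%:R * (1 - v * v) by ring.
  by rewrite vE /u; field; rewrite gt_eqF.
(* [(1 + v)^(- alpha)] is at most 1 or at most [2^(- alpha)] according to the sign of [alpha]; the
   constant adds the two cases. *)
have le_pow : (N%:R * (1 - v)) `^ alpha <= (1 + 2 `^ (- alpha)) * s `^ alpha.
  rewrite wE powRM ?invr_ge0 ?(ltW s0)//; last by rewrite addr_ge0// ltW.
  rewrite mulrC ler_wpM2r ?powR_ge0//.
  have v2 : 1 <= 1 + v by rewrite lerDl ltW.
  rewrite -powR_inv1 ?addr_ge0 ?(ltW v0)// -powRrM mulN1r.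
  have [al|al] := leP 0 alpha.
    apply: (@le_trans _ _ 1); last by rewrite lerDl powR_ge0.
    by rewrite -[leRHS](powRr0 (1 + v)); apply: ler_powR => //; rewrite oppr_le0.
  apply: (@le_trans _ _ (2 `^ (- alpha))); last by rewrite ler_wpDl.
  by apply: ge0_ler_powR; rewrite ?nnegrE ?oppr_ge0 ?(ltW al)//; lra.
(* The tangent bound replaces the potential by [u^(- N tau)]. The remaining exponent [n - N tau] of
   [u] is nonnegative, so [ln u <= - s / N] finishes. *)
have le_exp : u ^+ n * expR (- (N%:R * (g (rho * v) - g rho))) <=
    expR (- ((n%:R / N%:R - tau) * s)).
  have -> : u ^+ n = expR (n%:R * ln u) by rewrite expRM_natl lnK.
  rewrite -expRD ler_expR.
  have := g_tan (mulr_gt0 rho_gt0 v0).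
  rewrite -[leRHS]mulr1 ler_wpM2l ?(ltW rho_gt0) ?(ltW v1)// => /(_ isT).
  rewrite [rho * v]mulrC mulfK ?gt_eqF// -mulrA mulrCA lnv [v * rho]mulrC => h1.
  have h2 : N%:R * (tau * ln u) <= N%:R * (g (rho * v) - g rho).
    by rewrite ler_wpM2l ?(ltW N1)//; lra.
  have h3 : ln u <= - (s / N%:R).
    by rewrite /u; apply: le_ln1Dx; rewrite ltrN2 ltr_pdivrMr// mul1r.
  have nN : 0 <= n%:R - N%:R * tau.
    by move: nt; rewrite ler_pdivlMr// mulrC; lra.
  have h4 : (n%:R - N%:R * tau) * ln u <= (n%:R - N%:R * tau) * - (s / N%:R).
    by rewrite ler_wpM2l.
  have h5 : (n%:R - N%:R * tau) * - (s / N%:R) = - ((n%:R / N%:R - tau) * s).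
    by field; rewrite gt_eqF.
  by rewrite -h5; lra.
have -> : u ^+ n * (N%:R * (1 - v)) `^ alpha *
   expR (- (N%:R * (g (rho * v) - g rho))) * expR (H (rho * v)) =
  ((N%:R * (1 - v)) `^ alpha * expR (H (rho * v))) *
  (u ^+ n * expR (- (N%:R * (g (rho * v) - g rho)))) by ring.
have -> : (1 + 2 `^ (- alpha)) * E * (s `^ alpha * expR (- ((n%:R / N%:R - tau) * s)))
  = ((1 + 2 `^ (- alpha)) * s `^ alpha * E) * expR (- ((n%:R / N%:R - tau) * s)) by ring.
apply: ler_pM le_exp; rewrite ?mulr_ge0 ?powR_ge0 ?expR_ge0 ?exprn_ge0 ?(ltW u0)//.
by apply: ler_pM le_pow le_H; rewrite ?powR_ge0 ?expR_ge0.
Qed.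

Lemma edge_integrand_decr N (m n : nat) (s : R) : (n <= m)%N ->
  edge_integrand N m s <= edge_integrand N n s.
Proof.
move=> nm; rewrite /edge_integrand; case: ifP => // /andP[s0 sN].
have N1 : 0 < N%:R :> R by exact: lt_trans sN.
have sN0 : 0 < s / N%:R by rewrite divr_gt0.
have sN1 : s / N%:R < 1 by rewrite ltr_pdivrMr// mul1r.
rewrite -!mulrA; apply: ler_wpM2r; first by rewrite !mulr_ge0 ?powR_ge0 ?expR_ge0.
by apply: ler_wiXn2l => //; lra.
Qed.

Lemma integrable_edge_integrand_large N n : (0 < N)%N -> tau < n%:R / N%:R ->
  mu.-integrable I0y (EFin \o edge_integrand N n).
Proof.
move=> N0 tn; have [K K0 HK] := edge_integrand_le.
have c0 : 0 < n%:R / N%:R - tau by rewrite subr_gt0.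
have /= h := integrable_powR_exp alpha_gt c0.
apply: (@le_integrable _ _ _ mu I0y mI0y _
  (EFin \o (fun s => K * (s `^ alpha * expR (- ((n%:R / N%:R - tau) * s)))))).
- by apply/measurable_EFinP; apply: measurable_funTS; exact: measurable_edge_integrand.
- move=> s; rewrite /I0y /= in_itv /= andbT => s0.
  rewrite lee_fin ger0_norm ?edge_integrand_ge0// ger0_norm; last first.
    by rewrite mulr_ge0 ?(ltW K0)// mulr_ge0 ?powR_ge0 ?expR_ge0.
  by apply: HK => //; exact: ltW.
- exact: (integrableZl mI0y K h).
Qed.

(** For [n / N <= tau] the tangent bound does not control the integrand near the origin, that is
    near [s = N]. There the lower bound on [g] near 0 makes it bounded; elsewhere [u] is bounded
    below, and a larger index [m] with [m / N > tau] dominates. *)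
Lemma integrable_edge_integrand N n : (0 < N)%N ->
  mu.-integrable I0y (EFin \o edge_integrand N n).
Proof.
move=> N0; have N1 : 0 < N%:R :> R by rewrite ltr0n.
pose m := (n + (Num.truncn (`|tau| * N%:R)).+1)%N.
have tm : tau < m%:R / N%:R.
  rewrite ltr_pdivlMr//; apply: (@le_lt_trans _ _ (`|tau| * N%:R)).
    by rewrite ler_wpM2r ?ler_norm// ltW.
  apply: lt_le_trans (truncnS_gt _) _; rewrite ler_nat /m; exact: leq_addl.
have [b [d d0 Hb]] := g_low; have [E E0 HE] := H_bound.
(* For [v < e] the point [rho * v] is in the range where [g > b], and [N (1 - v)] lies in
   [[N / 2, N]]; the two powers in [C] cover both signs of [alpha]. *)
pose e := Num.min (d / (2 * rho)) (2^-1).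
have e0 : 0 < e by rewrite lt_min divr_gt0 ?mulr_gt0//= invr_gt0.
have e1 : e <= 2^-1 by rewrite ge_min lexx orbT.
have ed : rho * e < d.
  apply: (@le_lt_trans _ _ (d / 2)); last lra.
  have : e <= d / (2 * rho) by rewrite ge_min lexx.
  by rewrite ler_pdivlMr ?mulr_gt0//; lra.
pose C := (N%:R `^ alpha + (N%:R / 2) `^ alpha) * expR (- (N%:R * (b - g rho))) * E.
have C0 : 0 <= C by rewrite /C !mulr_ge0 ?addr_ge0 ?powR_ge0 ?expR_ge0 ?(ltW E0).
(* For [v >= e] one has [u >= e^2], hence [u^n <= 1 <= D u^m]. *)
pose D := e ^- (2 * m).
have D0 : 0 <= D by rewrite /D invr_ge0 exprn_ge0// ltW.
pose JN : set (measurableTypeR R) := `]0%R, N%:R]%classic.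
have mJN : measurable JN by rewrite /JN.
pose F1 (s : R) : R := C * \1_JN s; pose F2 (s : R) : R := D * edge_integrand N m s.
have key (s : R) : 0 < s -> edge_integrand N n s <= F1 s + F2 s.
  move=> s0; rewrite /F1 /F2.
  have [sN|Ns] := ltP s N%:R; last first.
    rewrite {1}/edge_integrand [s < _]ltNge Ns andbF /=.
    apply: addr_ge0; apply: mulr_ge0 => //; exact: edge_integrand_ge0.
  rewrite indicE (mem_set (_ : JN s)) ?mulr1; last by rewrite /JN /= in_itv /= s0 ltW.
  have Dm : 0 <= D * edge_integrand N m s by rewrite mulr_ge0// edge_integrand_ge0.
  have sN0 : 0 < s / N%:R by rewrite divr_gt0.
  have sN1 : s / N%:R < 1 by rewrite ltr_pdivrMr// mul1r.
  pose u : R := 1 - s / N%:R; pose v : R := Num.sqrt u.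
  have u0 : 0 < u by rewrite /u; lra.
  have u1 : u < 1 by rewrite /u; lra.
  have v0 : 0 < v by rewrite sqrtr_gt0.
  have v1 : v < 1 by rewrite -sqrtr1 ltr_sqrt.
  have [ve|ev] := ltP v e.
    apply: (@le_trans _ _ C); last by rewrite lerDl.
    rewrite /edge_integrand s0 sN /= -/u -/v /C.
    apply: ler_pM => //; rewrite ?mulr_ge0 ?powR_ge0 ?expR_ge0 ?exprn_ge0 ?(ltW u0)//.
      apply: ler_pM => //; rewrite ?mulr_ge0 ?powR_ge0 ?expR_ge0 ?exprn_ge0 ?(ltW u0)//.
        rewrite -[leRHS]mul1r; apply: ler_pM; rewrite ?exprn_ge0 ?powR_ge0 ?(ltW u0)//.
          by rewrite exprn_ile1// ltW.
        have w1 : N%:R * (1 - v) <= N%:R by rewrite -[leRHS]mulr1 ler_wpM2l//; lra.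
        have w2 : N%:R / 2 <= N%:R * (1 - v) by rewrite ler_wpM2l//; lra.
        have w0 : 0 < N%:R * (1 - v) by rewrite mulr_gt0//; lra.
        have [al|al] := leP 0 alpha.
          rewrite ler_wpDr ?powR_ge0//.
          by apply: ge0_ler_powR; rewrite ?nnegrE// ltW.
        rewrite ler_wpDl ?powR_ge0//.
        rewrite -[alpha]opprK !(powRN _ (- alpha)) lef_pV2 ?posrE ?powR_gt0 ?divr_gt0//.
        by apply: ge0_ler_powR; rewrite ?nnegrE ?oppr_ge0 ?divr_ge0 ?(ltW al)// ltW.
      rewrite ler_expR lerN2 ler_wpM2l// lerB// ltW//; apply: Hb; first by rewrite mulr_gt0.
      by apply: lt_trans ed; rewrite ltr_pM2l.
    by apply: HE; rewrite ?mulr_ge0 ?(ltW rho_gt0) ?(ltW v0)// -[leRHS]mulr1 ler_wpM2l ?ltW.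
  rewrite ler_wpDl//.
  rewrite /edge_integrand s0 sN /= -/u -/v !mulrA.
  do 3! [apply: ler_wpM2r; first by rewrite ?powR_ge0 ?expR_ge0].
  have ue : e ^+ 2 <= u by rewrite -(sqr_sqrtr (ltW u0)) ler_pXn2r// nnegrE ltW.
  apply: (@le_trans _ _ 1); first by rewrite exprn_ile1// ltW.
  rewrite mulrC /D ler_pdivlMr ?exprn_gt0// mul1r exprM.
  by apply: lerXn2r ue; rewrite nnegrE ?exprn_ge0// ltW.
apply: (@le_integrable _ _ _ mu I0y mI0y _
  ((EFin \o F1) \+ (EFin \o F2))%E).
- by apply/measurable_EFinP; apply: measurable_funTS; exact: measurable_edge_integrand.
- move=> s; rewrite /I0y /= in_itv /= andbT => s0.
  rewrite lee_fin ger0_norm ?edge_integrand_ge0// ger0_norm ?key//.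
  apply: addr_ge0; apply: mulr_ge0 => //; exact: edge_integrand_ge0.
- apply: integrableD => //.
    apply: (integrableZl mI0y C (f := EFin \o \1_JN)).
    apply: (integrableS measurableT) => //.
    exact: integrable_indic_itv.
  exact: (integrableZl mI0y D (integrable_edge_integrand_large N0 tm)).
Qed.

Definition edge_moment (N n : nat) : R := \int[mu]_(s in I0y) edge_integrand N n s.

Lemma edge_momentE N n : (0 < N)%N ->
  (\int[mu]_(s in I0y) (edge_integrand N n s)%:E = (edge_moment N n)%:E)%E.
Proof.
move=> N0; rewrite /edge_moment /Rintegral fineK//.
exact: (integrable_fin_num mI0y (integrable_edge_integrand n N0)).
Qed.

Lemma edge_moment_gt0 N n : (0 < N)%N -> 0 < edge_moment N n.
Proof.
move=> N0; have N1 : 0 < N%:R :> R by rewrite ltr0n.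
pose JN : set (measurableTypeR R) := `]0%R, N%:R[%classic.
have mJN : measurable JN by rewrite /JN.
have mE : measurable_fun setT (EFin \o edge_integrand N n).
  by apply/measurable_EFinP; exact: measurable_edge_integrand.
have pos (s : R) : 0 < s -> s < N%:R -> 0 < edge_integrand N n s.
  move=> s0 sN.
  have sN0 : 0 < s / N%:R by rewrite divr_gt0.
  have sN1 : s / N%:R < 1 by rewrite ltr_pdivrMr// mul1r.
  rewrite /edge_integrand s0 sN /=.
  have u0 : 0 < 1 - s / N%:R by lra.
  have v1 : Num.sqrt (1 - s / N%:R) < 1 by rewrite -[ltRHS]sqrtr1 ltr_sqrt//; lra.
  by rewrite !mulr_gt0 ?expR_gt0 ?powR_gt0 ?exprn_gt0// mulr_gt0// subr_gt0.
rewrite -lte_fin -edge_momentE//.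
apply: (@lt_le_trans _ _ (\int[mu]_(s in JN) (edge_integrand N n s)%:E)%E); last first.
  apply: ge0_subset_integral => //.
  - exact: measurable_funTS.
  - by move=> s _; rewrite lee_fin edge_integrand_ge0.
  - by move=> s; rewrite /JN /I0y /= !in_itv /= => /andP[->].
apply: gt0_integral => //; last first.
- by have -> : mu JN = N%:R%:E by rewrite [LHS]lebesgue_measure_itv /= lte_fin N1 oppr0 adde0.
- move=> s; rewrite /JN /= in_itv /= => /andP[s0 sN]; exact: pos.
- by apply: measurable_funTS; exact: measurable_edge_integrand.
Qed.

Lemma edge_moment_decr N (m n : nat) : (0 < N)%N -> (n <= m)%N ->
  edge_moment N m <= edge_moment N n.
Proof.
move=> N0 nm; apply: le_Rintegral => //; try exact: integrable_edge_integrand.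
by move=> s _; exact: edge_integrand_decr.
Qed.

(** The power tends to [exp (- x s)], the potential contributes [exp (tau s)] through its derivative
    at the edge, and the rescaled distance tends to [s / 2], which is the source of
    [2^(- alpha)]. *)
Lemma edge_integrand_cvg (N_ n_ : nat -> nat) (x s : R) : N_ @ \oo --> \oo ->
  (n_ j)%:R / (N_ j)%:R @[j --> \oo] --> x -> 0 < s ->
  edge_integrand (N_ j) (n_ j) s @[j --> \oo] -->
    2 `^ (- alpha) * (s `^ alpha * expR (- ((x - tau) * s))).
Proof.
move=> Noo nx s0.
have invN : (N_ j)%:R^-1 @[j --> \oo] --> (0 : R).
  exact: cvg_invn.
pose u j : R := 1 - s / (N_ j)%:R; pose v j : R := Num.sqrt (u j).
have sN : - (s / (N_ j)%:R) @[j --> \oo] --> (0 : R).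
  by rewrite -oppr0 -(mulr0 s); apply: cvgN; apply: cvgMr.
have u1 : u j @[j --> \oo] --> (1 : R).
  by rewrite -[1]addr0; apply: cvgD => //; exact: cvg_cst.
have v1 : v j @[j --> \oo] --> (1 : R).
  by rewrite -sqrtr1; apply: (cvg_comp _ _ u1); exact: sqrt_continuous.
have w : s / (1 + v j) @[j --> \oo] --> s / 2.
  by apply: cvgMr; apply: cvgV; rewrite ?pnatr_eq0//; apply: cvgD => //; exact: cvg_cst.
have h1 : expR ((n_ j)%:R * ln (1 + - (s / (N_ j)%:R))) @[j --> \oo] --> expR (- (x * s)).
  apply: (cvg_at (@continuous_expR R _)).
  apply: cvg_mul_ln1p => //.
  have -> : (fun j => (n_ j)%:R * - (s / (N_ j)%:R)) = (fun j => - ((n_ j)%:R / (N_ j)%:R * s)).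
    by apply/funext => j; ring.
  by apply: cvgN; apply: cvgMl.
have h2 : (s / (1 + v j)) `^ alpha @[j --> \oo] --> (s / 2) `^ alpha.
  by apply: (@cvg_at _ (fun r => r `^ alpha) _ _ _ w); apply: continuous_powR; rewrite divr_gt0.
have rv : rho * v j @[j --> \oo] --> rho by rewrite -[X in _ --> X]mulr1; apply: cvgMr.
have NE : \forall j \near \oo, s < (N_ j)%:R by exact: near_natr_gt.
have vE : \forall j \near \oo, (N_ j)%:R * (1 - v j) = s / (1 + v j).
  apply: filterS NE => j sNj; have N1 : 0 < (N_ j)%:R :> R by exact: lt_trans sNj.
  have u0 : 0 < u j by rewrite /u subr_gt0 ltr_pdivrMr// mul1r.
  have v0 : 0 < v j by rewrite sqrtr_gt0.
  have vv : v j * v j = u j by rewrite -expr2 sqr_sqrtr// ltW.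
  apply: (@mulIf _ (1 + v j)); first by rewrite gt_eqF// addr_gt0.
  rewrite divfK ?gt_eqF ?addr_gt0//.
  have -> : (N_ j)%:R * (1 - v j) * (1 + v j) = (N_ j)%:R * (1 - v j * v j) by ring.
  by rewrite vv /u; field; rewrite gt_eqF.
have h3 : expR (- ((N_ j)%:R * (g (rho * v j) - g rho))) @[j --> \oo] --> expR (tau * s).
  apply: (cvg_at (@continuous_expR R _)).
  have -> : tau * s = - (2 * tau / rho * (- (rho * (s / 2)))) by field; rewrite gt_eqF.
  apply: cvgN; apply: (cvg_mul_diff g_der rv).
  have w' : - (rho * (s / (1 + v j))) @[j --> \oo] --> - (rho * (s / 2)).
    by apply: cvgN; exact: cvgMr.
  apply: cvg_trans w'; apply: near_eq_cvg.
  by apply: filterS vE => j /= <-; ring.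
have h4 : expR (H (rho * v j)) @[j --> \oo] --> (1 : R).
  rewrite -expR0 -H_rho; apply: (cvg_at (@continuous_expR R _)).
  exact: (cvg_at (@H_cont rho) rv).
have -> : 2 `^ (- alpha) * (s `^ alpha * expR (- ((x - tau) * s))) =
  expR (- (x * s)) * (s / 2) `^ alpha * expR (tau * s) * 1.
  rewrite mulr1 powRM ?invr_ge0 ?(ltW s0)// -[2^-1]powR_inv1// -powRrM mulN1r.
  have -> : - ((x - tau) * s) = - (x * s) + tau * s by ring.
  by rewrite expRD; ring.
have h5 : expR ((n_ j)%:R * ln (1 + - (s / (N_ j)%:R))) * (s / (1 + v j)) `^ alpha *
    expR (- ((N_ j)%:R * (g (rho * v j) - g rho))) * expR (H (rho * v j)) @[j --> \oo] -->
  expR (- (x * s)) * (s / 2) `^ alpha * expR (tau * s) * 1.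
  by apply: cvgM h4; apply: cvgM h3; exact: cvgM.
apply: cvg_trans h5; apply: near_eq_cvg; near=> j => /=.
have sNj : s < (N_ j)%:R by near: j.
have N1 : 0 < (N_ j)%:R :> R by exact: lt_trans sNj.
have u0 : 0 < u j by rewrite /u subr_gt0 ltr_pdivrMr// mul1r.
rewrite /edge_integrand s0 sNj /= -/(u j) -/(v j).
congr (_ * _ * _ * _); first by rewrite expRM_natl lnK.
by congr (_ `^ _); symmetry; near: j.
Unshelve. all: by end_near. Qed.

Lemma edge_moment_cvg (N_ n_ : nat -> nat) (x : R) : N_ @ \oo --> \oo ->
  (n_ j)%:R / (N_ j)%:R @[j --> \oo] --> x -> tau < x ->
  edge_moment (N_ j) (n_ j) @[j --> \oo] -->
    2 `^ (- alpha) * ((x - tau) `^ (- (alpha + 1)) * Gamma (alpha + 1)).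
Proof.
move=> Noo nx tx; have [K K0 HK] := edge_integrand_le.
have xt0 : 0 < x - tau by rewrite subr_gt0.
(* Half of the limiting gap: eventually [n / N - tau >= c], so one function dominates all
   integrands. *)
pose c := (x - tau) / 2; have c0 : 0 < c by rewrite divr_gt0.
have : \forall j \near \oo, (0 < N_ j)%N /\ tau + c <= (n_ j)%:R / (N_ j)%:R.
  near=> j; split; first by near: j; exact: (Noo _ (nbhs_infty_gt _)).
  near: j; apply: (cvgr_ge _ nx); rewrite /c; lra.
(* [Rdominated_convergence] asks for the bound at every index, so the sequences are shifted by
   [J]. *)
move=> [J _ HJ].
have H2 j : (0 < N_ (j + J))%N /\ tau + c <= (n_ (j + J))%:R / (N_ (j + J))%:R.
  by apply: HJ => /=; exact: leq_addl.
have sh (f : nat -> R) (l : R) : f @ \oo --> l -> f (j + J)%N @[j --> \oo] --> l.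
  by move=> fl; rewrite cvg_shiftn.
have Noo' : N_ (j + J)%N @[j --> \oo] --> \oo.
  by apply: (cvg_comp _ _ _ Noo); exact: cvg_addnr.
have nx' := sh (fun j => (n_ j)%:R / (N_ j)%:R) x nx.
have pw (s : R) (s0 : 0 < s) := edge_integrand_cvg Noo' nx' s0.
have [] := @Rdominated_convergence _ (measurableTypeR R) R mu I0y
  (fun j => edge_integrand (N_ (j + J)) (n_ (j + J)))
  (fun s => 2 `^ (- alpha) * (s `^ alpha * expR (- ((x - tau) * s))))
  (fun s => K * (s `^ alpha * expR (- (c * s)))) mI0y.
- move=> j; apply: measurable_funTS; apply: measurable_edge_integrand.
  by have [] := H2 j.
- by apply: measurable_funTS; apply: measurable_funM => //; exact: measurable_powR_exp.
- move=> s; rewrite /I0y /= in_itv /= andbT => s0.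
  exact: pw.
- exact: (integrableZl mI0y K (integrable_powR_exp alpha_gt c0)).
- move=> j s; rewrite /I0y /= in_itv /= andbT => s0; have [N0 tc] := H2 j.
  rewrite ger0_norm ?edge_integrand_ge0//.
  apply: le_trans (HK _ _ _ N0 _ s0) _; first by apply: le_trans tc; rewrite lerDl ltW.
  rewrite ler_wpM2l ?(ltW K0)// ler_wpM2l ?powR_ge0// ler_expR lerN2 ler_wpM2r ?(ltW s0)//.
  by rewrite lerBrDl.
move=> _; rewrite RintegralZl//; last exact: integrable_powR_exp.
have /= <- := integral_powR_exp alpha_gt xt0 => h.
by rewrite -(cvg_shiftn J).
Unshelve. all: by end_near. Qed.

(** The limit of the inverse normalised moments at [n / N = x]; the positive part makes it 0 for
    [x <= tau]. *)
Definition edge_density (x : R) : R :=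
  2 `^ alpha * Num.max 0 (x - tau) `^ (alpha + 1) / Gamma (alpha + 1).

Let alpha1 : 0 < alpha + 1. Proof. by rewrite -ltrBlDr sub0r. Qed.

Lemma inv_edge_moment_cvg_gt (N_ n_ : nat -> nat) (x : R) : N_ @ \oo --> \oo ->
  (n_ j)%:R / (N_ j)%:R @[j --> \oo] --> x -> tau < x ->
  (edge_moment (N_ j) (n_ j))^-1 @[j --> \oo] --> edge_density x.
Proof.
move=> Noo nx tx; have xt0 : 0 < x - tau by rewrite subr_gt0.
have G0 := Gamma_gt0 alpha_gt.
have -> : edge_density x =
    (2 `^ (- alpha) * ((x - tau) `^ (- (alpha + 1)) * Gamma (alpha + 1)))^-1.
  by rewrite /edge_density max_r ?(ltW xt0)// !invfM !powRN !invrK mulrA.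
apply: cvgV; last exact: edge_moment_cvg.
by rewrite mulf_neq0 ?mulf_neq0 ?gt_eqF ?powR_gt0.
Qed.

Lemma inv_edge_moment_cvg (N_ n_ : nat -> nat) (x : R) : 0 <= tau -> N_ @ \oo --> \oo ->
  (n_ j)%:R / (N_ j)%:R @[j --> \oo] --> x ->
  (edge_moment (N_ j) (n_ j))^-1 @[j --> \oo] --> edge_density x.
Proof.
move=> tau0 Noo nx; have [xt|] := leP x tau; last exact: inv_edge_moment_cvg_gt.
have G0 := Gamma_gt0 alpha_gt.
have -> : edge_density x = 0.
  by rewrite /edge_density max_l ?subr_le0// powR0 ?gt_eqF// mulr0 mul0r.
apply/cvgr0Pnorm_lt => e e0.
(* The solution of [edge_density (tau + d) = e / 2]. Monotonicity in [n] compares [n_ j] with an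
   index near [(tau + d) N], where the limit is already known. *)
pose d : R := (e / 2 * Gamma (alpha + 1) / 2 `^ alpha) `^ (alpha + 1)^-1.
have d0 : 0 < d by apply: powR_gt0; rewrite !mulr_gt0 ?invr_gt0 ?powR_gt0.
pose m_ j := Num.truncn ((tau + d) * (N_ j)%:R).
have mx : (m_ j)%:R / (N_ j)%:R @[j --> \oo] --> tau + d.
  by apply: cvg_truncn_ratio => //; rewrite addr_ge0// ltW.
have td : tau < tau + d by rewrite ltrDl.
have dE : edge_density (tau + d) = e / 2.
  rewrite /edge_density addrAC subrr add0r max_r ?(ltW d0)// -powRrM mulVf ?gt_eqF//.
  rewrite powRr1; last by rewrite !mulr_ge0 ?invr_ge0 ?powR_ge0 ?(ltW e0) ?(ltW G0).
  by field; rewrite (gt_eqF G0) gt_eqF ?powR_gt0.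
have h := inv_edge_moment_cvg_gt Noo mx td.
near=> j.
have N0 : (0 < N_ j)%N by near: j; exact: (Noo _ (nbhs_infty_gt _)).
have N1 : 0 < (N_ j)%:R :> R by rewrite ltr0n.
have nm : (n_ j <= m_ j)%N.
  rewrite -(@ler_nat R) -(ler_pM2r (_ : 0 < (N_ j)%:R^-1)) ?invr_gt0//.
  apply: (@le_trans _ _ (tau + d / 2)).
    by near: j; apply: (cvgr_le _ nx); lra.
  by near: j; apply: (cvgr_ge _ mx); lra.
rewrite ger0_norm ?invr_ge0 ?(ltW (edge_moment_gt0 _ N0))//.
apply: (@le_lt_trans _ _ (edge_moment (N_ j) (m_ j))^-1).
  by rewrite lef_pV2 ?posrE ?edge_moment_gt0//; exact: edge_moment_decr.
by near: j; apply: (cvgr_lt _ h); rewrite dE; lra.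
Unshelve. all: by end_near. Qed.

(** By monotonicity the worst index is [n = N], whose ratio 1 exceeds [tau]. This bound dominates
    the Riemann sums below. *)
Lemma inv_edge_moment_bounded (N_ : nat -> nat) : 0 <= tau < 1 -> N_ @ \oo --> \oo ->
  exists2 C, 0 < C & \forall j \near \oo, forall n, (n <= N_ j)%N ->
    (edge_moment (N_ j) n)^-1 <= C.
Proof.
move=> /andP[tau0 tau1] Noo.
have nx : (N_ j)%:R / (N_ j)%:R @[j --> \oo] --> (1 : R).
  apply: cvg_near_cst; near=> j; rewrite divff// gt_eqF// ltr0n.
  by near: j; exact: (Noo _ (nbhs_infty_gt _)).
have h := inv_edge_moment_cvg_gt Noo nx tau1.
have d0 : 0 <= edge_density 1.
  by rewrite /edge_density !mulr_ge0 ?powR_ge0 ?invr_ge0 ?(ltW (Gamma_gt0 alpha_gt)).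
exists (edge_density 1 + 1); first by rewrite ltr_wpDl.
near=> j => n nN.
have N0 : (0 < N_ j)%N by near: j; exact: (Noo _ (nbhs_infty_gt _)).
apply: (@le_trans _ _ (edge_moment (N_ j) (N_ j))^-1).
  by rewrite lef_pV2 ?posrE ?edge_moment_gt0//; exact: edge_moment_decr.
by near: j; apply: (cvgr_le _ h); rewrite ltrDl.
Unshelve. all: by end_near. Qed.

End Moments.

(** * Convergence of the rescaled kernel *)

Section ComplexSequences.
Variable R : realType.
Implicit Types (u v : nat -> R[i]) (l m : R[i]).

(** Componentwise, so that limits of real sequences apply directly; [ccvg_cvg] recovers convergence
    in [R[i]^o]. *)
Definition ccvg u l :=
  (complex.Re (u j) @[j --> \oo] --> complex.Re l) /\
  (complex.Im (u j) @[j --> \oo] --> complex.Im l).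

Lemma ccvg_cst l : ccvg (fun=> l) l.
Proof. by split; exact: cvg_cst. Qed.

Lemma near_eq_ccvg u v l : (\forall j \near \oo, u j = v j) -> ccvg u l -> ccvg v l.
Proof.
move=> uv [ur ui]; split; [apply: cvg_trans ur|apply: cvg_trans ui];
  by apply: near_eq_cvg; apply: filterS uv => j /= ->.
Qed.

Lemma ccvgD u v l m : ccvg u l -> ccvg v m -> ccvg (fun j => u j + v j) (l + m).
Proof.
move=> [ur ui] [vr vi]; split; rewrite ?ReD ?ImD.
  by under eq_fun do rewrite ReD; exact: cvgD.
by under eq_fun do rewrite ImD; exact: cvgD.
Qed.

Lemma ReM l m : complex.Re (l * m) = complex.Re l * complex.Re m - complex.Im l * complex.Im m.
Proof. by case: l; case: m. Qed.

Lemma ImM l m : complex.Im (l * m) = complex.Re l * complex.Im m + complex.Im l * complex.Re m.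
Proof. by case: l; case: m. Qed.

Lemma ccvgM u v l m : ccvg u l -> ccvg v m -> ccvg (fun j => u j * v j) (l * m).
Proof.
move=> [ur ui] [vr vi]; split; rewrite ?ReM ?ImM.
  by under eq_fun do rewrite ReM; apply: cvgB; exact: cvgM.
by under eq_fun do rewrite ImM; apply: cvgD; exact: cvgM.
Qed.

Lemma Re_conj l : complex.Re (conjc l) = complex.Re l.
Proof. by case: l. Qed.

Lemma Im_conj l : complex.Im (conjc l) = - complex.Im l.
Proof. by case: l. Qed.

Lemma ccvg_conj u l : ccvg u l -> ccvg (fun j => conjc (u j)) (conjc l).
Proof.
move=> [ur ui]; split; rewrite ?Re_conj ?Im_conj.
  by under eq_fun do rewrite Re_conj.
by under eq_fun do rewrite Im_conj; exact: cvgN.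
Qed.

Lemma ccvg_real (x : nat -> R) (y : R) : x @ \oo --> y -> ccvg (fun j => (x j)%:C) y%:C.
Proof. by move=> xy; split=> //=; exact: cvg_cst. Qed.

Lemma ccvg_sum I (r : seq I) (U : I -> nat -> R[i]) (L : I -> R[i]) :
  (forall i, ccvg (U i) (L i)) ->
  ccvg (fun j => \sum_(i <- r) U i j) (\sum_(i <- r) L i).
Proof.
move=> UL; elim: r => [|i r IH].
  by rewrite big_nil; under eq_fun do rewrite big_nil; exact: ccvg_cst.
by rewrite big_cons; under eq_fun do rewrite big_cons; exact: ccvgD.
Qed.

Lemma ccvg_prod I (r : seq I) (U : I -> nat -> R[i]) (L : I -> R[i]) :
  (forall i, ccvg (U i) (L i)) ->
  ccvg (fun j => \prod_(i <- r) U i j) (\prod_(i <- r) L i).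
Proof.
move=> UL; elim: r => [|i r IH].
  by rewrite big_nil; under eq_fun do rewrite big_nil; exact: ccvg_cst.
by rewrite big_cons; under eq_fun do rewrite big_cons; exact: ccvgM.
Qed.

Lemma ccvg_det k (A_ : nat -> 'M[R[i]]_k) (A : 'M[R[i]]_k) :
  (forall i i', ccvg (fun j => A_ j i i') (A i i')) ->
  ccvg (fun j => \det (A_ j)) (\det A).
Proof.
move=> AA; rewrite /determinant; apply: ccvg_sum => s.
by apply: ccvgM; [exact: ccvg_cst|exact: ccvg_prod].
Qed.

Lemma ccvg_normc u l : ccvg u l -> normc (u j) @[j --> \oo] --> normc l.
Proof.
move=> [ur ui].
have -> : (fun j => normc (u j)) =
    (fun j => Num.sqrt (complex.Re (u j) * complex.Re (u j) + complex.Im (u j) * complex.Im (u j))).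
  by apply/funext => j; case: (u j).
have -> : normc l = Num.sqrt (complex.Re l * complex.Re l + complex.Im l * complex.Im l).
  by case: l {ur ui}.
apply: cvg_at; first exact: sqrt_continuous.
by apply: cvgD; exact: cvgM.
Qed.

Lemma ReN l : complex.Re (- l) = - complex.Re l.
Proof. by case: l. Qed.

Lemma ImN l : complex.Im (- l) = - complex.Im l.
Proof. by case: l. Qed.

Lemma normc_to0_ccvg u l : normc (u j - l) @[j --> \oo] --> (0 : R) -> ccvg u l.
Proof.
move=> ul; split; apply/cvgrPdist_lt => e e0; near=> j;
  (have lt_e : normc (u j - l) < e by near: j; exact: (cvgr_lt _ ul));
  rewrite distrC; apply: le_lt_trans lt_e; have [hr hi] := norm_ReIm (u j - l).
  by move: hr; rewrite ReD ReN.
by move: hi; rewrite ImD ImN.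
Unshelve. all: by end_near. Qed.

Lemma ccvg_normc0 u l : ccvg u l -> normc (u j - l) @[j --> \oo] --> (0 : R).
Proof.
move=> ul; rewrite -(@normc0 R) -(subrr l).
by apply: ccvg_normc; apply: ccvgD => //; exact: ccvg_cst.
Qed.

Lemma ccvg_expc u l : ccvg u l -> ccvg (fun j => expc (u j)) (expc l).
Proof.
move=> [ur ui]; apply: ccvgM.
  by apply: ccvg_real; apply: cvg_at => //; exact: continuous_expR.
by split => /=; apply: cvg_at => //; [exact: continuous_cos|exact: continuous_sin].
Qed.

Lemma normc_pow_sub (a e : R[i]) n : normc a <= 1 -> normc e <= 1 ->
  normc (a ^+ n - e ^+ n) <= n%:R * normc (a - e).
Proof.
move=> a1 e1; elim: n => [|n IH]; first by rewrite !expr0 subrr normc0 mul0r.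
have -> : a ^+ n.+1 - e ^+ n.+1 = a ^+ n * (a - e) + (a ^+ n - e ^+ n) * e.
  by rewrite !exprSr; ring.
apply: le_trans (le_normcD _ _) _.
rewrite !normcM -natr1 mulrDl mul1r addrC; apply: lerD.
  by rewrite -[leRHS]mulr1; apply: ler_pM => //; rewrite normc_ge0.
by rewrite -[leRHS]mul1r; apply: ler_wpM2r; rewrite ?normc_ge0// normcX exprn_ile1// normc_ge0.
Qed.

Lemma ccvg_expc_scaled (N_ : nat -> nat) (d : R[i]) : N_ @ \oo --> \oo ->
  ccvg (fun j => (N_ j)%:R%:C * (expc ((N_ j)%:R^-1%:C * d) - 1)) d.
Proof.
move=> Noo; have iN := @cvg_invn R _ Noo.
have NN (y : R) : (N_ j)%:R * ((N_ j)%:R^-1 * y) @[j --> \oo] --> y.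
  apply: cvg_near_cst; near=> j; rewrite mulrA divff ?mul1r// pnatr_eq0 -lt0n.
  by near: j; exact: (Noo _ (nbhs_infty_gt _)).
have i0 (y : R) : (N_ j)%:R^-1 * y @[j --> \oo] --> (0 : R).
  by rewrite -(mul0r y); exact: cvgMl.
have NN0 (y : R) : (N_ j)%:R * ((N_ j)%:R^-1 * y - 0) @[j --> \oo] --> y.
  by under eq_fun do rewrite subr0; exact: NN.
have dexp : is_derive (0 : R) 1 expR 1 by have := is_derive_expR (0 : R); rewrite expR0.
have dcos : is_derive (0 : R) 1 (@cos R) 0 by have := is_derive_cos (0 : R); rewrite sin0 oppr0.
have dsin : is_derive (0 : R) 1 (@sin R) 1 by have := is_derive_sin (0 : R); rewrite cos0.
pose x j : R := (N_ j)%:R^-1 * complex.Re d; pose y j : R := (N_ j)%:R^-1 * complex.Im d.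
have hx := cvg_mul_diff dexp (i0 (complex.Re d)) (NN0 _).
have hc := cvg_mul_diff dcos (i0 (complex.Im d)) (NN0 _).
have hs := cvg_mul_diff dsin (i0 (complex.Im d)) (NN0 _).
have cc : cos (y j) @[j --> \oo] --> (1 : R).
  by rewrite -[X in _ --> X](@cos0 R); apply: cvg_at; [exact: continuous_cos|exact: i0].
have ce : expR (x j) @[j --> \oo] --> (1 : R).
  by rewrite -[X in _ --> X](@expR0 R); apply: cvg_at; [exact: continuous_expR|exact: i0].
have E j : (N_ j)%:R%:C * (expc ((N_ j)%:R^-1%:C * d) - 1) =
   ((N_ j)%:R * (expR (x j) - expR 0) * cos (y j) + (N_ j)%:R * (cos (y j) - cos 0))
   +i* (expR (x j) * ((N_ j)%:R * (sin (y j) - sin 0))).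
  rewrite /expc /x /y !ReM !ImM /= !mul0r !subr0 addr0 expR0 cos0 sin0.
  by apply/eqP; rewrite eq_complex /=; apply/andP; split; apply/eqP; ring.
have hre := cvgD (cvgM hx cc) hc; have him := cvgM ce hs.
rewrite mul1r mulr1 mul0r addr0 in hre; rewrite !mul1r in him.
split; under eq_fun do rewrite E; [exact: hre|exact: him].
Unshelve. all: by end_near. Qed.

Lemma mulrn_realC (y : R) (z : R[i]) n : (y%:C * z) *+ n = (n%:R * y)%:C * z.
Proof.
elim: n => [|n IH]; first by rewrite mulr0n !mul0r.
have -> : n.+1%:R * y = y + n%:R * y by rewrite -natr1; ring.
by rewrite mulrS IH -mulrDl -rmorphD.
Qed.

(** A complex logarithm is avoided by comparing [a] with [e = exp (d / N)]: both lie in the closed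
    unit disk, so their [n]-th powers differ by at most [n |a - e|], which is [n / N] times a null
    sequence. *)
Lemma ccvg_pow (N_ n_ : nat -> nat) (a : nat -> R[i]) (d : R[i]) (x : R) :
  N_ @ \oo --> \oo -> (n_ j)%:R / (N_ j)%:R @[j --> \oo] --> x ->
  complex.Re d < 0 -> (\forall j \near \oo, normc (a j) <= 1) ->
  ccvg (fun j => (N_ j)%:R%:C * (a j - 1)) d ->
  ccvg (fun j => a j ^+ n_ j) (expc (x%:C * d)).
Proof.
move=> Noo nx d0 a1 ad.
pose e j : R[i] := expc ((N_ j)%:R^-1%:C * d).
have e1 j : normc (e j) <= 1.
  by rewrite normc_expc -expR0 ler_expR ReM /= mul0r subr0 mulr_ge0_le0 ?invr_ge0// ltW.
have ed : ccvg (fun j => e j ^+ n_ j) (expc (x%:C * d)).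
  have -> : (fun j => e j ^+ n_ j) = (fun j => expc (((n_ j)%:R / (N_ j)%:R)%:C * d)).
    apply/funext => j; by rewrite /e expcX mulrn_realC.
  by apply: ccvg_expc; apply: ccvgM; [exact: ccvg_real|exact: ccvg_cst].
have ad0 : ccvg (fun j => (N_ j)%:R%:C * (a j - e j)) 0.
  rewrite -(subrr d) -mulN1r.
  have -> : (fun j => (N_ j)%:R%:C * (a j - e j)) =
    (fun j => (N_ j)%:R%:C * (a j - 1) + (- 1) * ((N_ j)%:R%:C * (e j - 1))).
    by apply/funext => j; ring.
  apply: ccvgD => //; apply: ccvgM; [exact: ccvg_cst|exact: ccvg_expc_scaled].
have diff : ccvg (fun j => a j ^+ n_ j - e j ^+ n_ j) 0.
  apply: normc_to0_ccvg.
  have := ccvg_normc ad0; rewrite normc0 => h.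
  have h2 : (n_ j)%:R / (N_ j)%:R * normc ((N_ j)%:R%:C * (a j - e j)) @[j --> \oo] --> (0 : R).
    by rewrite -(mulr0 x); exact: cvgM.
  apply: (squeeze_cvgr _ (cvg_cst 0) h2); near=> j.
  rewrite subr0 normc_ge0 /=.
  have N0 : (0 < N_ j)%N by near: j; exact: (Noo _ (nbhs_infty_gt _)).
  have -> : normc ((N_ j)%:R%:C * (a j - e j)) = (N_ j)%:R * normc (a j - e j).
    by rewrite normcM /= expr0n addr0 sqrtr_sqr ger0_norm.
  rewrite mulrA divfK ?pnatr_eq0 -?lt0n//; apply: normc_pow_sub => //.
  by near: j.
have -> : (fun j => a j ^+ n_ j) = (fun j => (a j ^+ n_ j - e j ^+ n_ j) + e j ^+ n_ j).
  by apply/funext => j; rewrite subrK.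
by rewrite -[expc _]add0r; exact: ccvgD.
Unshelve. all: by end_near. Qed.

End ComplexSequences.

Section RiemannSum.
Variables (R : realType) (f : nat -> R) (c e : R).
Hypothesis e_gt0 : 0 < e.
Let mu : {measure set (measurableTypeR R) -> \bar R} := @lebesgue_measure R.

(** Riemann sums are written as integrals of step functions, so that dominated convergence yields
    their limit. *)
Definition step_fun (N : nat) (t : R) : R :=
  \sum_(n < N) f n * \1_(`[c + n%:R * e, c + n.+1%:R * e[%classic) t.

Lemma step_fun_int N : mu.-integrable setT (EFin \o step_fun N) /\
  \int[mu]_t step_fun N t = \sum_(n < N) e * f n.
Proof.
elim: N => [|N [iN IH]].
  rewrite (_ : step_fun 0 = fun=> 0); last by apply/funext => t; rewrite /step_fun big_ord0.
  by rewrite big_ord0; split; [exact: integrable0|rewrite /Rintegral integral0].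
pose J : set (measurableTypeR R) := `[c + N%:R * e, c + N.+1%:R * e[%classic.
have iJ : mu.-integrable setT (EFin \o \1_J) by exact: integrable_indic_itv.
have iNJ : mu.-integrable setT (EFin \o (fun t => f N * \1_J t)).
  exact: (integrableZl measurableT (f N) iJ).
have eN : step_fun N.+1 = fun t => step_fun N t + f N * \1_J t.
  by apply/funext => t; rewrite /step_fun big_ord_recr.
split; first by rewrite eN; exact: (integrableD measurableT iN iNJ).
rewrite eN RintegralD// IH big_ord_recr /=; congr (_ + _).
rewrite RintegralZl// mulrC; congr (_ * _).
have mJ : measurable J by rewrite /J.
rewrite /Rintegral integral_indic// setIT.
have -> : mu J = e%:E.
  rewrite [LHS]lebesgue_measure_itv /= lte_fin ltrD2l ltr_pM2r// ltr_nat ltnSn.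
  by rewrite -EFinB; congr (_%:E); rewrite -natr1; ring.
by [].
Qed.

Lemma step_funE N (t : R) : c <= t -> t < c + N%:R * e ->
  step_fun N t = f (Num.truncn ((t - c) / e)).
Proof.
move=> ct tN; set m := Num.truncn _.
have x0 : 0 <= (t - c) / e by rewrite divr_ge0 ?subr_ge0// ltW.
have m1 : m%:R * e <= t - c by rewrite -ler_pdivlMr// truncn_le.
have m2 : t - c < m.+1%:R * e by rewrite -ltr_pdivrMr// truncnS_gt.
have mN : (m < N)%N.
  by rewrite -(@ltr_nat R) -(ltr_pM2r e_gt0); lra.
rewrite /step_fun (bigD1 (Ordinal mN))//= indicE mem_set/=; last first.
  by rewrite in_itv /=; apply/andP; split; lra.
rewrite mulr1 big1 ?addr0// => n nm; rewrite indicE memNset ?mulr0//= in_itv /=.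
move/andP=> [h1 h2]; case/eqP: nm; apply: val_inj => /=; apply/eqP.
have lt_nat i j : i%:R * e < j.+1%:R * e -> (i <= j)%N.
  by rewrite ltr_pM2r// ltr_nat ltnS.
by rewrite eqn_leq !lt_nat//; lra.
Qed.

Lemma step_fun_out N (t : R) : ~ (c <= t /\ t < c + N%:R * e) -> step_fun N t = 0.
Proof.
move=> h; rewrite /step_fun big1// => n _; rewrite indicE memNset ?mulr0//= in_itv /=.
move/andP=> [h1 h2]; apply: h; split.
  by apply: le_trans h1; rewrite lerDl mulr_ge0// ltW.
by apply: lt_le_trans h2 _; rewrite lerD2l ler_pM2r// ler_nat.
Qed.

Lemma integral_step_fun N :
  \int[mu]_(t in `[c, (c + N%:R * e)%R[) step_fun N t = \sum_(n < N) e * f n.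
Proof.
have [_ <-] := step_fun_int N; rewrite Rintegral_mkcond.
apply: eq_Rintegral => t _; rewrite patchE; case: ifPn => // /negP tD.
rewrite step_fun_out// => -[h1 h2]; apply: tD.
by rewrite inE /= in_itv /= h1.
Qed.

End RiemannSum.

Lemma Re_realM (R : realType) (x : R) (v : R[i]) : complex.Re (x%:C * v) = x * complex.Re v.
Proof. by rewrite ReM /= mul0r subr0. Qed.

Section KernelLimit.
Variables (R : realType) (g H : R -> R) (rho alpha tau : R).
Hypothesis rho_gt0 : 0 < rho.
Hypothesis alpha_gt : -1 < alpha.
Hypothesis tau_ge0 : 0 <= tau.
Hypothesis tau_lt1 : tau < 1.
Hypothesis g_cont : forall r, 0 < r -> {for r, continuous g}.
Hypothesis g_low : exists b, exists2 d, 0 < d & forall r, 0 < r -> r < d -> b < g r.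
Hypothesis g_der : is_derive rho 1 g (2 * tau / rho).
Hypothesis g_tan : forall r, 0 < r -> r <= rho -> g rho + 2 * tau * ln (r / rho) <= g r.
Hypothesis H_cont : continuous H.
Hypothesis H_rho : H rho = 0.
Let mu : {measure set (measurableTypeR R) -> \bar R} := @lebesgue_measure R.
Let em := edge_moment g H rho alpha.
Let tau1 : 0 < 1 - tau. Proof. by rewrite subr_gt0. Qed.
(** The value of [t] at which [x = tau + (1 - tau) t] is 0. *)
Let c : R := - (tau / (1 - tau)).
Let c_le0 : c <= 0. Proof. by rewrite oppr_le0 divr_ge0// (ltW tau1). Qed.
Let D : set (measurableTypeR R) := `[c, 1%R[%classic.

Variables (N_ : nat -> nat) (a b : nat -> R[i]) (z w : R[i]).
Hypothesis Noo : N_ @ \oo --> \oo.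
Hypothesis z_gt0 : 0 < complex.Re z.
Hypothesis w_gt0 : 0 < complex.Re w.
Hypothesis az : ccvg (fun j => (N_ j)%:R%:C * (a j - 1)) (- (1 - tau)^-1%:C * z).
Hypothesis bw : ccvg (fun j => (N_ j)%:R%:C * (b j - 1)) (- (1 - tau)^-1%:C * w).
Hypothesis a_le1 : \forall j \near \oo, normc (a j) <= 1.
Hypothesis b_le1 : \forall j \near \oo, normc (b j) <= 1.

Definition kernel_term (N n : nat) (u v : R[i]) : R[i] :=
  (edge_moment g H rho alpha N n)^-1%:C * (u ^+ n * conjc (v ^+ n)).

(** The multiplier [s] reduces complex limits to real ones: [s = 1] and [s = - 'i] select the real
    and imaginary parts, and dividing by [kap] removes that factor. *)
Let limit_density (s : R[i]) (t : R) : R :=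
  edge_density alpha tau (tau + (1 - tau) * t) *
  complex.Re (s * expc (- ((tau / (1 - tau) + t)%:C * (z + conjc w)))).

Lemma riemann_sum_cvg (s : R[i]) :
  mu.-integrable D (EFin \o limit_density s) /\
  \sum_(n < N_ j) ((N_ j)%:R * (1 - tau))^-1 * complex.Re (s * kernel_term (N_ j) n (a j) (b j))
    @[j --> \oo] --> \int[mu]_(t in D) limit_density s t.
Proof.
have tau01 : 0 <= tau < 1 by rewrite tau_ge0.
have [C C0 HC] := inv_edge_moment_bounded rho_gt0 alpha_gt g_cont g_low g_der g_tan H_cont H_rho tau01 Noo.
have : \forall j \near \oo, [/\ (0 < N_ j)%N, normc (a j) <= 1, normc (b j) <= 1 &
    forall n, (n <= N_ j)%N -> (em (N_ j) n)^-1 <= C].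
  near=> j; split; [|by near: j..].
  by near: j; exact: (Noo (nbhs_infty_gt _)).
move=> [J _ HJ].
have H2 j : [/\ (0 < N_ (j + J))%N, normc (a (j + J)%N) <= 1, normc (b (j + J)%N) <= 1 &
    forall n, (n <= N_ (j + J))%N -> (em (N_ (j + J)) n)^-1 <= C].
  by apply: HJ => /=; exact: leq_addl.
(* The mesh [1 / N] in [x], expressed in [t]; the [N] steps fill [[c, 1[] exactly. *)
pose e j : R := ((N_ (j + J))%:R * (1 - tau))^-1.
have e0 j : 0 < e j by have [N0 _ _ _] := H2 j; rewrite invr_gt0 mulr_gt0// ltr0n.
pose f j n : R := complex.Re (s * kernel_term (N_ (j + J)) n (a (j + J)%N) (b (j + J)%N)).
pose F j : R -> R := step_fun (f j) c (e j) (N_ (j + J)).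
have cE j : c + (N_ (j + J))%:R * e j = 1.
  have [N0 _ _ _] := H2 j; rewrite /c /e; field.
  by rewrite gt_eqF//= pnatr_eq0 -lt0n.
have mD : measurable D by rewrite /D.
have mF j : measurable_fun D (F j).
  have [/integrableP[/measurable_EFinP mF _] _] := step_fun_int (f j) c (e0 j) (N_ (j + J)).
  exact: measurable_funTS.
have pw (t : R) : c <= t -> t < 1 -> F j t @[j --> \oo] --> limit_density s t.
  move=> ct t1; pose x : R := tau + (1 - tau) * t.
  have x0 : 0 <= x.
    have : (1 - tau) * c <= (1 - tau) * t by rewrite ler_wpM2l// ltW.
    by rewrite /x /c mulrN mulrCA mulfV ?gt_eqF//; lra.
  pose n_ j := Num.truncn (x * (N_ j)%:R).
  have nx := cvg_truncn_ratio x0 Noo.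
  have h1 := inv_edge_moment_cvg rho_gt0 alpha_gt g_cont g_low g_der g_tan H_cont H_rho tau_ge0 Noo nx.
  have dneg (v : R[i]) : 0 < complex.Re v -> complex.Re (- (1 - tau)^-1%:C * v) < 0.
    by move=> v0; rewrite ReM ReN ImN /= oppr0 mul0r subr0 mulNr oppr_lt0 mulr_gt0 ?invr_gt0.
  have h2 := ccvg_pow Noo nx (dneg _ z_gt0) a_le1 az.
  have h3 := ccvg_pow Noo nx (dneg _ w_gt0) b_le1 bw.
  have [h4 _] := ccvgM (ccvg_cst s) (ccvgM (ccvg_real h1) (ccvgM h2 (ccvg_conj h3))).
  have -> : limit_density s t = complex.Re (s * ((edge_density alpha tau x)%:C *
      (expc (x%:C * (- (1 - tau)^-1%:C * z)) * conjc (expc (x%:C * (- (1 - tau)^-1%:C * w)))))).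
    rewrite /limit_density -/x expc_conj -expcD.
    have -> : x%:C * (- (1 - tau)^-1%:C * z) + conjc (x%:C * (- (1 - tau)^-1%:C * w)) =
      - ((tau / (1 - tau) + t)%:C * (z + conjc w)).
      have -> : tau / (1 - tau) + t = x / (1 - tau) by rewrite /x; field; rewrite gt_eqF.
      apply/eqP; case: (z) (w) => z1 z2 [w1 w2]; rewrite eq_complex /=.
      by apply/andP; split; apply/eqP; ring.
    by rewrite -Re_realM mulrCA.
  have h5 : (fun j => F j t) = fun j => complex.Re (s * ((em (N_ (j + J)) (n_ (j + J)%N))^-1%:C *
    (a (j + J)%N ^+ n_ (j + J)%N * conjc (b (j + J)%N ^+ n_ (j + J)%N)))).
    apply/funext => j; rewrite /F step_funE ?cE// /f /kernel_term.
    have -> // : (t - c) / e j = x * (N_ (j + J))%:R.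
    by rewrite /e invrK /c /x; field; rewrite gt_eqF.
  by rewrite h5 (cvg_shiftn J (fun j => complex.Re (s * ((em (N_ j) (n_ j))^-1%:C *
    (a j ^+ n_ j * conjc (b j ^+ n_ j)))))).
have pwD t : D t -> F j t @[j --> \oo] --> limit_density s t.
  by rewrite /D /= in_itv /= => /andP[]; exact: pw.
have bnd j (t : R) : c <= t -> t < 1 -> `|F j t| <= normc s * C.
  move=> ct t1; rewrite /F step_funE ?cE// /f.
  have [N0 a1 b1 HCj] := H2 j.
  apply: le_trans (norm_ReIm _).1 _.
  have nN : (Num.truncn ((t - c) / e j) <= N_ (j + J))%N.
    rewrite -ltnS -(@ltr_nat R); apply: le_lt_trans (_ : (t - c) / e j < _).
      by rewrite truncn_le divr_ge0 ?subr_ge0// ltW.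
    rewrite ltr_pdivrMr//; apply: lt_le_trans (_ : (N_ (j + J))%:R * e j <= _).
      by have := cE j; lra.
    by rewrite ler_pM2r// ler_nat.
  rewrite normcM ler_wpM2l ?normc_ge0// /kernel_term normcM.
  rewrite -[leRHS]mulr1; apply: ler_pM; rewrite ?normc_ge0//.
    rewrite /= expr0n addr0 sqrtr_sqr ger0_norm; first exact: HCj.
    by rewrite invr_ge0; apply: Rintegral_ge0 => // r _; exact: edge_integrand_ge0.
  rewrite normcM normc_conj !normcX -[leRHS]mulr1.
  by apply: ler_pM; rewrite ?exprn_ge0 ?normc_ge0// exprn_ile1 ?normc_ge0.
have [] := @Rdominated_convergence _ (measurableTypeR R) R mu D F (limit_density s)
  (fun=> normc s * C) mD mF (measurable_fun_cvg mF pwD) pwD.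
- apply/integrableP; split; first by apply/measurable_EFinP; exact: measurable_cst.
  rewrite integral_cst//= [X in (_ * X)%E](_ : _ = (1 - c)%:E).
    by rewrite ltry.
  rewrite [LHS]lebesgue_measure_itv /= lte_fin ifT//.
  exact: le_lt_trans c_le0 ltr01.
- by move=> j t; rewrite /D /= in_itv /= => /andP[]; exact: bnd.
move=> ids h; split=> //; rewrite -(cvg_shiftn J).
have hE j : \int[mu]_(t in D) F j t =
    \sum_(n < N_ (j + J)) ((N_ (j + J))%:R * (1 - tau))^-1 *
      complex.Re (s * kernel_term (N_ (j + J)) n (a (j + J)%N) (b (j + J)%N)).
  by have := integral_step_fun (f j) c (e0 j) (N_ (j + J)); rewrite cE.
by under eq_fun do rewrite -hE.
Unshelve. all: by end_near. Qed.

Let C1 : R := 2 `^ alpha * (1 - tau) `^ (alpha + 1).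
(** The part of the exponential independent of [t]. Its modulus is later compensated by the
    amplitudes, which leaves a phase. *)
Let kap : R[i] := expc (- ((tau / (1 - tau))%:C * (z + conjc w))).
Let G (t : R) : R[i] :=
  (t `^ (alpha + 1) / Gamma (alpha + 1))%:C * expc (- (t%:C * (z + conjc w))).
Let I01 : set (measurableTypeR R) := `[0%R, 1%R[%classic.

Let C1_gt0 : 0 < C1. Proof. by rewrite mulr_gt0// powR_gt0. Qed.

Let alpha1 : alpha + 1 != 0. Proof. by rewrite gt_eqF// -ltrBlDr sub0r. Qed.

Let limit_density_pos s t : 0 <= t -> limit_density s t = C1 * complex.Re (s * kap * G t).
Proof.
move=> t0; rewrite /limit_density /edge_density [tau + _]addrC addrK max_r; last first.
  by rewrite mulr_ge0// ltW.
rewrite powRM// ?(ltW tau1)//.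
have -> : (tau / (1 - tau) + t)%:C = (tau / (1 - tau))%:C + t%:C by exact: rmorphD.
rewrite mulrDl opprD expcD -/kap [s * (kap * _)]mulrA.
rewrite /G [s * kap * (_ * _)]mulrCA Re_realM /C1.
by set X := complex.Re _; rewrite !mulrA.
Qed.

Let limit_density_neg s t : t <= 0 -> limit_density s t = 0.
Proof.
move=> t0; rewrite /limit_density /edge_density [tau + _]addrC addrK max_l.
  by rewrite powR0// mulr0 !mul0r.
by rewrite mulr_ge0_le0// ltW.
Qed.

Let mI : measurable I01. Proof. by rewrite /I01. Qed.

Let ID : I01 `<=` D.
Proof.
move=> t; rewrite /I01 /D /= !in_itv /= => /andP[t0 ->]; rewrite andbT.
exact: le_trans c_le0 t0.
Qed.

Let integral_limit_density s : \int[mu]_(t in D) limit_density s t =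
  \int[mu]_(t in I01) (C1 * complex.Re (s * kap * G t)).
Proof.
rewrite Rintegral_mkcond [RHS]Rintegral_mkcond; apply: eq_Rintegral => t _.
rewrite !patchE; case: ifPn => tD; last first.
  by rewrite ifF//; apply/negP => tI; case/negP: tD; rewrite inE; apply: ID; rewrite inE in tI.
case: ifPn => tI.
  by apply: limit_density_pos; move: tI; rewrite inE /I01 /= in_itv /= => /andP[].
apply: limit_density_neg; move: tI tD; rewrite notin_setE inE /I01 /D /= !in_itv /= => tI.
move=> /andP[_ t1]; rewrite leNgt; apply/negP => t0; apply: tI.
by rewrite (ltW t0).
Qed.

Let kap_neq0 : kap != 0.
Proof.
apply/negP => /eqP /(congr1 (@normc R)); rewrite normc_expc normc0.
by apply/eqP; rewrite gt_eqF// expR_gt0.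
Qed.

Let integrable_G (s : R[i]) : mu.-integrable I01 (EFin \o (fun t => complex.Re (s * G t))).
Proof.
have [/(integrableS _ mI ID) iD _] := riemann_sum_cvg (s / kap).
have mD : measurable D by rewrite /D.
have {}iD := iD mD.
apply: (eq_integrable mI (EFin \o (fun t => C1^-1 * limit_density (s / kap) t))).
  move=> t; rewrite inE /I01 /= in_itv /= => /andP[t0 _].
  by rewrite limit_density_pos// divfK//= mulKf// gt_eqF.
exact: (integrableZl mI C1^-1 iD).
Qed.

Lemma riemann_sum_ccvg : ccvg
  (fun j => ((N_ j)%:R * (1 - tau))^-1%:C * \sum_(n < N_ j) kernel_term (N_ j) n (a j) (b j))
  (C1%:C * kap * complex_integral 0 1 G).
Proof.
have iRe := integrable_G 1.
have iIm := integrable_G (- 'i).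
have ReG t : complex.Re (1 * G t) = complex.Re (G t) by rewrite mul1r.
have ImG t : complex.Re (- 'i * G t) = complex.Im (G t) by case: (G t) => p q /=; ring.
have {}iRe : mu.-integrable I01 (EFin \o (fun t => complex.Re (G t))).
  by move: iRe; under [X in _ \o X]eq_fun do rewrite ReG.
have {}iIm : mu.-integrable I01 (EFin \o (fun t => complex.Im (G t))).
  by move: iIm; under [X in _ \o X]eq_fun do rewrite ImG.
have JE : complex_integral 0 1 G =
    (\int[mu]_(t in I01) complex.Re (G t)) +i* (\int[mu]_(t in I01) complex.Im (G t)).
  by rewrite /complex_integral -!Rintegral_itv_bndo_bndc.
have key (s : R[i]) : complex.Re (s * (((N_ j)%:R * (1 - tau))^-1%:C *
      \sum_(n < N_ j) kernel_term (N_ j) n (a j) (b j))) @[j --> \oo] -->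
    complex.Re (s * (C1%:C * kap * complex_integral 0 1 G)).
  have [_ h] := riemann_sum_cvg s.
  have -> : complex.Re (s * (C1%:C * kap * complex_integral 0 1 G)) =
      \int[mu]_(t in D) limit_density s t.
    rewrite integral_limit_density.
    have E t : C1 * complex.Re (s * kap * G t) = C1 * complex.Re (s * kap) * complex.Re (G t) -
        C1 * complex.Im (s * kap) * complex.Im (G t).
      by rewrite ReM; ring.
    under eq_Rintegral do rewrite E.
    rewrite RintegralB//; last 2 first.
    - exact: (integrableZl mI (C1 * complex.Re (s * kap)) iRe).
    - exact: (integrableZl mI (C1 * complex.Im (s * kap)) iIm).
    rewrite !RintegralZl// JE.
    move: (\int[mu]_(t in I01) complex.Re (G t)) (\int[mu]_(t in I01) complex.Im (G t)) => X Y.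
    rewrite -mulrA mulrCA Re_realM mulrA.
    case: (s * kap) => p q /=; ring.
  apply: cvg_trans h; apply: near_eq_cvg; apply: nearW => j /=.
  rewrite -mulr_sumr [in RHS]mulrCA Re_realM; congr (_ * _); rewrite mulr_sumr.
  elim: (index_enum _) => [|n r IH]; first by rewrite !big_nil.
  by rewrite !big_cons ReD IH.
split.
  by have := key 1; under eq_fun do rewrite mul1r; rewrite mul1r.
have ImE (u : R[i]) : complex.Re (- 'i * u) = complex.Im u by case: u => p q /=; ring.
by have := key (- 'i); under eq_fun do rewrite ImE; rewrite ImE.
Qed.

End KernelLimit.

Section EdgePoints.
Variables (R : realType) (tau : R).
Hypothesis tau_lt1 : tau < 1.
Let tau1 : 0 < 1 - tau. Proof. by rewrite subr_gt0. Qed.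

(** The physical point divided by [p]: the normal is [- p / rho], so the radius [rho] in [gamma_]
    drops out. *)
Definition edge_point (N : nat) (z : R[i]) : R[i] := 1 - (N%:R * (1 - tau))^-1%:C * z.

Lemma realCM (x y : R) : (x * y)%:C = x%:C * y%:C.
Proof. exact: rmorphM. Qed.

Variables (N_ : nat -> nat) (z_ : nat -> R[i]) (z : R[i]).
Hypothesis Noo : N_ @ \oo --> \oo.
Hypothesis zz : ccvg z_ z.

Let N_gt0 : \forall j \near \oo, (0 < N_ j)%N.
Proof. exact: (Noo (nbhs_infty_gt _)). Qed.

Lemma edge_point_scaled :
  ccvg (fun j => (N_ j)%:R%:C * (edge_point (N_ j) (z_ j) - 1)) (- (1 - tau)^-1%:C * z).
Proof.
apply: (@near_eq_ccvg _ (fun j => - (1 - tau)^-1%:C * z_ j)); last first.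
  by apply: ccvgM => //; exact: ccvg_cst.
apply: filterS N_gt0 => j N0.
have -> : (1 - tau)^-1 = (N_ j)%:R * ((N_ j)%:R * (1 - tau))^-1.
  by field; rewrite gt_eqF//= pnatr_eq0 -lt0n.
by rewrite realCM /edge_point; ring.
Qed.

Let invN0 : ((N_ j)%:R * (1 - tau))^-1 @[j --> \oo] --> (0 : R).
Proof.
under eq_fun do rewrite invfM; rewrite -(mul0r (1 - tau)^-1).
by apply: cvgMl; exact: cvg_invn.
Qed.

Let edge_point_cvg1 : ccvg (fun j => edge_point (N_ j) (z_ j)) 1.
Proof.
rewrite -[1]addr0 -[0](mulr0 (-1)) -[X in _ * X](mul0r z).
have -> : (fun j => edge_point (N_ j) (z_ j)) =
    (fun j => 1 + (-1) * (((N_ j)%:R * (1 - tau))^-1%:C * z_ j)).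
  by apply/funext => j; rewrite mulN1r.
apply: ccvgD; first exact: ccvg_cst.
apply: ccvgM; first exact: ccvg_cst.
by apply: ccvgM => //; exact: (ccvg_real invN0).
Qed.

(** The square of the modulus is explicit, so [1 - |a|^2] is computed exactly and divided by
    [1 + |a|], which tends to 2. *)
Lemma edge_point_depth : (N_ j)%:R * (1 - normc (edge_point (N_ j) (z_ j))) @[j --> \oo] -->
  complex.Re z / (1 - tau).
Proof.
have n1 := ccvg_normc edge_point_cvg1; rewrite normc1 in n1.
have zr := zz.1; have zn := ccvg_normc zz.
have h : (2 * complex.Re (z_ j) - normc (z_ j) * normc (z_ j) * ((N_ j)%:R * (1 - tau))^-1)
     / (1 - tau) / (1 + normc (edge_point (N_ j) (z_ j))) @[j --> \oo] -->
   (2 * complex.Re z - normc z * normc z * 0) / (1 - tau) / (1 + 1).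
  apply: cvgM; last by apply: cvgV; rewrite ?pnatr_eq0//; apply: cvgD => //; exact: cvg_cst.
  apply: cvgMl; apply: cvgB; first exact: cvgMr.
  by apply: cvgM => //; exact: cvgM.
have -> : complex.Re z / (1 - tau) = (2 * complex.Re z - normc z * normc z * 0) / (1 - tau) / (1 + 1).
  by field; rewrite gt_eqF.
apply: cvg_trans h; apply: near_eq_cvg; apply: filterS N_gt0 => j N0 /=.
set a := edge_point _ _; set e := ((N_ j)%:R * (1 - tau))^-1.
have a0 : 0 < 1 + normc a by rewrite ltr_pwDl// normc_ge0.
have a1 : 1 + normc a != 0 by rewrite gt_eqF.
apply: (mulIf a1); rewrite divfK//.
have sqn (v : R[i]) : normc v * normc v = complex.Re v ^+ 2 + complex.Im v ^+ 2.
  by case: v => p q /=; rewrite -expr2 sqr_sqrtr// addr_ge0// sqr_ge0.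
have eN : (N_ j)%:R * e = (1 - tau)^-1.
  by rewrite /e; field; rewrite gt_eqF//= pnatr_eq0 -lt0n.
have -> : (N_ j)%:R * (1 - normc a) * (1 + normc a) = (N_ j)%:R * (1 - normc a * normc a) by ring.
have -> : normc a * normc a = 1 - e * (2 * complex.Re (z_ j) - normc (z_ j) * normc (z_ j) * e).
  by rewrite !sqn /a /edge_point -/e; case: (z_ j) => p q /=; ring.
by rewrite opprB addrCA subrr addr0 mulrA eN mulrC.
Qed.

Lemma edge_point_lt1 : 0 < complex.Re z ->
  \forall j \near \oo, normc (edge_point (N_ j) (z_ j)) < 1.
Proof.
move=> z0; near=> j.
have N0 : 0 < (N_ j)%:R :> R by rewrite ltr0n; near: j.
rewrite -subr_gt0 -(pmulr_rgt0 _ N0).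
by near: j; apply: (cvgr_gt _ edge_point_depth); rewrite divr_gt0.
Unshelve. all: by end_near. Qed.

End EdgePoints.

Section RescaledKernel.
Variables (R : realType) (g H : R -> R) (rho alpha tau : R).
Hypothesis rho_gt0 : 0 < rho.
Hypothesis alpha_gt : -1 < alpha.
Hypothesis tau_ge0 : 0 <= tau.
Hypothesis tau_lt1 : tau < 1.
Hypothesis g_cont : forall r, 0 < r -> {for r, continuous g}.
Hypothesis g_low : exists b, exists2 d, 0 < d & forall r, 0 < r -> r < d -> b < g r.
Hypothesis g_der : is_derive rho 1 g (2 * tau / rho).
Hypothesis g_tan : forall r, 0 < r -> r <= rho -> g rho + 2 * tau * ln (r / rho) <= g r.
Hypothesis H_cont : continuous H.
Hypothesis H_rho : H rho = 0.
Let tau1 : 0 < 1 - tau. Proof. by rewrite subr_gt0. Qed.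

(** The order of magnitude of the weight at distance of order [rho / N] from the edge; the same
    factors occur in [edge_scale]. *)
Let unit_weight (N : nat) : R := (rho / N%:R) `^ alpha * expR (- (N%:R * g rho)).

Definition edge_amplitude (N : nat) (r : R) : R :=
  Num.sqrt (radial_weight g H rho alpha N r / unit_weight N).

Lemma edge_amplitude_cvg (N_ : nat -> nat) (t_ : nat -> R) (c : R) : N_ @ \oo --> \oo ->
  0 < c -> (N_ j)%:R * (1 - t_ j) @[j --> \oo] --> c ->
  edge_amplitude (N_ j) (rho * t_ j) @[j --> \oo] --> expR (tau * c) * c `^ (alpha / 2).
Proof.
move=> Noo c0 tc.
have N_gt0 : \forall j \near \oo, (0 < N_ j)%N by exact: (Noo _ (nbhs_infty_gt _)).
have t1 : t_ j @[j --> \oo] --> (1 : R).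
  have h : 1 - (N_ j)%:R^-1 * ((N_ j)%:R * (1 - t_ j)) @[j --> \oo] --> 1 - 0 * c.
    by apply: cvgB; [exact: cvg_cst|apply: cvgM => //; exact: cvg_invn].
  rewrite mul0r subr0 in h; apply: cvg_trans h; apply: near_eq_cvg.
  by apply: filterS N_gt0 => j N0 /=; field; rewrite pnatr_eq0 -lt0n.
have rt : rho * t_ j @[j --> \oo] --> rho by rewrite -[X in _ --> X]mulr1; apply: cvgMr.
have hg : (N_ j)%:R * (g (rho * t_ j) - g rho) @[j --> \oo] --> 2 * tau / rho * - (rho * c).
  apply: (cvg_mul_diff g_der rt).
  have h : - (rho * ((N_ j)%:R * (1 - t_ j))) @[j --> \oo] --> - (rho * c).
    by apply: cvgN; exact: cvgMr.
  apply: cvg_trans h; apply: near_eq_cvg; apply: nearW => j /=; ring.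
have he : expR (- ((N_ j)%:R * (g (rho * t_ j) - g rho))) @[j --> \oo] --> expR (2 * tau * c).
  have -> : 2 * tau * c = - (2 * tau / rho * - (rho * c)) by field; rewrite gt_eqF.
  by apply: cvg_at; [exact: continuous_expR|exact: cvgN].
have hp : ((N_ j)%:R * (1 - t_ j)) `^ alpha @[j --> \oo] --> c `^ alpha.
  by apply: (@cvg_at _ (fun r => r `^ alpha) _ _ _ tc); exact: continuous_powR.
have hH : expR (H (rho * t_ j)) @[j --> \oo] --> (1 : R).
  rewrite -expR0 -H_rho; apply: cvg_at; first exact: continuous_expR.
  exact: (cvg_at (@H_cont rho) rt).
have -> : expR (tau * c) * c `^ (alpha / 2) = Num.sqrt (expR (2 * tau * c) * c `^ alpha * 1).
  rewrite mulr1 sqrtrM ?expR_ge0// powRrM powR12_sqrt ?powR_ge0//; congr (_ * _).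
  rewrite (_ : 2 * tau * c = tau * c + tau * c); last by ring.
  by rewrite expRD -expr2 sqrtr_sqr ger0_norm ?expR_ge0.
apply: (@cvg_at _ (@Num.sqrt R)); first exact: sqrt_continuous.
apply: cvg_trans (cvgM (cvgM he hp) hH); apply: near_eq_cvg; near=> j => /=.
have N0 : 0 < (N_ j)%:R :> R by rewrite ltr0n; near: j.
have t0 : 0 < (N_ j)%:R * (1 - t_ j) by near: j; exact: (cvgr_gt _ tc).
have tj1 : 0 < 1 - t_ j by rewrite -(pmulr_rgt0 _ N0).
rewrite /radial_weight ifT; last by rewrite -[ltRHS]mulr1 ltr_pM2l//; lra.
have -> : rho - rho * t_ j = rho / (N_ j)%:R * ((N_ j)%:R * (1 - t_ j)).
  by field; rewrite gt_eqF.
rewrite powRM ?(ltW t0) ?divr_ge0 ?(ltW rho_gt0)// /unit_weight.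
have -> : expR (- ((N_ j)%:R * g (rho * t_ j))) =
    expR (- ((N_ j)%:R * g rho)) * expR (- ((N_ j)%:R * (g (rho * t_ j) - g rho))).
  by rewrite -expRD; congr expR; ring.
by field; rewrite !gt_eqF ?expR_gt0 ?powR_gt0 ?divr_gt0.
Unshelve. all: by end_near. Qed.

Variable p : R[i].
Hypothesis p_rho : normc p = rho.

Definition moment (N n : nat) : R := edge_scale g rho alpha N n * edge_moment g H rho alpha N n.

Definition rescaled_kernel (N : nat) (z w : R[i]) : R[i] :=
  ((rho / (N%:R * (1 - tau))) ^+ 2)%:C *
  proj_kernel (fun u => radial_weight g H rho alpha N (normc u)) (moment N) N
    (p * edge_point tau N z) (p * edge_point tau N w).

(** The factors [p^n conj(p)^n = rho^(2n)] and [unit_weight] cancel against [edge_scale]. One of the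
    two factors [N^-1] from the scaling is absorbed as well; the other is the mesh of the Riemann
    sum. *)
Lemma rescaled_kernelE (N : nat) (z w : R[i]) : (0 < N)%N ->
  let a := edge_point tau N z in let b := edge_point tau N w in
  rescaled_kernel N z w =
  ((1 - tau)^-1 * edge_amplitude N (rho * normc a) * edge_amplitude N (rho * normc b))%:C *
  ((N%:R * (1 - tau))^-1%:C * \sum_(n < N) kernel_term g H rho alpha N n a b).
Proof.
move=> N0 a b; have N1 : 0 < N%:R :> R by rewrite ltr0n.
rewrite /rescaled_kernel /proj_kernel -/a -/b mulrA !mulr_sumr; apply: eq_bigr => n _.
rewrite /orth_fun /kernel_term !normcM p_rho.
set A := radial_weight _ _ _ _ _ _; set B := radial_weight _ _ _ _ _ _.
have em0 := edge_moment_gt0 rho_gt0 alpha_gt g_cont g_low g_tan H_cont n N0.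
have m0 : 0 < moment N n by rewrite mulr_gt0 ?edge_scale_gt0.
have u0 : 0 < unit_weight N by rewrite mulr_gt0 ?powR_gt0 ?expR_gt0 ?divr_gt0.
have pp : p ^+ n * conjc (p ^+ n) = (rho ^+ (2 * n))%:C.
  by rewrite mulc_conj normcX p_rho -exprM mulnC.
rewrite conjcM conjc_real !exprMn conjcM.
have -> : forall x y : R, x%:C * (p ^+ n * a ^+ n) * (y%:C * (conjc (p ^+ n) * conjc (b ^+ n))) =
   (x * y * rho ^+ (2 * n))%:C * (a ^+ n * conjc (b ^+ n)).
  by move=> x y; rewrite !realCM -pp; ring.
rewrite !mulrA -!realCM; congr (_%:C * _ * _).
have amp r : edge_amplitude N r =
    Num.sqrt (radial_weight g H rho alpha N r) * Num.sqrt (unit_weight N)^-1.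
  by rewrite /edge_amplitude sqrtrM ?radial_weight_ge0.
rewrite !amp -/A -/B.
have sm : Num.sqrt (moment N n) ^+ 2 = moment N n by rewrite sqr_sqrtr// ltW.
have su : Num.sqrt (unit_weight N)^-1 ^+ 2 = (unit_weight N)^-1 by rewrite sqr_sqrtr// invr_ge0 ltW.
have sm0 : Num.sqrt (moment N n) != 0 by rewrite gt_eqF ?sqrtr_gt0.
transitivity (Num.sqrt A * Num.sqrt B *
    ((rho / (N%:R * (1 - tau))) ^+ 2 * rho ^+ (2 * n) / Num.sqrt (moment N n) ^+ 2)).
  by field; rewrite sm0 !gt_eqF.
transitivity (Num.sqrt A * Num.sqrt B * ((1 - tau)^-1 * Num.sqrt (unit_weight N)^-1 ^+ 2 *
    (N%:R * (1 - tau))^-1 * (edge_moment g H rho alpha N n)^-1)); last by ring.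
rewrite sm su /moment /edge_scale /unit_weight; congr (_ * _).
have E0 := expR_gt0 (- (N%:R * g rho)).
have P0 : 0 < (rho / N%:R) `^ alpha by rewrite powR_gt0// divr_gt0.
move: (expR _) ((rho / N%:R) `^ alpha) (edge_moment _ _ _ _ _ _) E0 P0 em0 => E P M E0 P0 M0.
have r0 : rho ^+ (2 * n) != 0 by rewrite expf_neq0// gt_eqF.
by field; rewrite r0 !gt_eqF.
Qed.

(* The cocycle by which the kernels converge only up to diagonal conjugation. *)
Definition edge_phase (z : R[i]) : R[i] :=
  expc ((tau / (1 - tau))%:C * ((complex.Re z)%:C - z)).

Lemma expc_real (x : R) : expc x%:C = (expR x)%:C.
Proof. by rewrite /expc /= cos0 sin0 mulr1. Qed.

Lemma edge_phase_norm (z : R[i]) : edge_phase z * conjc (edge_phase z) = 1.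
Proof.
rewrite /edge_phase expc_conj -expcD -expc0; congr expc.
by case: z => x y; apply/eqP; rewrite eq_complex /=; apply/andP; split; apply/eqP; ring.
Qed.

Lemma rescaled_kernel_cvg (N_ : nat -> nat) (z_ w_ : nat -> R[i]) (z w : R[i]) :
  N_ @ \oo --> \oo -> ccvg z_ z -> ccvg w_ w -> 0 < complex.Re z -> 0 < complex.Re w ->
  ccvg (fun j => rescaled_kernel (N_ j) (z_ j) (w_ j))
    (edge_phase z * limit_kernel alpha z w * conjc (edge_phase w)).
Proof.
move=> Noo zz ww z0 w0.
have az := edge_point_scaled tau_lt1 Noo zz; have bw := edge_point_scaled tau_lt1 Noo ww.
have le1 (v_ : nat -> R[i]) v : ccvg v_ v -> 0 < complex.Re v ->
    \forall j \near \oo, normc (edge_point tau (N_ j) (v_ j)) <= 1.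
  by move=> vv v0; apply: filterS (edge_point_lt1 tau_lt1 Noo vv v0) => j; exact: ltW.
have hs := riemann_sum_ccvg rho_gt0 alpha_gt tau_ge0 tau_lt1 g_cont g_low g_der g_tan
  H_cont H_rho Noo z0 w0 az bw (le1 _ _ zz z0) (le1 _ _ ww w0).
have c0 (v : R[i]) : 0 < complex.Re v -> 0 < complex.Re v / (1 - tau) by move=> v0; rewrite divr_gt0.
have hz := edge_amplitude_cvg Noo (c0 z z0) (edge_point_depth tau_lt1 Noo zz).
have hw := edge_amplitude_cvg Noo (c0 w w0) (edge_point_depth tau_lt1 Noo ww).
have ha : (1 - tau)^-1 * edge_amplitude (N_ j) (rho * normc (edge_point tau (N_ j) (z_ j))) *
    edge_amplitude (N_ j) (rho * normc (edge_point tau (N_ j) (w_ j))) @[j --> \oo] -->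
  (1 - tau)^-1 * (expR (tau * (complex.Re z / (1 - tau))) * (complex.Re z / (1 - tau)) `^ (alpha / 2)) *
    (expR (tau * (complex.Re w / (1 - tau))) * (complex.Re w / (1 - tau)) `^ (alpha / 2)).
  by apply: cvgM hw; exact: cvgMr.
have := ccvgM (ccvg_real ha) hs.
set J := complex_integral _ _ _; set kap := expc _.
have -> : limit_kernel alpha z w =
    ((2 * complex.Re z) `^ (alpha / 2) * (2 * complex.Re w) `^ (alpha / 2))%:C * J.
  by rewrite /limit_kernel !indicE !mem_set// mulr1; exact: mulr1.
(* The exponential growth of the two amplitudes is the inverse of the modulus of [kap], so only
   phases survive. *)
have ph : edge_phase z * conjc (edge_phase w) =
  (expR (tau * (complex.Re z / (1 - tau))) * expR (tau * (complex.Re w / (1 - tau))))%:C * kap.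
  rewrite realCM -(expc_real (tau * (complex.Re z / _))) -(expc_real (tau * (complex.Re w / _))).
  rewrite /edge_phase /kap expc_conj -!expcD; congr expc.
  case: (z) (w) => z1 z2 [w1 w2]; apply/eqP; rewrite eq_complex /=.
  by apply/andP; split; apply/eqP; field; rewrite gt_eqF.
have re : (1 - tau)^-1 * (complex.Re z / (1 - tau)) `^ (alpha / 2) *
    (complex.Re w / (1 - tau)) `^ (alpha / 2) * (2 `^ alpha * (1 - tau) `^ (alpha + 1)) =
    (2 * complex.Re z) `^ (alpha / 2) * (2 * complex.Re w) `^ (alpha / 2).
  rewrite !powRM ?invr_ge0 ?(ltW z0) ?(ltW w0) ?(ltW tau1)//.
  have -> : (1 - tau) `^ (alpha + 1) = (1 - tau) `^ (alpha / 2) * (1 - tau) `^ (alpha / 2) * (1 - tau).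
    rewrite -powRD; last by rewrite (gt_eqF tau1) implybT.
    by rewrite -splitr powRD ?powRr1 ?(ltW tau1)// (gt_eqF tau1) implybT.
  have -> : 2 `^ alpha = 2 `^ (alpha / 2) * 2 `^ (alpha / 2) :> R.
    by rewrite -powRD -?splitr// pnatr_eq0 implybT.
  have -> : (1 - tau)^-1 `^ (alpha / 2) = ((1 - tau) `^ (alpha / 2))^-1.
    by rewrite -powR_inv1 ?(ltW tau1)// -powRrM mulN1r powRN.
  have T0 : 0 < (1 - tau) `^ (alpha / 2) by rewrite powR_gt0.
  by field; rewrite (gt_eqF T0) (gt_eqF tau1).
move=> h; apply: near_eq_ccvg (_ : ccvg _ _); last first.
  rewrite [edge_phase z * _ * _]mulrAC ph -re.
  have -> : forall e1 e2 p1 p2 t1 t2 : R, (e1 * e2)%:C * kap * ((t1 * p1 * p2 * t2)%:C * J) =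
    (t1 * (e1 * p1) * (e2 * p2))%:C * (t2%:C * kap * J).
    by move=> *; rewrite !realCM; ring.
  exact: h.
have N_gt0 : \forall j \near \oo, (0 < N_ j)%N by exact: (Noo _ (nbhs_infty_gt _)).
by apply: filterS N_gt0 => j N0; rewrite rescaled_kernelE.
Qed.

End RescaledKernel.

(** * Convergence of the correlations *)

Section ContinuousConvergence.
Variables (R : realType) (k : nat).

Lemma cvg_complexP (f : nat -> R[i]) (l : R[i]) :
  (f @ \oo --> (l : R[i]^o)) <-> (forall e : R, 0 < e -> \forall j \near \oo, normc (f j - l) < e).
Proof.
have nE (u : R[i]) (e : R) : (normc (l - u) < e)%R = (`|(l : R[i]^o) - u| < e%:C).
  rewrite ltcE /=; case: (l - u) => p q /=.
  by rewrite eqxx.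
have sw (u : R[i]) : normc (u - l) = normc (l - u) by rewrite -normcN opprB.
have P := @cvgrPdist_lt R[i] R[i]^o nat \oo _ f l.
split=> [/P fl e e0|fl].
  have := fl e%:C; rewrite ltcE /= eqxx e0 => /(_ isT).
  by apply: filterS => j; rewrite sw nE.
apply/P => e; rewrite ltcE /= => /andP[/eqP e1 e0].
have -> : e = (complex.Re e)%:C by case: e e1 {e0} => p q /= ->.
by apply: filterS (fl _ e0) => j; rewrite sw nE.
Qed.

Lemma ccvg_cvg (f : nat -> R[i]) (l : R[i]) : ccvg f l -> f @ \oo --> (l : R[i]^o).
Proof.
move=> /ccvg_normc0 fl; apply/cvg_complexP => e e0.
exact: (cvgr_lt _ fl).
Qed.

Variables (F : nat -> k.-tuple R[i] -> R[i]) (L : k.-tuple R[i] -> R[i]) (U : set R[i]).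

Hypothesis F_cvg : forall (N_ : nat -> nat) (z_ : nat -> k.-tuple R[i]) z,
  N_ @ \oo --> \oo -> (forall i, U (tnth z i)) ->
  (forall i, ccvg (fun j => tnth (z_ j) i) (tnth z i)) ->
  ccvg (fun j => F (N_ j) (z_ j)) (L z).

Lemma cvg_ge_id (N_ : nat -> nat) : (forall j, (j <= N_ j)%N) -> N_ @ \oo --> \oo.
Proof.
move=> jN A [m _ mA]; exists m => //= j /= mj; apply: mA => /=.
exact: leq_trans mj (jN j).
Qed.

(** Tychonoff gives a cluster point in the product, and indices are picked with all coordinates
    within [1 / (n + 1)] of it. That [phi] dominates the identity suffices for [phi j] to tend to
    infinity. *)
Lemma compact_subsequence (K : set R[i]^o) (z_ : nat -> k.-tuple R[i]) : compact K ->
  (forall j i, K (tnth (z_ j) i)) ->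
  exists (phi : nat -> nat) (z : k.-tuple R[i]), [/\ forall j, (j <= phi j)%N,
    forall i, K (tnth z i) & forall i, ccvg (fun j => tnth (z_ (phi j)) i) (tnth z i)].
Proof.
move=> cK zK.
have cKk := @tychonoff 'I_k (fun=> R[i]^o) (fun=> K) (fun=> cK).
pose s (j : nat) : prod_topology (fun _ : 'I_k => R[i]^o) := fun i => tnth (z_ j) i.
have [|f [fK fcl]] := cKk (s @ \oo) _.
  by exists 0%N => // j _ /= i; exact: zK.
pose z : k.-tuple R[i] := [tuple f i | i < k].
have tz i : tnth z i = f i by rewrite tnth_mktuple.
have ex (n : nat) : exists m, (n <= m)%N /\ forall i, normc (tnth (z_ m) i - f i) < n.+1%:R^-1.
  pose B : set (prod_topology (fun _ : 'I_k => R[i]^o)) :=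
    [set g | forall i, `|(f i : R[i]^o) - g i| < (n.+1%:R^-1 : R)%:C].
  have nB : nbhs f B.
    apply: (@filter_forall _ 'I_k (fun i => [set g | `|(f i : R[i]^o) - g i| < (n.+1%:R^-1 : R)%:C])
      (nbhs f) (nbhs_filter f)) => i.
    have e0 : 0 < (n.+1%:R^-1 : R)%:C :> R[i] by rewrite ltcE /= eqxx invr_gt0 ltr0n.
    have nb : nbhs (f i : R[i]^o) [set u : R[i]^o | `|(f i : R[i]^o) - u| < (n.+1%:R^-1 : R)%:C].
      by have := @nbhsx_ballx R[i] R[i]^o (f i) _ e0; rewrite -ball_normE.
    exact: (@proj_continuous _ (fun _ : 'I_k => R[i]^o) i f _ nb).
  have As : (s @ \oo) [set s m | m in [set m | (n <= m)%N]].
    by exists n => // m /= nm; exists m.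
  have [_ [[m /= nm <-]] Bm] := fcl _ _ As nB.
  exists m; split=> // i; have := Bm i; rewrite ltcE /= /s -normcN opprB.
  by case: (f i - tnth (z_ m) i) => p q /= /andP[_].
have [phi Hphi] := choice ex.
exists phi, z; split=> [j|i|i].
- by have [] := Hphi j.
- by rewrite tz; exact: fK.
apply: normc_to0_ccvg; rewrite tz.
apply: (squeeze_cvgr _ (cvg_cst 0) (@cvg_harmonic R)); apply: nearW => j.
by rewrite normc_ge0 ltW//; have [_] := Hphi j.
Qed.

(** Bad points are extracted along a convergent subsequence. Continuity of [L] comes from the same
    hypothesis: [L (z_ j)] is approximated by [F (M j) (z_ j)] with [M j] large, and this diagonal
    sequence tends to [L z]. *)
Lemma compact_uniform_cvg (K : set R[i]^o) : compact K -> K `<=` U ->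
  forall eps : R, 0 < eps -> \forall N \near \oo, forall z : k.-tuple R[i],
    (forall i, K (tnth z i)) -> normc (F N z - L z) < eps.
Proof.
move=> cK KU eps eps0; apply: contrapT => nH.
have ex (n : nat) : exists Nz : nat * k.-tuple R[i], [/\ (n <= Nz.1)%N,
    forall i, K (tnth Nz.2 i) & eps <= normc (F Nz.1 Nz.2 - L Nz.2)].
  apply: contrapT => nex; apply: nH; exists n => // N /= nN z zK.
  by rewrite ltNge; apply/negP => h; apply: nex; exists (N, z).
have [Nz HNz] := choice ex.
have [phi [z [phi_ge zK zcvg]]] := @compact_subsequence K (fun j => (Nz j).2) cK
  (fun j => let: And3 _ h _ := HNz j in h).
pose N_ j := (Nz (phi j)).1; pose z_ j := (Nz (phi j)).2.
have zjK j i : K (tnth (z_ j) i) by have [_ h _] := HNz (phi j); exact: h.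
have N_oo : N_ @ \oo --> \oo.
  by apply: cvg_ge_id => j; have [h _ _] := HNz (phi j); exact: leq_trans (phi_ge j) h.
have exM (j : nat) : exists M, (j <= M)%N /\ normc (F M (z_ j) - L (z_ j)) < j.+1%:R^-1.
  have id_oo : (fun M : nat => M) @ \oo --> \oo by exact: cvg_id.
  have h := ccvg_normc0 (F_cvg id_oo (fun i => KU _ (zjK j i)) (fun i => ccvg_cst _)).
  have j0 : 0 < j.+1%:R^-1 :> R by rewrite invr_gt0 ltr0n.
  have [m _ hm] := cvgr_lt _ h _ j0.
  by exists (maxn j m); split; [exact: leq_maxl|apply: hm => /=; exact: leq_maxr].
have [M HM] := choice exM.
have M_oo : M @ \oo --> \oo by apply: cvg_ge_id => j; have [] := HM j.
have zU i : U (tnth z i) by exact: KU.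
have h1 := ccvg_normc0 (F_cvg N_oo zU zcvg).
have h2 := ccvg_normc0 (F_cvg M_oo zU zcvg).
have h : normc (F (N_ j) (z_ j) - L z) + normc (F (M j) (z_ j) - L z) + j.+1%:R^-1
    @[j --> \oo] --> (0 + 0 + 0 : R).
  by apply: cvgD; [exact: cvgD|exact: cvg_harmonic].
rewrite !addr0 in h.
have [m _ /(_ m (leqnn m)) /=] := cvgr_lt _ h _ eps0.
apply/negP; rewrite -leNgt.
have [_ _ he] := HNz (phi m); apply: le_trans he _.
have [_ /ltW hM] := HM m.
have -> : F (N_ m) (z_ m) - L (z_ m) =
    (F (N_ m) (z_ m) - L z) + - (F (M m) (z_ m) - L z) + (F (M m) (z_ m) - L (z_ m)) by ring.
apply: le_trans (le_normcD _ _) _; apply: lerD => //.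
by apply: le_trans (le_normcD _ _) _; rewrite normcN.
Qed.

End ContinuousConvergence.

Section Hermitian.
Variable R : realType.

Lemma det_unimodular_conj k (L : 'M[R[i]]_k) (d : 'I_k -> R[i]) :
  (forall i, d i * conjc (d i) = 1) ->
  \det (\matrix_(i, j) (d i * L i j * conjc (d j))) = \det L.
Proof.
move=> d1.
have -> : \matrix_(i, j) (d i * L i j * conjc (d j)) =
    diag_mx (\row_i d i) *m L *m diag_mx (\row_i conjc (d i)).
  by apply/matrixP => i j; rewrite mul_mx_diag mul_diag_mx !mxE.
rewrite !det_mulmx !det_diag mulrAC -big_split big1 ?mul1r// => i _.
by rewrite !mxE; exact: d1.
Qed.

(** Serves to drop the real part introduced by [correlation_det]. *)
Lemma det_hermitian_real k (A : 'M[R[i]]_k) : (forall i j, A j i = conjc (A i j)) ->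
  (complex.Re (\det A))%:C = \det A.
Proof.
move=> hA.
have : conjc (\det A) = \det A.
  rewrite -det_map_mx -det_tr; congr (\det _); apply/matrixP => i j.
  by rewrite !mxE [RHS]hA.
case: (\det A) => x y /eqP; rewrite eq_complex /= => /andP[_ /eqP yy].
by congr (_ +i* _); lra.
Qed.

Lemma conjc_mul_conj (u v : R[i]) : conjc (u * conjc v) = v * conjc u.
Proof.
by case: u v => a b [c d]; apply/eqP; rewrite eq_complex /=; apply/andP; split; apply/eqP; ring.
Qed.

Lemma det_zero_row k (A : 'M[R[i]]_k) i : (forall j, A i j = 0) -> \det A = 0.
Proof. by move=> h; rewrite (expand_det_row A i) big1// => j _; rewrite h mul0r. Qed.

End Hermitian.

Section HardEdge.
Variables (R : realType) (Q : R[i] -> \bar R) (q : R -> \bar R) (rho0 rho1 rho alpha : R).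
Variables (h : R[i] -> R) (p : R[i]).
Hypothesis Q_gtNy : forall z, (-oo < Q z)%E.
Hypothesis Q_lsc : lower_semicontinuous (Q : R[i]^o -> \bar R).
Hypothesis Q_radial : forall z, Q z = q (normc z).
Hypothesis Q_subharmonic : subharmonic_on setT Q.
Hypothesis q_fin : forall r, 0 < r -> q r \is a fin_num.
Hypothesis q_derivable : forall r, 0 < r -> derivable (fine \o q) r 1.
Hypothesis dq_ac : forall a b, 0 < a -> a <= b -> absolutely_continuous_on a b (dq q).
Hypothesis rho0_least : is_least [set r | 0 <= r /\ forall s, r < s -> 0 < dq q s] rho0.
Hypothesis rho1_least : is_least [set r | 0 < r /\ r * dq q r = 2] rho1.
Hypothesis rho0_lt : rho0 < rho.
Hypothesis lt_rho1 : rho < rho1.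
Hypothesis alpha_gt : -1 < alpha.
Hypothesis h_smooth : smooth (fun u : R * R => h (of_pair u)).
Hypothesis h_radial : forall z, h z = h (normc z)%:C.
Hypothesis h_circle : forall z, normc z = rho -> h z = 0.
Hypothesis p_circle : normc p = rho.

Let g : R -> R := fine \o q.
Let H (r : R) : R := h r%:C.
Let t : R := tau q rho.

Let rho_gt0 : 0 < rho.
Proof. by apply: le_lt_trans rho0_lt; have [[]] := rho0_least. Qed.

Let t_ge0 : 0 <= t.
Proof.
have [[_ dq0] _] := rho0_least.
by rewrite /t /tau divr_ge0// mulr_ge0 ?(ltW rho_gt0)// ltW// dq0.
Qed.

Let t_lt1 : t < 1.
Proof.
rewrite /t /tau ltr_pdivrMr// mul1r.
exact: (edge_lt2 Q_radial Q_gtNy Q_lsc q_fin q_derivable dq_ac rho1_least rho_gt0 lt_rho1).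
Qed.

Let g_cont : forall r, 0 < r -> {for r, continuous g}.
Proof. by move=> r; exact: g_continuous. Qed.

Let g_low : exists b, exists2 d, 0 < d & forall r, 0 < r -> r < d -> b < g r.
Proof. exact: (potential_lower_bound_near0 Q_radial Q_gtNy Q_lsc q_fin). Qed.

Let g_der : is_derive rho 1 g (2 * t / rho).
Proof.
have -> : 2 * t / rho = derive1 g rho.
  by rewrite /t /tau /dq; field; rewrite gt_eqF.
by rewrite derive1E; split=> //; exact: q_derivable.
Qed.

Let g_tan r : 0 < r -> r <= rho -> g rho + 2 * t * ln (r / rho) <= g r.
Proof.
move=> r0 rr.
have := @tangent_ineq _ Q q Q_radial Q_subharmonic q_fin q_derivable rho r rho_gt0.
rewrite r0 rr => /(_ isT).
by have -> : 2 * t = rho * derive1 (fine \o q) rho by rewrite /t /tau /dq; field.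
Qed.

Let H_cont : continuous H.
Proof.
(* The empty list of directions in [smooth] gives differentiability of [h] itself. *)
move=> r; have := differentiable_continuous (h_smooth [::] (r, 0)) => /= hc.
have pc : {for (r : R), continuous (fun s : R => (s, 0 : R))}.
  move=> A hA.
  exact: (@cvg_pair R R R (nbhs r) (nbhs r) (nbhs (0 : R)) _ _ _ id (fun=> 0) cvg_id (cvg_cst _) A hA).
exact: (@continuous_comp _ _ _ (fun s : R => (s, 0 : R)) (fun u => h (of_pair u)) r pc hc).
Qed.

Let H_rho : H rho = 0.
Proof. by apply: h_circle; rewrite /= expr0n addr0 sqrtr_sqr gtr0_norm. Qed.

Let Q_finite z : Q z \is a fin_num.
Proof.
by have [Qy _ _] := Q_subharmonic; rewrite fin_numE -ltNye -ltey Q_gtNy Qy.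
Qed.

Let weightE N z : weight Q rho alpha h N z = radial_weight g H rho alpha N (normc z).
Proof. by rewrite /weight /radial_weight Q_radial h_radial. Qed.

Let wE N u : weight Q rho alpha h N (of_pair u) =
  radial_weight g H rho alpha N (Num.sqrt (norm2 u)).
Proof. by rewrite weightE -normc_pt sqrtr_sqr ger0_norm// normc_ge0. Qed.

Let m := moment g H rho alpha.

Let m_gt0 N n : (0 < N)%N -> 0 < m N n.
Proof.
move=> N0; rewrite /m mulr_gt0 ?edge_scale_gt0//.
exact: (edge_moment_gt0 rho_gt0 alpha_gt g_cont g_low g_tan H_cont).
Qed.

Let mE N n : (0 < N)%N -> (\int[lebesgue_measure]_(x in `]0%R, +oo[)
  (x ^+ n * radial_weight g H rho alpha N (Num.sqrt x))%:E = (m N n)%:E)%E.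
Proof.
move=> N0; rewrite integral_weighted// (edge_momentE rho_gt0 alpha_gt g_cont g_low g_tan H_cont)//.
Qed.

Lemma rescaled_correlation_det N k (z : k.-tuple R[i]) : (0 < N)%N -> (k <= N)%N ->
  (rescaled_correlation Q q rho alpha h p N z)%:C =
  \det (\matrix_(i < k, j < k) rescaled_kernel g H rho alpha t p N (tnth z i) (tnth z j)).
Proof.
move=> N0 kN; have N1 : 0 < N%:R :> R by rewrite ltr0n.
rewrite /rescaled_correlation (correlation_det N0 Q_finite (wE N) _ _ (fun n => @m_gt0 N n N0) (fun n => @mE N n N0))//; last 2 first.
- by move=> x; exact: radial_weight_ge0.
- exact: measurable_radial_weight.
rewrite realCM (_ : forall x : R, fine x%:E = x)// /det_at.
set T := [tuple _ | _ < k]; set w := weight _ _ _ _ _.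
set A := (X in complex.Re (\det X)).
have pt i : tnth T i = p * edge_point t N (tnth z i).
  rewrite tnth_mktuple /normal /gamma_ -/t /edge_point.
  have -> : (rho / (N%:R * (1 - t)))%:C = rho%:C * (N%:R * (1 - t))^-1%:C by exact: realCM.
  have r0 : rho%:C != 0 :> R[i] by rewrite eq_complex /= eqxx andbT gt_eqF.
  by rewrite [- _ * _]mulrA mulNr divfK//; ring.
have -> : \matrix_(i < k, j < k) rescaled_kernel g H rho alpha t p N (tnth z i) (tnth z j) = ((gamma_ q rho N) ^+ 2)%:C *: A.
  apply/matrixP => i j; rewrite !mxE /rescaled_kernel -/(gamma_ q rho N) -!tnth_nth !pt.
  have -> // : w = fun u => radial_weight g H rho alpha N (normc u).
  by apply/funext => u; exact: weightE.
rewrite detZ det_hermitian_real; last first.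
  move=> i j; rewrite !mxE /proj_kernel rmorph_sum; apply: eq_bigr => n _.
  exact: esym (conjc_mul_conj _ _).
by rewrite exprM rmorphXn.
Qed.

Lemma rescaled_kernel_out N z w : (0 < N)%N -> complex.Re z <= 0 ->
  rescaled_kernel g H rho alpha t p N z w = 0.
Proof.
move=> N0 z0; rewrite /rescaled_kernel /proj_kernel big1 ?mulr0// => n _.
rewrite /orth_fun /radial_weight normcM p_circle ifF ?sqrtr0 ?mul0r//.
apply/negbTE; rewrite -leNgt -[leLHS]mulr1 ler_wpM2l ?(ltW rho_gt0)//.
(* The real part of [edge_point] is at least 1 when [Re z <= 0], hence so is its modulus. *)
apply: le_trans (norm_ReIm _).1; apply: le_trans (ler_norm _).
rewrite /edge_point ReD ReN Re_realM /= lerDl oppr_ge0 mulr_ge0_le0// invr_ge0.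
by rewrite mulr_ge0// subr_ge0 ltW.
Qed.

Lemma rescaled_correlation_cvg k (N_ : nat -> nat) (z_ : nat -> k.-tuple R[i]) z :
  N_ @ \oo --> \oo -> (forall i, half_plane (tnth z i)) ->
  (forall i, ccvg (fun j => tnth (z_ j) i) (tnth z i)) ->
  ccvg (fun j => (rescaled_correlation Q q rho alpha h p (N_ j) (z_ j))%:C)
    (limit_correlation alpha z).
Proof.
move=> Noo zP zz.
(* The determinantal formula holds once [N] is positive and at least [k]; smaller [N] are
   discarded. *)
have hN : \forall j \near \oo, (maxn 1 k <= N_ j)%N by exact: (Noo _ (nbhs_infty_ge _)).
apply: near_eq_ccvg (_ : ccvg (fun j => \det (\matrix_(i < k, i' < k)
  rescaled_kernel g H rho alpha t p (N_ j) (tnth (z_ j) i) (tnth (z_ j) i'))) _).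
  apply: filterS hN => j; rewrite geq_max => /andP[N0 kN].
  by rewrite rescaled_correlation_det.
rewrite /limit_correlation -(@det_unimodular_conj _ _ _ (fun i => edge_phase t (tnth z i))).
  apply: ccvg_det => i j; rewrite !mxE; under eq_fun do rewrite mxE.
  exact: (rescaled_kernel_cvg rho_gt0 alpha_gt t_ge0 t_lt1 g_cont g_low g_der g_tan H_cont
    H_rho p_circle Noo (zz i) (zz j) (zP i) (zP j)).
by move=> i; exact: edge_phase_norm.
Qed.

Lemma rescaled_correlation_pointwise k (z : k.-tuple R[i]) :
  (rescaled_correlation Q q rho alpha h p N z)%:C @[N --> \oo]
    --> (limit_correlation alpha z : R[i]^o).
Proof.
apply: ccvg_cvg; have [zP|] := pselect (forall i, half_plane (tnth z i)).
  by apply: (rescaled_correlation_cvg cvg_id zP) => i; exact: ccvg_cst.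
move=> /existsNP[i /negP]; rewrite -leNgt => zi.
have -> : limit_correlation alpha z = 0.
  apply: (det_zero_row (i := i)) => j; rewrite mxE /limit_kernel indicE memNset ?mul0r ?mulr0//.
  by rewrite /half_plane /= ltNge zi.
apply: near_eq_ccvg (ccvg_cst 0); exists (maxn 1 k) => // N /=.
rewrite geq_max => /andP[N0 kN]; rewrite rescaled_correlation_det//.
by rewrite (det_zero_row (i := i))// => j; rewrite mxE rescaled_kernel_out.
Qed.

End HardEdge.

Theorem theorem2p1 (R : realType)
  (Q : R[i] -> \bar R) (q : R -> \bar R) (rho0 rho1 rho alpha : R)
  (h : R[i] -> R) (p : R[i])
  (Q_gtNy : forall z, (-oo < Q z)%E)
  (Q_lsc : lower_semicontinuous (Q : R[i]^o -> \bar R))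
  (Q_fin : (0 < @dA R [set u | Q (of_pair u) \is a fin_num])%E)
  (Q_growth : (1 < limf_einf
     (fun z : R[i]^o => Q z / (ln (normc z ^+ 2))%:E) (@infinity_filter R))%E)
  (Q_radial : forall z, Q z = q (normc z))
  (Q_subharmonic : subharmonic_on setT Q)
  (q_fin : forall r, 0 < r -> q r \is a fin_num)
  (q_derivable : forall r, 0 < r -> derivable (fine \o q) r 1)
  (dq_ac : forall a b, 0 < a -> a <= b -> absolutely_continuous_on a b (dq q))
  (rho0_least : is_least
     [set r | 0 <= r /\ forall s, r < s -> 0 < dq q s] rho0)
  (rho1_least : is_least [set r | 0 < r /\ r * dq q r = 2] rho1)
  (rho0_lt : rho0 < rho) (lt_rho1 : rho < rho1)
  (Q_strict : exists U : set R[i]^o,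
     [/\ open U, [set z | normc z = rho] `<=` U & strictly_subharmonic_on U Q])
  (alpha_gt : -1 < alpha)
  (h_smooth : smooth (fun u : R * R => h (of_pair u)))
  (h_radial : forall z, h z = h (normc z)%:C)
  (h_circle : forall z, normc z = rho -> h z = 0)
  (p_circle : normc p = rho)
  (k : nat) (k_gt0 : (0 < k)%N) :
  (forall z : k.-tuple R[i],
     (rescaled_correlation Q q rho alpha h p N z)%:C @[N --> \oo]
       --> (limit_correlation alpha z : R[i]^o)) /\
  (forall K : set R[i]^o, compact K -> K `<=` @half_plane R ->
     forall eps : R, 0 < eps ->
       \forall N \near \oo, forall z : k.-tuple R[i],
         (forall i, K (tnth z i)) ->
         normc ((rescaled_correlation Q q rho alpha h p N z)%:C
                - limit_correlation alpha z) < eps).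
Proof.
split=> [z|K cK KP eps eps0].
  exact: (rescaled_correlation_pointwise Q_gtNy Q_lsc Q_radial Q_subharmonic q_fin q_derivable
    dq_ac rho0_least rho1_least rho0_lt lt_rho1 alpha_gt h_smooth h_radial h_circle p_circle).
apply: (compact_uniform_cvg _ cK KP eps0) => N_ z_ z.
exact: (rescaled_correlation_cvg Q_gtNy Q_lsc Q_radial Q_subharmonic q_fin q_derivable
  dq_ac rho0_least rho1_least rho0_lt lt_rho1 alpha_gt h_smooth h_radial h_circle p_circle).
Qed.
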